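(* Let $n\geq 2$ and put \[a_n=\tfrac{2^{n-1}}{2^n-1}\pi,\quad b_n=\tfrac{2^n}{2^n-1}\pi,\quad c_n=\tfrac{2^{n-1}(2^n-2)}{2^n-1}\pi,\quad d_n=\tfrac{2^{2n-1}}{2^n-1}\pi,\quad e_n=\tfrac{2^n-2}{2^n-1}\pi,\] and $S_n=[-d_n,-c_n]\cup[-b_n,-a_n]\cup[a_n,b_n]\cup[c_n,d_n]$. Let $\psi\in L^2(\mathbb{R})$ with $\operatorname{supp}\hat\psi\subseteq S_n$, and let $b(\xi)=|\hat\psi(\xi)|$. Then $\psi$ is an orthonormal wavelet of $L^2(\mathbb{R})$ if and only if all of the following hold: (i) $b(\xi)=1$ for a.e. $\xi\in[a_n,e_n]\cup[-e_n,-a_n]$; (ii) $b^2(\xi)+b^2(2^{n-1}\xi)=1$ for a.e. $\xi\in[e_n,b_n]$; (iii) $b^2(\xi)+b^2(\xi-2\pi)=1$ for a.e. $\xi\in[e_n,b_n]$; (iv) $b(\xi)=b\big(2^{n-1}(\xi-2\pi)\big)$ for a.e. $\xi\in[e_n,b_n]$; (v) $\hat\psi(\xi)=e^{i\theta(\xi)}b(\xi)$, where the real-valued measurable function $\theta$ satisfies \[\theta(\xi)+\theta\big(2^{n-1}(\xi-2\pi)\big)-\theta(\xi-2\pi)-\theta(2^{n-1}\xi)=(2m(\xi)+1)\pi\] for some $m(\xi)\in\mathbb{Z}$, for a.e. $\xi\in[e_n,b_n]\cap(\operatorname{supp} b)\cap\big(\tfrac{1}{2^{n-1}}\operatorname{supp}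 b\big)$. Moreover, for $n\geq 3$, none of these wavelets is associated with a multiresolution analysis (i.e., none is an MRA-wavelet).
   Context: Fourier transform: $\hat f(\xi)=\int_{\mathbb{R}}f(x)e^{-i\xi x}\,dx$. A function $\psi\in L^2(\mathbb{R})$ is an (orthonormal) wavelet if $\{\psi_{j,k}(x)=2^{j/2}\psi(2^jx-k): j,k\in\mathbb{Z}\}$ is an orthonormal basis of $L^2(\mathbb{R})$. A multiresolution analysis (MRA) is a sequence of closed subspaces $\{V_j\}_{j\in\mathbb{Z}}$ of $L^2(\mathbb{R})$ with $V_j\subset V_{j+1}$, $\bigcup_j V_j$ dense, $\bigcap_j V_j=\{0\}$, $f\in V_j\iff f(2\cdot)\in V_{j+1}$, and some $\varphi\in L^2(\mathbb{R})$ whose integer translates form an orthonormal basis of $V_0$. A wavelet $\psi$ is associated with an MRA (an MRA-wavelet) if the spaces $V_j=\overline{\operatorname{span}}\{\psi_{l,k}: l<j,\ k\in\mathbb{Z}\}$ form an MRA. For a set $A$ and $c>0$, $cA=\{c\xi:\xi\in A\}$. *)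

(* Defs.v *)
(* R : realType, complex numbers R[i] from
   mathcomp-real-closed, Lebesgue measure/integral from mathcomp-analysis. *)
From HB Require Import structures.
From mathcomp Require Import all_boot all_order all_algebra.
From mathcomp Require Import all_classical all_reals all_analysis.
From mathcomp Require Import complex.
Set Implicit Arguments.
Unset Strict Implicit.
Unset Printing Implicit Defensive.
Import Order.TTheory GRing.Theory Num.Theory.
Import numFieldNormedType.Exports.
Local Open Scope classical_set_scope.
Local Open Scope ring_scope.
Local Open Scope complex_scope.

Section Wavelets.
Context {R : realType}.
Local Notation C := (R[i]).
Local Notation leb := (@lebesgue_measure R).

(* |z|^2 and |z| for z : R[i], as reals *)
Definition sqmod (z : C) : R := @complex.Re R z ^+ 2 + @complex.Im R z ^+ 2.
Definition cabs (z : C) : R := Num.sqrt (sqmod z).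

(* e^{i t} *)
Definition expi (t : R) : C := (cos t) +i* (sin t).

(* measurability of a complex-valued function = of its real and imaginary parts *)
Definition cmeasurable (f : R -> C) : Prop :=
  measurable_fun [set: R] (fun x => @complex.Re R (f x)) /\
  measurable_fun [set: R] (fun x => @complex.Im R (f x)).

(* f is (a representative of an element) of L^2(R) *)
Definition L2 : set (R -> C) :=
  [set f | cmeasurable f /\ (\int[leb]_x (sqmod (f x))%:E < +oo)%E].

(* squared L^2 distance ||f - g||_2^2 *)
Definition l2dist2 (f g : R -> C) : \bar R :=
  (\int[leb]_x (sqmod (f x - g x))%:E)%E.

(* Lebesgue integral of a complex-valued function over D *)
Definition cint (D : set R) (f : R -> C) : C :=
  (\int[leb]_(x in D) @complex.Re R (f x))%R +i* (\int[leb]_(x in D) @complex.Im R (f x))%R.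

(* L^2 inner product <f, g> = \int f conj(g) *)
Definition cinner (f g : R -> C) : C := cint setT (fun x => f x * (g x)^*).

(* Fourier(-Plancherel) transform on L^2: Fh is the L^2-limit of the
   truncated transforms  xi |-> \int_{-N}^{N} f(x) e^{-i xi x} dx. *)
Definition fourier_L2 (f Fh : R -> C) : Prop :=
  L2 Fh /\
  (fun N : nat => l2dist2 Fh
       (fun xi => cint `[- (N%:R), N%:R] (fun x => f x * expi (- (xi * x)))))
    @ \oo --> (0 : \bar R)%E.

(* psi_{j,k}(x) = 2^{j/2} psi(2^j x - k) *)
Definition psi_jk (psi : R -> C) (j k : int) : R -> C :=
  fun x => (Num.sqrt ((2 : R) ^ j))%:C * psi ((2 : R) ^ j * x - k%:~R).

Definition orthonormal {I : Type} (e : I -> R -> C) : Prop :=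
  (forall i, L2 (e i)) /\
  (forall i i', (i = i' -> cinner (e i) (e i') = 1) /\
                (i <> i' -> cinner (e i) (e i') = 0)).

(* completeness of the family e in V: only the zero element of V
   (up to a.e. equality) is orthogonal to every e i *)
Definition complete_in {I : Type} (V : set (R -> C)) (e : I -> R -> C) : Prop :=
  forall f, V f -> (forall i, cinner f (e i) = 0) ->
  {ae leb, forall x, f x = 0}.

(* e is an orthonormal basis of the closed subspace V *)
Definition onb_of {I : Type} (V : set (R -> C)) (e : I -> R -> C) : Prop :=
  orthonormal e /\ (forall i, V (e i)) /\ complete_in V e.

Definition is_wavelet (psi : R -> C) : Prop :=
  onb_of L2 (fun jk : int * int => psi_jk psi jk.1 jk.2).

(* finite linear combinations of elements of G *)
Definition lin_span (G : set (R -> C)) : set (R -> C) :=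
  [set f | exists (m : nat) (g : 'I_m -> R -> C) (c : 'I_m -> C),
      (forall i, G (g i)) /\ f = (fun x => \sum_(i < m) c i * g i x)].

(* closure in L^2 *)
Definition closure_L2 (W : set (R -> C)) : set (R -> C) :=
  [set f | L2 f /\ forall eps : R, 0 < eps ->
                  exists g, W g /\ (l2dist2 f g < eps%:E)%E].

Definition closed_subspace (V : set (R -> C)) : Prop :=
  [/\ V `<=` L2, V (fun _ => 0),
      (forall (c : C) f g, V f -> V g -> V (fun x => c * f x + g x))
    & closure_L2 V `<=` V].

(* f = 0 almost everywhere *)
Definition ae_zero (f : R -> C) : Prop := {ae leb, forall x, f x = 0}.

(* multiresolution analysis *)
Definition is_MRA (V : int -> set (R -> C)) : Prop :=
  (forall j, closed_subspace (V j)) /\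
  [/\ (forall j, V j `<=` V (j + 1)),
      closure_L2 (\bigcup_j V j) = L2,
      (forall f, (forall j, V j f) -> ae_zero f),
      (forall j f, V j f <-> V (j + 1) (fun x => f (2 * x)))
    & exists phi : R -> C,
        onb_of (V 0) (fun k : int => fun x => phi (x - k%:~R))].

Definition MRA_wavelet (psi : R -> C) : Prop :=
  is_MRA (fun j => closure_L2 (lin_span
            [set g | exists l k : int, l < j /\ g = psi_jk psi l k])).

(* cA = { c xi : xi in A } *)
Definition scale_set (c : R) (A : set R) : set R := [set c * x | x in A].

(* supp b = { xi | b xi <> 0 } *)
Definition fsupp (b : R -> R) : set R := [set x | b x <> 0].

(* the constants of the theorem *)
Definition a_n (n : nat) : R := (2 : R) ^+ n.-1 / ((2 : R) ^+ n - 1) * pi.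
Definition b_n (n : nat) : R := (2 : R) ^+ n / ((2 : R) ^+ n - 1) * pi.
Definition c_n (n : nat) : R :=
  (2 : R) ^+ n.-1 * ((2 : R) ^+ n - 2) / ((2 : R) ^+ n - 1) * pi.
Definition d_n (n : nat) : R := (2 : R) ^+ (2 * n).-1 / ((2 : R) ^+ n - 1) * pi.
Definition e_n (n : nat) : R := ((2 : R) ^+ n - 2) / ((2 : R) ^+ n - 1) * pi.

Definition S_n (n : nat) : set R :=
  `[- d_n n, - c_n n] `|` `[- b_n n, - a_n n] `|` `[a_n n, b_n n] `|`
  `[c_n n, d_n n].

End Wavelets.

(* Main.v *)
(* By Plancherel, [<f, psi_{j,k}>] is up to a constant the [k]-th Fourier coefficient
   of [F(2^j .) conj(psih)], where [F] is the transform of [f]; so orthonormality and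
   completeness are statements about the sums of such products over the fibres
   [x + 2 pi Z]. With [N = 2^(n-1)], [S_n] meets the fibre of [x] in the point [x] for
   [x] in [+-(a_n, e_n)], in [x] and [x - 2 pi] for [x] in [(e_n, b_n)], and, for the
   same [x], meets the fibre of [N x] in [N x] and [N (x - 2 pi)]. Moreover [S_n] and
   [2^-d S_n], [d >= 1], overlap only when [2^d = N]. Hence [psi] has orthonormal
   dilates and translates iff [|psih| = 1] on [+-(a_n, e_n)] and, on [(e_n, b_n)], the
   matrix with rows [(psih x, psih (x - 2 pi))] and
   [(psih (N x), psih (N (x - 2 pi)))] is unitary; in polar coordinates this is
   (i)-(v). If [f] is orthogonal to all [psi_{j,k}], this matrix kills the vector
   [(F (2^j x), F (2^j (x - 2 pi)))] for every [j], so [F] vanishes on all dilates of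
   [a_n <= |x| <= b_n], that is, everywhere.

   For [n >= 3] we have [a_n < e_n], and [psih (2^j .)] vanishes on
   [(a_n, e_n) + 2 pi Z] for [j >= 1]. So would the transform of every element of
   [V_0], whereas the translates of a scaling function [phi] are orthonormal only if
   [sum_k |phih (x + 2 pi k)|^2 = 1]. *)
Require Import Defs.
From HB Require Import structures.
From mathcomp Require Import all_boot all_order all_algebra.
From mathcomp Require Import all_classical all_reals all_analysis.
From mathcomp Require Import complex.
From mathcomp Require Import measurable_realfun ring lra zify.
Import Order.TTheory GRing.Theory Num.Theory.
Import numFieldNormedType.Exports.
Local Open Scope classical_set_scope.
Local Open Scope ring_scope.
Local Open Scope complex_scope.
Set Implicit Arguments.
Unset Strict Implicit.
Unset Printing Implicit Defensive.

Local Arguments cint : simpl never.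
Local Arguments cinner : simpl never.
Local Arguments expi : simpl never.
Local Arguments conjc : simpl never.

(** The transform is given only as an L^2 limit of truncated integrals, so Plancherel's theorem has
    to come first: Parseval for exponentials on [[- L, L]], integrated over a shift of the
    frequency, proves it for compactly supported functions, and truncation extends it. Parseval and
    the passage from inner products to fibres rest on the same uniqueness statement: an integrable
    function whose moments against all [e^{ikwx}] vanish has integral 0 over every periodised
    interval. Polynomials in a single cosine that converge boundedly to the indicator of an arc give
    this directly.

    The matrix on [(e, b)] comes from two coincidences among the constants. Since [2 pi - e = b],
    translation by [- 2 pi] carries [[e, b]] onto [[- b, - e]]. With [K = N / 2] one has
    [N e = 2 pi K - a] and [N b = 2 pi K + a], so the outer bands are [[- a, a]] moved by [2 pi K]
    and [- 2 pi K], and [x |-> N x - 2 pi K] carries [[e, b]] onto [[- a, a]]. Thus one [x] in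
    [(e, b)] governs both kinds of two-point fibres. *)

Section ComplexL2.
Context {R : realType}.
Local Notation C := R[i].
Local Notation mu := (@lebesgue_measure R).
Local Notation Re := (@complex.Re R).
Local Notation Im := (@complex.Im R).
Implicit Types (z : C) (f g h : R -> C) (A D : set R).

(** * Complex-valued functions *)

Lemma complex_ext z1 z2 : Re z1 = Re z2 -> Im z1 = Im z2 -> z1 = z2.
Proof. by case: z1 z2 => [a b] [c d] /= -> ->. Qed.

Lemma ReM z1 z2 : Re (z1 * z2) = Re z1 * Re z2 - Im z1 * Im z2.
Proof. by case: z1 z2 => [a b] [c d]. Qed.

Lemma ImM z1 z2 : Im (z1 * z2) = Re z1 * Im z2 + Im z1 * Re z2.
Proof. by case: z1 z2 => [a b] [c d]. Qed.

Lemma ReD z1 z2 : Re (z1 + z2) = Re z1 + Re z2.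
Proof. by case: z1 z2 => [a b] [c d]. Qed.

Lemma ImD z1 z2 : Im (z1 + z2) = Im z1 + Im z2.
Proof. by case: z1 z2 => [a b] [c d]. Qed.

Lemma ReN z : Re (- z) = - Re z. Proof. by case: z. Qed.
Lemma ImN z : Im (- z) = - Im z. Proof. by case: z. Qed.
Lemma ReJ z : Re (z^*%C) = Re z. Proof. by case: z. Qed.
Lemma ImJ z : Im (z^*%C) = - Im z. Proof. by case: z. Qed.
Lemma ReR (x : R) : Re (x%:C) = x. Proof. by []. Qed.
Lemma ImR (x : R) : Im (x%:C) = 0. Proof. by []. Qed.
Lemma Re_expi (t : R) : Re (expi t) = cos t. Proof. by []. Qed.
Lemma Im_expi (t : R) : Im (expi t) = sin t. Proof. by []. Qed.
Lemma Re0 : Re 0 = 0. Proof. by []. Qed.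
Lemma Im0 : Im 0 = 0. Proof. by []. Qed.
Lemma Re1 : Re 1 = 1. Proof. by []. Qed.
Lemma Im1 : Im 1 = 0. Proof. by []. Qed.

Lemma conjcD z1 z2 : (z1 + z2)^*%C = z1^*%C + z2^*%C. Proof. exact: rmorphD. Qed.
Lemma conjcM z1 z2 : (z1 * z2)^*%C = z1^*%C * z2^*%C. Proof. exact: rmorphM. Qed.
Lemma conjcN z : (- z)^*%C = - z^*%C. Proof. exact: rmorphN. Qed.

Definition ReIm :=
  (ReM, ImM, ReD, ImD, ReN, ImN, ReJ, ImJ, ReR, ImR, Re_expi, Im_expi,
   Re0, Im0, Re1, Im1).

Lemma sqmodM z1 z2 : sqmod (z1 * z2) = sqmod z1 * sqmod z2.
Proof. by rewrite /sqmod !ReIm; ring. Qed.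

Lemma sqmod_ge0 z : 0 <= sqmod z.
Proof. by rewrite addr_ge0 ?sqr_ge0. Qed.

Lemma sqmodJ z : sqmod z^*%C = sqmod z.
Proof. by rewrite /sqmod !ReIm sqrrN. Qed.

Lemma sqmodN z : sqmod (- z) = sqmod z.
Proof. by rewrite /sqmod !ReIm !sqrrN. Qed.

Lemma sqmod0 : sqmod (0 : C) = 0.
Proof. by rewrite /sqmod !ReIm expr0n addr0. Qed.

Lemma sqmodR (x : R) : sqmod x%:C = x ^+ 2.
Proof. by rewrite /sqmod !ReIm expr0n addr0. Qed.

Lemma sqmod_expi (t : R) : sqmod (expi t) = 1.
Proof. by rewrite /sqmod !ReIm cos2Dsin2. Qed.

Lemma sqmod_eq0 z : sqmod z = 0 -> z = 0.
Proof.
move=> /eqP; rewrite paddr_eq0 ?sqr_ge0// !sqrf_eq0 => /andP[/eqP r /eqP i].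
exact: complex_ext.
Qed.

Lemma mulcJ z : z * z^*%C = (sqmod z)%:C.
Proof. by apply: complex_ext; rewrite /sqmod !ReIm; ring. Qed.

Lemma sqmodD_le z1 z2 : sqmod (z1 + z2) <= 2 * sqmod z1 + 2 * sqmod z2.
Proof.
rewrite -subr_ge0 (_ : _ - _ = sqmod (z1 - z2)) ?sqmod_ge0//.
by rewrite /sqmod !ReIm; ring.
Qed.

Lemma Re_le_sqmod z : Re z ^+ 2 <= sqmod z.
Proof. by rewrite lerDl sqr_ge0. Qed.

Lemma Im_le_sqmod z : Im z ^+ 2 <= sqmod z.
Proof. by rewrite lerDr sqr_ge0. Qed.

Lemma normr_ReM_le z1 z2 : `|Re (z1 * z2)| <= sqmod z1 + sqmod z2.
Proof.
rewrite ler_norml /sqmod !ReIm; case: z1 z2 => [a b] [c d] /=.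
have := (sqr_ge0 (a + c), sqr_ge0 (b - d), sqr_ge0 (a - c), sqr_ge0 (b + d),
         sqr_ge0 a, sqr_ge0 b, sqr_ge0 c, sqr_ge0 d).
rewrite !(sqrrD, sqrrB) => -[[[[[[[]]]]]]] *; apply/andP; split; lra.
Qed.

Lemma normr_ImM_le z1 z2 : `|Im (z1 * z2)| <= sqmod z1 + sqmod z2.
Proof.
have -> : Im (z1 * z2) = - Re (z1 * (z2 * (0 +i* 1))).
  by case: z1 z2 => [a b] [c d] /=; ring.
rewrite normrN (le_trans (normr_ReM_le _ _))// sqmodM lerD2l.
by rewrite {2}/sqmod /= expr0n expr1n add0r mulr1.
Qed.

Lemma expiD (s t : R) : expi (s + t) = expi s * expi t.
Proof. by apply: complex_ext; rewrite !ReIm ?cosD ?sinD//; ring. Qed.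

Lemma expi0 : expi (0 : R) = 1.
Proof. by apply: complex_ext; rewrite !ReIm ?cos0 ?sin0. Qed.

Lemma expiN (t : R) : expi (- t) = (expi t)^*%C.
Proof. by apply: complex_ext; rewrite !ReIm ?cosN ?sinN. Qed.

Lemma expiJ (t : R) : (expi t)^*%C = expi (- t).
Proof. by rewrite expiN. Qed.

Lemma ae_imp (P Q : R -> Prop) :
  {ae mu, forall x, P x} -> (forall x, P x -> Q x) -> {ae mu, forall x, Q x}.
Proof.
move=> [N [mN N0 PN]] PQ; exists N; split => // x nQ; apply: PN.
by apply: contra_not nQ; exact: PQ.
Qed.

Lemma ae_imp2 (P Q S : R -> Prop) :
  {ae mu, forall x, P x} -> {ae mu, forall x, Q x} ->
  (forall x, P x -> Q x -> S x) -> {ae mu, forall x, S x}.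
Proof.
move=> [N [mN N0 PN]] [M [mM M0 QM]] PQS; exists (N `|` M); split.
- exact: measurableU.
- exact: null_set_setU.
- move=> x nS; apply: contrapT => /not_orP[nN nM]; apply: nS; apply: PQS.
    by apply: contrapT => /PN.
  by apply: contrapT => /QM.
Qed.

Lemma ae_and (P Q : R -> Prop) : {ae mu, forall x, P x} -> {ae mu, forall x, Q x} ->
  {ae mu, forall x, P x /\ Q x}.
Proof. by move=> p q; apply: (ae_imp2 p q) => x. Qed.

Lemma aeT (P : R -> Prop) : (forall x, P x) -> {ae mu, forall x, P x}.
Proof. by move=> PT; apply: aeW. Qed.

Lemma cmeasurableD f g : cmeasurable f -> cmeasurable g ->
  cmeasurable (fun x => f x + g x).
Proof.
move=> [rf if_] [rg ig]; split.
- by under eq_fun do rewrite ReD; exact: measurable_funD.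
- by under eq_fun do rewrite ImD; exact: measurable_funD.
Qed.

Lemma cmeasurableM f g : cmeasurable f -> cmeasurable g ->
  cmeasurable (fun x => f x * g x).
Proof.
move=> [rf if_] [rg ig]; split.
- under eq_fun do rewrite ReM.
  by apply: measurable_funB; exact: measurable_funM.
- under eq_fun do rewrite ImM.
  by apply: measurable_funD; exact: measurable_funM.
Qed.

Lemma cmeasurable_cst z : cmeasurable (fun _ => z).
Proof. by split; exact: measurable_cst. Qed.

Lemma cmeasurableN f : cmeasurable f -> cmeasurable (fun x => - f x).
Proof.
move=> [rf if_]; split.
- by under eq_fun do rewrite ReN; exact: measurable_funN.
- by under eq_fun do rewrite ImN; exact: measurable_funN.
Qed.

Lemma cmeasurableB f g : cmeasurable f -> cmeasurable g ->
  cmeasurable (fun x => f x - g x).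
Proof. by move=> mf mg; apply: cmeasurableD => //; exact: cmeasurableN. Qed.

Lemma cmeasurableJ f : cmeasurable f -> cmeasurable (fun x => (f x)^*%C).
Proof.
move=> [rf if_]; split.
- by under eq_fun do rewrite ReJ.
- by under eq_fun do rewrite ImJ; exact: measurable_funN.
Qed.

Lemma cmeasurable_real (h : R -> R) : measurable_fun [set: R] h ->
  cmeasurable (fun x => (h x)%:C).
Proof. by move=> mh; split => //; exact: measurable_cst. Qed.

Lemma cmeasurable_comp f (h : R -> R) : measurable_fun [set: R] h ->
  cmeasurable f -> cmeasurable (fun x => f (h x)).
Proof.
move=> mh [rf if_]; split.
- exact: (measurableT_comp rf).
- exact: (measurableT_comp if_).
Qed.

Lemma measurable_affine (a b : R) : measurable_fun [set: R] (fun x : R => a * x + b).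
Proof. by apply: measurable_funD => //; exact: mulrl_measurable. Qed.

Lemma cmeasurable_expi (h : R -> R) : measurable_fun [set: R] h ->
  cmeasurable (fun x => expi (h x)).
Proof.
move=> mh; split.
- by apply: measurableT_comp mh; apply: continuous_measurable_fun; exact: continuous_cos.
- by apply: measurableT_comp mh; apply: continuous_measurable_fun; exact: continuous_sin.
Qed.

Lemma measurable_sqmod f : cmeasurable f -> measurable_fun [set: R] (fun x => sqmod (f x)).
Proof.
by move=> [rf if_]; apply: measurable_funD; exact: measurable_funX.
Qed.

Lemma Re_cint D f : Re (cint D f) = (\int[mu]_(x in D) Re (f x))%R.
Proof. by []. Qed.

Lemma Im_cint D f : Im (cint D f) = (\int[mu]_(x in D) Im (f x))%R.
Proof. by []. Qed.

Lemma EFin_Rintegrable_scale (a : R) (u : R -> R) :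
  mu.-integrable setT (EFin \o u) ->
  mu.-integrable setT (EFin \o (fun x => a * u x)).
Proof. by move=> /(integrableZl measurableT a). Qed.

Definition cintegrable f :=
  mu.-integrable setT (EFin \o (fun x => Re (f x))) /\
  mu.-integrable setT (EFin \o (fun x => Im (f x))).

Lemma cintegrable_cmeasurable f : cintegrable f -> cmeasurable f.
Proof.
by move=> [/measurable_int/measurable_EFinP ? /measurable_int/measurable_EFinP ?].
Qed.

Lemma le_cintegrable f (h : R -> R) : cmeasurable f ->
  mu.-integrable setT (EFin \o h) ->
  (forall x, `|Re (f x)| <= h x) -> (forall x, `|Im (f x)| <= h x) -> cintegrable f.
Proof.
move=> [mr mi] ih rh iih; split.
- apply: le_integrable ih => //; first exact/measurable_EFinP.
  by move=> x _ /=; rewrite lee_fin (le_trans (rh x))// ler_norm.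
- apply: le_integrable ih => //; first exact/measurable_EFinP.
  by move=> x _ /=; rewrite lee_fin (le_trans (iih x))// ler_norm.
Qed.

Lemma eq_cint D f g : (forall x, D x -> f x = g x) -> cint D f = cint D g.
Proof.
move=> fg; rewrite /cint; congr (_ +i* _);
by apply: eq_Rintegral => x /set_mem Dx; rewrite fg.
Qed.

Lemma cint0 : cint setT (fun=> 0 : C) = 0.
Proof. by rewrite /cint !Rintegral_cst//= !mul0r. Qed.

Lemma cintegrableD f g : cintegrable f -> cintegrable g ->
  cintegrable (fun x => f x + g x).
Proof.
move=> [rf if_] [rg ig]; split.
- rewrite (_ : _ \o _ = (EFin \o (fun x => Re (f x))) \+ (EFin \o (fun x => Re (g x)))).
    exact: integrableD.
  by apply/funext => x /=; rewrite ReD.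
- rewrite (_ : _ \o _ = (EFin \o (fun x => Im (f x))) \+ (EFin \o (fun x => Im (g x)))).
    exact: integrableD.
  by apply/funext => x /=; rewrite ImD.
Qed.

Lemma Rintegrable_lin (a b : R) (u v : R -> R) :
  mu.-integrable setT (EFin \o u) -> mu.-integrable setT (EFin \o v) ->
  mu.-integrable setT (EFin \o (fun x => a * u x + b * v x)).
Proof.
move=> iu iv.
rewrite (_ : _ \o _ = (fun x => a%:E * (EFin \o u) x) \+ (fun x => b%:E * (EFin \o v) x))%E.
  by apply: integrableD => //; exact: integrableZl.
by apply/funext => x /=.
Qed.

Lemma Rintegral_lin (a b : R) (u v : R -> R) :
  mu.-integrable setT (EFin \o u) -> mu.-integrable setT (EFin \o v) ->
  (\int[mu]_x (a * u x + b * v x) = a * (\int[mu]_x u x) + b * (\int[mu]_x v x))%R.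
Proof.
move=> iu iv.
by rewrite RintegralD ?RintegralZl//; exact: EFin_Rintegrable_scale.
Qed.

Lemma cintegrableZ z f : cintegrable f -> cintegrable (fun x => z * f x).
Proof.
move=> [rf if_]; split.
- under eq_fun do rewrite ReM -mulNr; exact: Rintegrable_lin.
- under eq_fun do rewrite ImM; exact: Rintegrable_lin.
Qed.

Lemma cintD f g : cintegrable f -> cintegrable g ->
  cint setT (fun x => f x + g x) = cint setT f + cint setT g.
Proof.
move=> [rf if_] [rg ig]; apply: complex_ext; rewrite ?(ReD, ImD) !(Re_cint, Im_cint).
- by under eq_Rintegral do rewrite ReD; rewrite RintegralD.
- by under eq_Rintegral do rewrite ImD; rewrite RintegralD.
Qed.

Lemma cintZ z f : cintegrable f -> cint setT (fun x => z * f x) = z * cint setT f.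
Proof.
move=> [rf if_]; apply: complex_ext; rewrite ?(ReM, ImM) !(Re_cint, Im_cint).
- by under eq_Rintegral do rewrite ReM -mulNr; rewrite Rintegral_lin// mulNr.
- by under eq_Rintegral do rewrite ImM; rewrite Rintegral_lin.
Qed.

Lemma cintegrableN f : cintegrable f -> cintegrable (fun x => - f x).
Proof. by move=> fi; under eq_fun do rewrite -mulN1r; exact: cintegrableZ. Qed.

Lemma cintN f : cintegrable f -> cint setT (fun x => - f x) = - cint setT f.
Proof. by move=> fi; rewrite -mulN1r -cintZ//; apply: eq_cint => x _; rewrite mulN1r. Qed.

Lemma cintegrableB f g : cintegrable f -> cintegrable g ->
  cintegrable (fun x => f x - g x).
Proof. by move=> fi gi; apply: cintegrableD => //; exact: cintegrableN. Qed.

Lemma cintB f g : cintegrable f -> cintegrable g ->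
  cint setT (fun x => f x - g x) = cint setT f - cint setT g.
Proof. by move=> fi gi; rewrite cintD ?cintN//; exact: cintegrableN. Qed.

Lemma cintJ f : cintegrable f -> cint setT (fun x => (f x)^*%C) = (cint setT f)^*%C.
Proof.
move=> [rf if_]; apply: complex_ext; rewrite ?(ReJ, ImJ) !(Re_cint, Im_cint).
- by under eq_Rintegral do rewrite ReJ.
- by under eq_Rintegral do rewrite ImJ -mulN1r; rewrite RintegralZl// mulN1r.
Qed.

Lemma cintegrable0 : cintegrable (fun=> 0).
Proof. by split; exact: integrable0. Qed.

Lemma cintegrable_sum I (s : seq I) (F : I -> R -> C) :
  (forall i, cintegrable (F i)) -> cintegrable (fun x => \sum_(i <- s) F i x).
Proof.
move=> mF; elim: s => [|i s IH].
  by under eq_fun do rewrite big_nil; exact: cintegrable0.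
by under eq_fun do rewrite big_cons; exact: cintegrableD.
Qed.

Lemma cint_sum I (s : seq I) (F : I -> R -> C) :
  (forall i, cintegrable (F i)) ->
  cint setT (fun x => \sum_(i <- s) F i x) = \sum_(i <- s) cint setT (F i).
Proof.
move=> mF; elim: s => [|i s IH].
  by under eq_fun do rewrite big_nil; rewrite cint0 big_nil.
under eq_fun do rewrite big_cons.
by rewrite cintD ?IH ?big_cons//; exact: cintegrable_sum.
Qed.

Lemma ae_eq_Rintegral (u v : R -> R) : measurable_fun setT u -> measurable_fun setT v ->
  {ae mu, forall x, u x = v x} -> (\int[mu]_x u x = \int[mu]_x v x)%R.
Proof.
move=> mu_ mv uv; congr fine; apply: ae_eq_integral => //; try exact/measurable_EFinP.
by apply: (ae_imp uv) => x -> _.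
Qed.

Lemma ae_eq_cint f g : cmeasurable f -> cmeasurable g ->
  {ae mu, forall x, f x = g x} -> cint setT f = cint setT g.
Proof.
move=> [? ?] [? ?] fg; rewrite /cint; congr (_ +i* _); apply: ae_eq_Rintegral => //;
by apply: (ae_imp fg) => x ->.
Qed.

(** * The space of square integrable functions *)

Lemma affine_preimage_ocitv (a b p q : R) : 0 < a ->
  (fun x => a * x + b) @^-1` `]p, q]%classic = `](p - b) / a, (q - b) / a]%classic.
Proof.
move=> a0; apply/seteqP; split => x /=; rewrite !in_itv/= ltr_pdivrMr// ler_pdivlMr//;
by rewrite ltrBlDr lerBrDr ![_ * a]mulrC.
Qed.

Lemma ge0_integral_affine (a b : R) (u : R -> \bar R) : 0 < a ->
  measurable_fun setT u -> (forall x, 0 <= u x)%E ->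
  (\int[mu]_x u (a * x + b)%R = a^-1%:E * \int[mu]_x u x)%E.
Proof.
move=> a0 mf u0; have mphi := measurable_affine a b.
pose phi : measurableTypeR R -> measurableTypeR R := fun x => a * x + b.
have mphi' : measurable_fun [set: measurableTypeR R] phi by [].
pose m : {measure set (measurableTypeR R) -> \bar R} :=
  measure_function_pushforward__canonical__measure_function_Measure mu mphi'.
(* Lebesgue measure is [a] times its push-forward under the affine map, because the two agree on
   half-open intervals. *)
have E : forall A, measurable A -> mu A = mscale (NngNum (ltW a0)) m A.
  apply: lebesgue_measure_unique => //= _ [[p q]] _ <-.
  rewrite /mscale/= /m/= /pushforward affine_preimage_ocitv//.
  rewrite !lebesgue_measure_itv/= !lte_fin ltr_pM2r ?invr_gt0// ltrD2r.
  case: ifPn => pq; last by rewrite mule0.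
  by rewrite -!EFinB -EFinM; congr EFin; field; rewrite gt_eqF.
have -> : (\int[mu]_x u x = a%:E * \int[mu]_x u (a * x + b)%R)%E.
  rewrite (_ : (\int[mu]_x u x = \int[mscale (NngNum (ltW a0)) m]_x u x)%E); last first.
    by apply: eq_measure_integral => A mA _; exact: E.
  by rewrite ge0_integral_mscale//= /m ge0_integral_pushforward.
by rewrite muleA -EFinM mulVf ?gt_eqF// mul1e.
Qed.

Lemma Rintegrable_affine (a b : R) (u : R -> R) : 0 < a ->
  mu.-integrable setT (EFin \o u) ->
  mu.-integrable setT (EFin \o (fun x => u (a * x + b))).
Proof.
move=> a0 /integrableP[mu_ fu]; apply/integrableP; split.
  by apply: (measurableT_comp mu_); exact: measurable_affine.
rewrite (ge0_integral_affine b (u := fun x => `|(EFin \o u) x|%E))//; last exact: measurableT_comp.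
by rewrite lte_mul_pinfty// ?lee_fin ?invr_ge0 ?ltW.
Qed.

Lemma Rintegral_affine (a b : R) (u : R -> R) : 0 < a ->
  mu.-integrable setT (EFin \o u) ->
  (\int[mu]_x u (a * x + b) = a^-1 * \int[mu]_x u x)%R.
Proof.
move=> a0 iu; have mu_ := measurable_int _ iu.
rewrite /Rintegral integralE [in RHS]integralE.
have ip := integrable_pos_fin_num measurableT iu.
have in_ := integrable_neg_fin_num measurableT iu.
have := ge0_integral_affine b a0 (measurable_funepos mu_) (fun=> funepos_ge0 _ _).
have := ge0_integral_affine b a0 (measurable_funeneg mu_) (fun=> funeneg_ge0 _ _).
rewrite [X in fine (X - _)%E = _](_ : _ = \int[mu]_x (EFin \o u)^\+%E (a * x + b)%R)%E//.
rewrite [X in fine (_ - X)%E = _](_ : _ = \int[mu]_x (EFin \o u)^\-%E (a * x + b)%R)%E//.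
move=> -> ->.
- rewrite -muleBr ?fin_num_adde_defr// fineM// fin_numB.
  by apply/andP.
- by apply: eq_integral => x _; rewrite -[RHS]/(((EFin \o u)^\- \o (fun x => a * x + b)%R)%E x) -funeneg_comp.
- by apply: eq_integral => x _; rewrite -[RHS]/(((EFin \o u)^\+ \o (fun x => a * x + b)%R)%E x) -funepos_comp.
Qed.

Lemma cintegrable_affine (a b : R) f : 0 < a ->
  cintegrable f -> cintegrable (fun x => f (a * x + b)).
Proof.
by move=> a0 [r i]; split; [exact: (Rintegrable_affine _ _ r)|exact: (Rintegrable_affine _ _ i)].
Qed.

Lemma cint_affine (a b : R) f : 0 < a -> cintegrable f ->
  cint setT (fun x => f (a * x + b)) = (a^-1)%:C * cint setT f.
Proof.
move=> a0 [r i]; apply: complex_ext; rewrite (ReM, ImM) !(Re_cint, Im_cint) ReR ImR mul0r ?subr0 ?addr0.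
- exact: (Rintegral_affine _ a0 r).
- exact: (Rintegral_affine _ a0 i).
Qed.

(** Real-valued for the sake of arithmetic. An infinite integral becomes 0 here, so a bound on
    [nrm2] carries information only together with membership in [L2]. *)
Definition nrm2 f : R := (\int[mu]_x sqmod (f x))%R.

Lemma L2P f : L2 f <->
  cmeasurable f /\ mu.-integrable setT (EFin \o (fun x => sqmod (f x))).
Proof.
split=> -[mf fi]; split => //.
- apply/integrableP; split; first by apply/measurable_EFinP; exact: measurable_sqmod.
  by under eq_integral do rewrite /= ger0_norm ?sqmod_ge0//.
- have /integrableP[_] := fi.
  by under eq_integral do rewrite /= ger0_norm ?sqmod_ge0//.
Qed.

Lemma L2_cmeasurable f : L2 f -> cmeasurable f. Proof. by case. Qed.

Lemma L2_sqmod_integrable f : L2 f -> mu.-integrable setT (EFin \o (fun x => sqmod (f x))).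
Proof. by move=> /L2P[]. Qed.

Lemma nrm2E f : L2 f -> ((nrm2 f)%:E = \int[mu]_x (sqmod (f x))%:E)%E.
Proof.
move=> Lf; rewrite /nrm2 /Rintegral fineK//.
exact: (integrable_fin_num measurableT (L2_sqmod_integrable Lf)).
Qed.

Lemma nrm2_ge0 f : 0 <= nrm2 f.
Proof. by apply: Rintegral_ge0 => x _; exact: sqmod_ge0. Qed.

Lemma le_L2 f (u : R -> R) : cmeasurable f -> mu.-integrable setT (EFin \o u) ->
  (forall x, sqmod (f x) <= u x) -> L2 f.
Proof.
move=> mf iu fu; apply/L2P; split => //; apply: le_integrable iu => //.
  by apply/measurable_EFinP; exact: measurable_sqmod.
by move=> x _ /=; rewrite lee_fin ger0_norm ?sqmod_ge0// (le_trans (fu x))// ler_norm.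
Qed.

Lemma L2D f g : L2 f -> L2 g -> L2 (fun x => f x + g x).
Proof.
move=> Lf Lg; apply: (@le_L2 _ (fun x => 2 * sqmod (f x) + 2 * sqmod (g x))).
- by apply: cmeasurableD; exact: L2_cmeasurable.
- by apply: Rintegrable_lin; exact: L2_sqmod_integrable.
- by move=> x; exact: sqmodD_le.
Qed.

Lemma L2M_bounded f g (M : R) : L2 f -> cmeasurable g ->
  (forall x, sqmod (g x) <= M) -> L2 (fun x => g x * f x).
Proof.
move=> Lf mg gM; apply: (@le_L2 _ (fun x => M * sqmod (f x))).
- by apply: cmeasurableM => //; exact: L2_cmeasurable.
- by apply: EFin_Rintegrable_scale; exact: L2_sqmod_integrable.
- by move=> x; rewrite sqmodM ler_wpM2r ?sqmod_ge0.
Qed.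

Lemma L2Z z f : L2 f -> L2 (fun x => z * f x).
Proof.
move=> Lf; apply: (L2M_bounded (g := fun=> z) (M := sqmod z)) => //.
Qed.

Lemma L2N f : L2 f -> L2 (fun x => - f x).
Proof. by move=> Lf; under eq_fun do rewrite -mulN1r; exact: L2Z. Qed.

Lemma L2B f g : L2 f -> L2 g -> L2 (fun x => f x - g x).
Proof. by move=> Lf Lg; apply: L2D => //; exact: L2N. Qed.

Lemma L2_0 : L2 (fun _ : R => 0 : C).
Proof.
apply/L2P; split; first exact: cmeasurable_cst.
rewrite (_ : _ \o _ = cst 0%E); first exact: integrable0.
by apply/funext => x /=; rewrite sqmod0.
Qed.

Lemma L2_sum I (s : seq I) (F : I -> R -> C) :
  (forall i, L2 (F i)) -> L2 (fun x => \sum_(i <- s) F i x).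
Proof.
move=> mF; elim: s => [|i s IH].
  by under eq_fun do rewrite big_nil; exact: L2_0.
by under eq_fun do rewrite big_cons; exact: L2D.
Qed.

Lemma L2_affine (a b : R) f : 0 < a -> L2 f -> L2 (fun x => f (a * x + b)).
Proof.
move=> a0 /L2P[mf fi]; apply/L2P; split.
  by apply: (cmeasurable_comp _ mf); exact: measurable_affine.
exact: (Rintegrable_affine _ a0 fi).
Qed.

Lemma nrm2_affine (a b : R) f : 0 < a -> L2 f ->
  nrm2 (fun x => f (a * x + b)) = a^-1 * nrm2 f.
Proof. by move=> a0 /L2_sqmod_integrable fi; exact: (Rintegral_affine _ a0 fi). Qed.

Lemma L2_mul_cintegrable f g : L2 f -> L2 g -> cintegrable (fun x => f x * (g x)^*%C).
Proof.
move=> Lf Lg; apply: (@le_cintegrable _ (fun x => 1 * sqmod (f x) + 1 * sqmod (g x))).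
- by apply: cmeasurableM; [|apply: cmeasurableJ]; exact: L2_cmeasurable.
- by apply: Rintegrable_lin; exact: L2_sqmod_integrable.
- by move=> x; rewrite !mul1r -(sqmodJ (g x)); exact: normr_ReM_le.
- by move=> x; rewrite !mul1r -(sqmodJ (g x)); exact: normr_ImM_le.
Qed.

Lemma cinnerE f g : cinner f g = cint setT (fun x => f x * (g x)^*%C).
Proof. by []. Qed.

Lemma cinnerDl f g h : L2 f -> L2 g -> L2 h ->
  cinner (fun x => f x + g x) h = cinner f h + cinner g h.
Proof.
move=> Lf Lg Lh; rewrite /cinner -cintD; [|exact: L2_mul_cintegrable..].
by apply: eq_cint => x _; rewrite mulrDl.
Qed.

Lemma cinnerZl z f h : L2 f -> L2 h ->
  cinner (fun x => z * f x) h = z * cinner f h.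
Proof.
move=> Lf Lh; rewrite /cinner -cintZ; last exact: L2_mul_cintegrable.
by apply: eq_cint => x _; rewrite mulrA.
Qed.

Lemma cinnerC f g : L2 f -> L2 g -> cinner f g = (cinner g f)^*%C.
Proof.
move=> Lf Lg; rewrite !cinnerE -cintJ; last exact: L2_mul_cintegrable.
by apply: eq_cint => x _; rewrite conjcM conjcK mulrC.
Qed.

Lemma cinnerDr f g h : L2 f -> L2 g -> L2 h ->
  cinner h (fun x => f x + g x) = cinner h f + cinner h g.
Proof.
move=> Lf Lg Lh; rewrite cinnerC//; last exact: L2D.
by rewrite cinnerDl// conjcD -(cinnerC Lh Lf) -(cinnerC Lh Lg).
Qed.

Lemma cinnerZr z f h : L2 f -> L2 h ->
  cinner h (fun x => z * f x) = z^*%C * cinner h f.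
Proof.
move=> Lf Lh; rewrite cinnerC//; last exact: L2Z.
by rewrite cinnerZl// conjcM -(cinnerC Lh Lf).
Qed.

Lemma cinnerNl f h : L2 f -> L2 h -> cinner (fun x => - f x) h = - cinner f h.
Proof.
move=> Lf Lh; rewrite -mulN1r -cinnerZl//.
by apply: eq_cint => x _; rewrite mulN1r.
Qed.

Lemma cinnerBl f g h : L2 f -> L2 g -> L2 h ->
  cinner (fun x => f x - g x) h = cinner f h - cinner g h.
Proof. by move=> Lf Lg Lh; rewrite cinnerDl// ?cinnerNl//; exact: L2N. Qed.

Lemma cinner_suml I (s : seq I) (F : I -> R -> C) h : (forall i, L2 (F i)) -> L2 h ->
  cinner (fun x => \sum_(i <- s) F i x) h = \sum_(i <- s) cinner (F i) h.
Proof.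
move=> LF Lh; rewrite /cinner -cint_sum => [|i]; last exact: L2_mul_cintegrable.
by apply: eq_cint => x _; rewrite mulr_suml.
Qed.

Lemma cinner_nrm2 f : L2 f -> cinner f f = (nrm2 f)%:C.
Proof.
move=> Lf; apply: complex_ext; rewrite (ReR, ImR) (Re_cint, Im_cint).
- by apply: eq_Rintegral => x _; rewrite mulcJ.
- under eq_Rintegral do rewrite [_ * _]mulcJ ImR.
  by rewrite Rintegral_cst// mul0r.
Qed.

Lemma ReB z1 z2 : Re (z1 - z2) = Re z1 - Re z2. Proof. by rewrite ReD ReN. Qed.

Lemma nrm2D f g : L2 f -> L2 g ->
  nrm2 (fun x => f x + g x) = nrm2 f + nrm2 g + 2 * Re (cinner f g).
Proof.
move=> Lf Lg; rewrite -[LHS]ReR -cinner_nrm2; last exact: L2D.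
rewrite cinnerDl ?cinnerDr//; [|exact: L2D].
rewrite (cinner_nrm2 Lf) (cinner_nrm2 Lg) (cinnerC Lg Lf) !ReD ReJ; set a := Re (cinner _ _).
by rewrite /=; ring.
Qed.

Lemma nrm2Z z f : L2 f -> nrm2 (fun x => z * f x) = sqmod z * nrm2 f.
Proof.
move=> Lf; rewrite /nrm2 -RintegralZl//; last exact: L2_sqmod_integrable.
by apply: eq_Rintegral => x _; rewrite sqmodM.
Qed.

Lemma nrm2N f : nrm2 (fun x => - f x) = nrm2 f.
Proof. by apply: eq_Rintegral => x _; rewrite sqmodN. Qed.

Lemma nrm2B f g : L2 f -> L2 g ->
  nrm2 (fun x => f x - g x) = nrm2 f + nrm2 g - 2 * Re (cinner f g).
Proof.
move=> Lf Lg; rewrite nrm2D//; last exact: L2N.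
rewrite nrm2N (cinnerC Lf (L2N Lg)) cinnerNl// conjcN -(cinnerC Lf Lg).
by rewrite ReN mulrN.
Qed.

Lemma nrm2_subC f g : nrm2 (fun x => f x - g x) = nrm2 (fun x => g x - f x).
Proof. by apply: eq_Rintegral => x _; rewrite -sqmodN opprB. Qed.

Lemma eq_nrm2 f g : (forall x, f x = g x) -> nrm2 f = nrm2 g.
Proof. by move=> fg; apply: eq_Rintegral => x _; rewrite fg. Qed.

Lemma le_nrm2 f g : cmeasurable f -> L2 g ->
  (forall x, sqmod (f x) <= sqmod (g x)) -> nrm2 f <= nrm2 g.
Proof.
move=> mf Lg fg; apply: le_Rintegral => //; last exact: L2_sqmod_integrable.
apply: L2_sqmod_integrable; apply: (le_L2 mf _ fg); exact: L2_sqmod_integrable.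
Qed.

Lemma nrm2D_le f g : L2 f -> L2 g ->
  nrm2 (fun x => f x + g x) <= 2 * nrm2 f + 2 * nrm2 g.
Proof.
move=> Lf Lg; rewrite -Rintegral_lin; [|exact: L2_sqmod_integrable..].
apply: le_Rintegral => //; first by apply: L2_sqmod_integrable; exact: L2D.
  by apply: Rintegrable_lin; exact: L2_sqmod_integrable.
by move=> x _; exact: sqmodD_le.
Qed.

Lemma nrm2_triangle f g h : L2 f -> L2 g -> L2 h ->
  nrm2 (fun x => f x - h x) <=
  2 * nrm2 (fun x => f x - g x) + 2 * nrm2 (fun x => g x - h x).
Proof.
move=> Lf Lg Lh; rewrite (_ : nrm2 _ = nrm2 (fun x => (f x - g x) + (g x - h x))).
  by apply: nrm2D_le; exact: L2B.
by apply: eq_nrm2 => x; rewrite addrA subrK.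
Qed.

Lemma nrm2_eq0 f : L2 f -> nrm2 f = 0 -> {ae mu, forall x, f x = 0}.
Proof.
move=> Lf n0.
have : (\int[mu]_x `|(sqmod (f x))%:E| = 0)%E.
  under eq_integral do rewrite gee0_abs ?lee_fin ?sqmod_ge0//.
  by rewrite -nrm2E// n0.
move/ae_eq_integral_abs => H.
have : ae_eq mu setT (fun x => (sqmod (f x))%:E) (cst 0%E).
  apply: H => //; apply/measurable_EFinP; apply: measurable_sqmod.
  exact: L2_cmeasurable.
move=> h0; apply: (ae_imp h0) => x /(_ Logic.I) [] /= h.
exact: sqmod_eq0.
Qed.

Lemma ae_eq_nrm2 f g : cmeasurable f -> cmeasurable g ->
  {ae mu, forall x, f x = g x} -> nrm2 f = nrm2 g.
Proof.
move=> mf mg fg; apply: ae_eq_Rintegral; [exact: measurable_sqmod..|].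
by apply: (ae_imp fg) => x ->.
Qed.

(* The discriminant of [t |-> || f - t <f,g> g ||^2] is nonpositive. *)
Lemma cauchy_schwarz f g : L2 f -> L2 g -> sqmod (cinner f g) <= nrm2 f * nrm2 g.
Proof.
move=> Lf Lg; set c := cinner f g.
have key (t : R) : 0 <= nrm2 f + t ^+ 2 * (sqmod c * nrm2 g) - 2 * t * sqmod c.
  have := nrm2_ge0 (fun x => f x - (t%:C * c) * g x).
  rewrite nrm2B//; last exact: L2Z.
  rewrite nrm2Z// cinnerZr// -/c sqmodM sqmodR conjcM conjc_real.
  rewrite (_ : Re _ = t * sqmod c); last first.
    by rewrite -mulrA [_^*%C * _]mulrC mulcJ !ReM !ReR ImR mulr0 subr0.
  by rewrite !mulrA.
have c0 := sqmod_ge0 c; have f0 := nrm2_ge0 f; have g0 := nrm2_ge0 g.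
have [gz|gz] := eqVneq (nrm2 g) 0.
  rewrite gz mulr0.
  have [->//|cz] := eqVneq (sqmod c) 0.
  have cp : 0 < sqmod c by rewrite lt_neqAle eq_sym cz.
  (* The quadratic term has disappeared, and this [t] makes the remaining affine expression equal to
     -1. *)
  have := key ((nrm2 f + 1) / (2 * sqmod c)).
  rewrite gz !mulr0 addr0 (_ : 2 * _ * _ = nrm2 f + 1); last first.
    by field; rewrite gt_eqF.
  by rewrite opprD addrA subrr sub0r oppr_ge0 ler10.
have gp : 0 < nrm2 g by rewrite lt_neqAle eq_sym gz.
have := key (nrm2 g)^-1.
rewrite (_ : _ + _ - _ = nrm2 f - sqmod c / nrm2 g); last by field.
by rewrite subr_ge0 ler_pdivrMr.
Qed.

Lemma l2dist2E f g : L2 f -> L2 g -> l2dist2 f g = (nrm2 (fun x => f x - g x))%:E.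
Proof. by move=> Lf Lg; rewrite nrm2E//; exact: L2B. Qed.

(** * Completeness of L^2 and Parseval's identity *)

Lemma sqmod_cvg (u : nat -> C) (z w : C) :
  (Re (u k) @[k --> \oo] --> Re z) -> (Im (u k) @[k --> \oo] --> Im z) ->
  sqmod (w - u k) @[k --> \oo] --> sqmod (w - z).
Proof.
move=> ur ui; rewrite /sqmod ReB ImD ImN.
under eq_fun do rewrite ReB ImD ImN.
apply: cvgD; rewrite expr2; under eq_fun do rewrite expr2.
- by apply: cvgM; apply: cvgB => //; exact: cvg_cst.
- by apply: cvgM; apply: cvgB => //; exact: cvg_cst.
Qed.

Lemma limn_einf_le (u : (\bar R)^nat) (c : \bar R) K :
  (forall k, (K <= k)%N -> (u k <= c)%E) -> (limn_einf u <= c)%E.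
Proof.
move=> uc; rewrite limn_einf_lim; apply: lime_le; first exact: is_cvg_einfs.
apply: nearW => n; apply: (@le_trans _ _ (u (maxn n K))); last by rewrite uc// leq_maxr.
by apply: ereal_inf_lbound; exists (maxn n K) => //=; rewrite leq_maxl.
Qed.

(* Half of the Riesz-Fischer argument: [|a_k| <= 2^-k (1 + M)] once [4^k a_k^2 <= M]. *)
Lemma cvg_fast_increments (u : R^nat) (M : R) :
  (forall k, 4 ^+ k * (u k.+1 - u k) ^+ 2 <= M) -> cvgn u.
Proof.
move=> uM.
have M0 : 0 <= M by apply: le_trans (uM 0); rewrite expr0 mul1r sqr_ge0.
have B k : `|u k.+1 - u k| <= geometric (1 + M) 2^-1 k.
  have p2 : (0 : R) < 2 ^+ k by rewrite exprn_gt0.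
  have := uM k; set t := u k.+1 - u k; rewrite /geometric/= => tM.
  rewrite exprVn ler_pdivlMr//.
  have E : 4 ^+ k = 2 ^+ k * 2 ^+ k :> R by rewrite -exprMn; congr (_ ^+ _); lra.
  have : 0 <= (2 ^+ k * `|t| - 1) ^+ 2 by exact: sqr_ge0.
  rewrite sqrrB expr1n mulr1 exprMn real_normK ?num_real// expr2 -E.
  have : 0 <= 2 ^+ k * `|t| by rewrite mulr_ge0// ltW.
  by rewrite mulr2n; lra.
have cs : cvgn (series (telescope u)).
  apply: normed_cvg; apply: (series_le_cvg _ _ B) => //.
  - by move=> k; rewrite mulr_ge0// ?exprn_ge0// ?invr_ge0// addr_ge0.
  - by apply: is_cvg_geometric_series; rewrite ger0_norm ?invr_ge0// invf_lt1// ltr1n.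
rewrite (_ : u = series (telescope u) \+ cst (u 0)); first by apply: is_cvgD => //; exact: is_cvg_cst.
by apply/funext => k; rewrite telescopeK /= subrK.
Qed.

(** Riesz-Fischer: a subsequence with fast decreasing increments converges almost everywhere, and
    Fatou's lemma carries the Cauchy estimates over to the limit. *)
Lemma L2_complete (F : nat -> R -> C) : (forall n, L2 (F n)) ->
  (forall eps, 0 < eps -> exists N, forall m n, (N <= m)%N -> (N <= n)%N ->
    nrm2 (fun x => F m x - F n x) < eps) ->
  exists2 f, L2 f & nrm2 (fun x => F n x - f x) @[n --> \oo] --> 0.
Proof.
move=> LF Cau.
(* The first factor cancels the weight [4^k] in [W]; the second ones sum to 1. *)
pose e k : R := (4 ^+ k)^-1 * (1 / (2 ^ (k + 1))%N%:R).
have e0 k : 0 < e k by rewrite mulr_gt0 ?invr_gt0 ?exprn_gt0// divr_gt0// ltr0n expn_gt0.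
have /choice[N NP] : forall k, exists N, forall m n, (N <= m)%N -> (N <= n)%N ->
    nrm2 (fun x => F m x - F n x) < e k by move=> k; exact: Cau.
(* Summing the thresholds makes the indices monotone; the summand [k] makes them unbounded. *)
pose s k := (k + \sum_(i < k.+1) N i)%N.
have sN k : (N k <= s k)%N by rewrite /s big_ord_recr /= addnA leq_addl.
have sS k : (s k <= s k.+1)%N.
  rewrite /s [X in (_ <= _ + X)%N]big_ord_recr /= addnA.
  by apply: leq_trans (leq_addr _ _); rewrite leq_add2r.
have sk k : (k <= s k)%N by exact: leq_addr.
pose G k := F (s k); have LG k : L2 (G k) by exact: LF.
have GB k : nrm2 (fun x => G k.+1 x - G k x) < e k.
  by apply: NP => //; exact: leq_trans (sS k).
pose W k x : \bar R := (4 ^+ k * sqmod (G k.+1 x - G k x))%:E.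
have W0 k x : (0 <= W k x)%E by rewrite lee_fin mulr_ge0 ?exprn_ge0 ?sqmod_ge0.
have mW k : measurable_fun setT (W k).
  apply/measurable_EFinP; apply: measurable_funM; first exact: measurable_cst.
  by apply: measurable_sqmod; apply: cmeasurableB; exact: L2_cmeasurable.
pose T x : \bar R := (\sum_(k <oo) W k x)%E.
have T0 x : (0 <= T x)%E by apply: nneseries_ge0 => k _ _.
have mT : measurable_fun setT T.
  by apply: ge0_emeasurable_sum => // k x _ _.
have iT : mu.-integrable setT T.
  apply/integrableP; split => //.
  under eq_integral do rewrite gee0_abs//.
  rewrite /T integral_nneseries//.
  apply: (@le_lt_trans _ _ (\sum_(k <oo) (1 / (2 ^ (k + 1))%N%:R : R)%:E)%E).
    apply: lee_nneseries => [k _ _|k _]; first exact: integral_ge0.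
    rewrite /W; under eq_integral do rewrite EFinM.
    rewrite ge0_integralZl ?lee_fin ?exprn_ge0//; last 2 first.
    - apply/measurable_EFinP; apply: measurable_sqmod; apply: cmeasurableB; exact: L2_cmeasurable.
    - by move=> x _; rewrite lee_fin sqmod_ge0.
    rewrite -nrm2E; last exact: L2B.
    rewrite -EFinM lee_fin mulrC -ler_pdivlMr ?exprn_gt0// mulrC.
    exact/ltW/GB.
  have /cvg_lim -> // := @cvg_geometric_eseries_half R 1 0.
  by rewrite ltry.
pose E := [set x | T x \is a fin_num].
have mE : measurable E by rewrite -[E]setTI; exact: emeasurable_fin_num.
have aeE : {ae mu, forall x, E x} by apply: (ae_imp (integrable_ae measurableT iT)) => x; exact.
pose H k x := (\1_E x : R)%:C * G k x.
have HE k x : E x -> H k x = G k x by move=> Ex; rewrite /H indicE mem_set// mul1r.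
have HNE k x : ~ E x -> H k x = 0 by move=> Ex; rewrite /H indicE memNset// mul0r.
have mH k : cmeasurable (H k).
  by apply: cmeasurableM; [apply: cmeasurable_real|exact: L2_cmeasurable].
have TM x k : E x -> 4 ^+ k * sqmod (G k.+1 x - G k x) <= fine (T x).
  move=> Ex; rewrite -lee_fin fineK//.
  have := @nneseries_lim_ge R (W ^~ x) xpredT 0 k.+1 (fun n _ _ => W0 n x).
  apply: le_trans; rewrite big_nat_recr//= leeDr//.
  by apply: sume_ge0 => i _.
have cH (P : C -> R) : (forall z, P z ^+ 2 <= sqmod z) -> (forall z w, P (z - w) = P z - P w) ->
    forall x, cvgn (fun k => P (H k x)).
  move=> Psq PB x; have [Ex|NEx] := pselect (E x); last first.
    by under eq_fun do rewrite HNE//; exact: is_cvg_cst.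
  under eq_fun do rewrite HE//.
  apply: (@cvg_fast_increments _ (fine (T x))) => k.
  by rewrite -PB (le_trans _ (TM x k Ex))// ler_wpM2l ?exprn_ge0.
have cr := cH Re Re_le_sqmod ReB.
have ci : forall x, cvgn (fun k => Im (H k x)).
  by apply: cH => [|z w]; [exact: Im_le_sqmod|rewrite ImD ImN].
pose f x : C := limn (fun k => Re (H k x)) +i* limn (fun k => Im (H k x)).
have mf : cmeasurable f.
  split.
  - by apply: (@measurable_fun_cvg _ _ _ _ (fun k x => Re (H k x))) => [k|x _]; [case: (mH k)|exact: cr].
  - by apply: (@measurable_fun_cvg _ _ _ _ (fun k x => Im (H k x))) => [k|x _]; [case: (mH k)|exact: ci].
(* Fatou's lemma. It serves twice: to show that [f] is in [L2], and for the convergence. *)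
have bnd n c K : (forall k, (K <= k)%N -> nrm2 (fun x => F n x - G k x) <= c) ->
    (\int[mu]_x (sqmod (F n x - f x))%:E <= c%:E)%E.
  move=> Kc.
  have -> : (\int[mu]_x (sqmod (F n x - f x))%:E =
             \int[mu]_x limn_einf (fun k => (sqmod (F n x - H k x))%:E))%E.
    apply: eq_integral => x _; apply/esym.
    apply: (cvg_limn_einf_sup _).1; apply/cvg_EFin; first exact: nearW.
    exact: (@sqmod_cvg (fun k => H k x) (f x) (F n x) (cr x) (ci x)).
  apply: le_trans (fatou _ _ _ _) _ => //.
  - move=> k; apply/measurable_EFinP; apply: measurable_sqmod.
    by apply: cmeasurableB => //; exact: L2_cmeasurable.
  - by move=> k x _; rewrite lee_fin sqmod_ge0.
  apply: (@limn_einf_le _ _ K) => k Kk.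
  have -> : (\int[mu]_x (sqmod (F n x - H k x))%:E = \int[mu]_x (sqmod (F n x - G k x))%:E)%E.
    apply: ae_eq_integral => //.
    - apply/measurable_EFinP; apply: measurable_sqmod.
      by apply: cmeasurableB => //; exact: L2_cmeasurable.
    - apply/measurable_EFinP; apply: measurable_sqmod.
      by apply: cmeasurableB => //; exact: L2_cmeasurable.
    - by apply: (ae_imp aeE) => x Ex _; rewrite HE.
  by rewrite -nrm2E ?lee_fin ?Kc//; exact: L2B.
have mFf n : cmeasurable (fun x => F n x - f x).
  by apply: cmeasurableB => //; exact: L2_cmeasurable.
have Lf : L2 f.
  rewrite (_ : f = fun x => F (N 0%N) x - (F (N 0%N) x - f x)); last first.
    by apply/funext => x; rewrite opprB addrC subrK.
  apply: L2B => //; split => //.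
  apply: le_lt_trans (bnd _ (e 0%N) (N 0%N) _) _; last exact: ltry.
  by move=> k Kk; apply/ltW/NP => //; exact: leq_trans (sk k).
exists f => //.
apply/cvgrPdist_le => eps eps0; have [K KP] := Cau _ eps0.
near=> n; rewrite sub0r normrN ger0_norm ?nrm2_ge0//.
rewrite -lee_fin nrm2E; last exact: L2B.
apply: (bnd _ _ K) => k Kk; apply/ltW/KP; last exact: leq_trans (sk k).
by near: n; exact: nbhs_infty_ge.
Unshelve. all: by end_near. Qed.

Section Parseval.
Variables (e : nat -> R -> C) (f : R -> C).
Hypotheses (oe : Defs.orthonormal e) (Lf : L2 f).
Let Le i : L2 (e i). Proof. by have [] := oe. Qed.
Let ee i j : cinner (e i) (e j) = (i == j)%:R.
Proof. by have [_ /(_ i j)[h1 h2]] := oe; case: eqP => [/h1|/h2]. Qed.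
Let c i := cinner f (e i).
Let s n x := \sum_(i < n) c i * e i x.
Let sigma n : R := \sum_(i < n) sqmod (c i).

Let Ls n : L2 (s n).
Proof. by apply: L2_sum => i; exact: L2Z. Qed.

Let cinner_s n g : L2 g -> cinner (s n) g = \sum_(i < n) c i * (cinner g (e i))^*%C.
Proof.
move=> Lg; rewrite cinner_suml// => [|i]; last exact: L2Z.
by apply: eq_bigr => i _; rewrite cinnerZl// (cinnerC (Le i) Lg).
Qed.

Let cinner_se n j : (j < n)%N -> cinner (s n) (e j) = c j.
Proof.
move=> jn; rewrite cinner_s// (bigD1 (Ordinal jn))//= ee eqxx conjc1 mulr1.
rewrite big1 ?addr0// => i /eqP ij; rewrite ee eq_sym.
by case: eqP => [ji|]; [case: ij; apply: val_inj|rewrite conjc0 mulr0].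
Qed.

Let cinner_s_sigma n g : L2 g -> (forall i, (i < n)%N -> cinner g (e i) = c i) ->
  cinner (s n) g = (sigma n)%:C.
Proof.
move=> Lg gc; rewrite cinner_s// /sigma rmorph_sum/=.
by apply: eq_bigr => i _; rewrite gc// mulcJ.
Qed.

Let nrm2_s n : nrm2 (s n) = sigma n.
Proof.
by apply: complexI; rewrite -cinner_nrm2// cinner_s_sigma// => i; exact: cinner_se.
Qed.

(** Pythagoras for any [g] sharing the first [n] coefficients of [f]: applied to [f] it is Bessel's
    inequality, to a later partial sum the Cauchy property, and to the limit it computes the
    norm. *)
Let nrm2_sB n g : L2 g -> (forall i, (i < n)%N -> cinner g (e i) = c i) ->
  nrm2 (fun x => s n x - g x) = nrm2 g - sigma n.
Proof. by move=> Lg gc; rewrite nrm2B// cinner_s_sigma// nrm2_s ReR; ring. Qed.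

Let sigma_le n : sigma n <= nrm2 f.
Proof. by rewrite -subr_ge0 -nrm2_sB ?nrm2_ge0. Qed.

Let sigma_nd : {homo sigma : m n / (m <= n)%N >-> m <= n}.
Proof.
move=> m n mn; rewrite /sigma -!(big_mkord xpredT (fun i => sqmod (c i))).
by rewrite (big_cat_nat _ mn)//= lerDl sumr_ge0// => i _; exact: sqmod_ge0.
Qed.

Let sigma_cvg : cvgn sigma.
Proof.
apply: nondecreasing_is_cvgn; first exact: sigma_nd.
by exists (nrm2 f) => _ [n _ <-].
Qed.

Let s_limit : exists2 h, L2 h & nrm2 (fun x => s n x - h x) @[n --> \oo] --> 0.
Proof.
apply: L2_complete => // eps eps0.
have /cvgrPdist_lt /(_ _ eps0) [N _ NP] := sigma_cvg.
exists N => m n.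
wlog mn : m n / (m <= n)%N.
  move=> W Nm Nn; have [/W|/ltnW /W] := leqP m n; first exact.
  by rewrite nrm2_subC; exact.
move=> Nm Nn; rewrite nrm2_sB//; last by move=> i im; apply: cinner_se; exact: leq_trans mn.
rewrite nrm2_s; have := NP m Nm => /=; rewrite ltr_distlC => /andP[+ _].
have := nondecreasing_cvgn_le sigma_nd sigma_cvg n; lra.
Qed.

(** The hypothesis asks less than completeness in [L2]: exponentials cut off to an interval satisfy
    it for [f] supported there, though they do not span [L2]. The limit [h] of the partial sums has
    the coefficients of [f], so [nrm2 f <= nrm2 h = lim sigma <= nrm2 f]. *)
Lemma parseval :
  (forall h, L2 h -> (forall i, cinner (fun x => f x - h x) (e i) = 0) ->
     nrm2 f <= nrm2 h) ->
  (\sum_(i <oo) (sqmod (cinner f (e i)))%:E = (nrm2 f)%:E)%E.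
Proof.
move=> total; have [h Lh sh] := s_limit.
have hc i : cinner h (e i) = c i.
  apply/eqP; rewrite -subr_eq0; apply/eqP/sqmod_eq0/eqP; rewrite eq_le sqmod_ge0 andbT.
  apply: (cvgr_to_ge sh); exists i.+1 => // n /= ni.
  rewrite -(cinner_se ni) -sqmodN opprB -cinnerBl//.
  have := @cauchy_schwarz (fun x => s n x - h x) (e i) (L2B (Ls n) Lh) (Le i).
  by rewrite -[nrm2 (e i)]ReR -cinner_nrm2// ee eqxx mulr1.
have fh : nrm2 f <= nrm2 h.
  by apply: total => // i; rewrite cinnerBl// hc subrr.
have hs n : nrm2 (fun x => s n x - h x) = nrm2 h - sigma n.
  by apply: nrm2_sB => // i _; rewrite hc.
have sf : sigma n @[n --> \oo] --> nrm2 f.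
  have -> : nrm2 f = limn sigma; last exact: sigma_cvg.
  apply/le_anti/andP; split; last by apply: limr_le => //; exact: nearW.
  apply: le_trans fh _; rewrite -subr_ge0 -oppr_le0 opprB; apply: (cvgr_to_ge sh).
  apply: nearW => n; rewrite hs lerB//.
  exact: (nondecreasing_cvgn_le sigma_nd sigma_cvg).
apply/cvg_lim => //.
rewrite (_ : (fun n => _) = EFin \o sigma); first by apply/cvg_EFin; [exact: nearW|exact: sf].
by apply/funext => n /=; rewrite big_mkord sumEFin.
Qed.
End Parseval.

(** * Uniqueness of Fourier coefficients *)

Lemma Rint_dct (u : nat -> R -> R) (v h : R -> R) :
  (forall n, measurable_fun setT (u n)) -> (forall x, u n x @[n --> \oo] --> v x) ->
  mu.-integrable setT (EFin \o h) -> (forall n x, `|u n x| <= h x) ->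
  (\int[mu]_x u n x)%R @[n --> \oo] --> (\int[mu]_x v x)%R.
Proof.
move=> mun uv ih uh.
have mv : measurable_fun setT v by apply: (@measurable_fun_cvg _ _ _ _ u) => // x _; exact: uv.
have [] := @dominated_convergence _ _ R mu setT measurableT
  (fun n => EFin \o u n) (EFin \o v) (EFin \o h).
- by move=> n; apply/measurable_EFinP; exact: mun.
- by apply/measurable_EFinP; exact: mv.
- by apply: aeT => x _; apply/cvg_EFin; [exact: nearW|exact: uv].
- exact: ih.
- by apply: aeT => x n _; rewrite /= lee_fin.
move=> iv _; rewrite -[X in _ --> X -> _]fineK; last exact: (integrable_fin_num measurableT iv).
exact: fine_cvg.
Qed.

Lemma cintegrableM_bounded H g (M : R) : cintegrable H -> cmeasurable g ->
  (forall x, sqmod (g x) <= M) -> cintegrable (fun x => H x * g x).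
Proof.
move=> iH mg gM; have [ir ii] := iH.
apply: (@le_cintegrable _ (fun x => (1 + M) * `|Re (H x)| + (1 + M) * `|Im (H x)|)).
- by apply: cmeasurableM => //; exact: cintegrable_cmeasurable.
- by apply: Rintegrable_lin; exact: integrable_norm.
- move=> x; have := gM x; rewrite ReM /sqmod => gx.
  rewrite (le_trans (ler_normB _ _))// !normrM lerD// mulrC ler_wpM2r//.
    rewrite ler_norml; have := (sqr_ge0 (Re (g x) - 1), sqr_ge0 (Re (g x) + 1),
      sqr_ge0 (Im (g x)), sqr_ge0 (Re (g x))).
    by rewrite sqrrB sqrrD => -[[[]]] *; apply/andP; split; lra.
  rewrite ler_norml; have := (sqr_ge0 (Im (g x) - 1), sqr_ge0 (Im (g x) + 1),
    sqr_ge0 (Re (g x)), sqr_ge0 (Im (g x))).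
  by rewrite sqrrB sqrrD => -[[[]]] *; apply/andP; split; lra.
- move=> x; have := gM x; rewrite ImM /sqmod => gx.
  rewrite (le_trans (ler_normD _ _))// !normrM lerD// mulrC ler_wpM2r//.
    rewrite ler_norml; have := (sqr_ge0 (Im (g x) - 1), sqr_ge0 (Im (g x) + 1),
      sqr_ge0 (Re (g x)), sqr_ge0 (Im (g x))).
    by rewrite sqrrB sqrrD => -[[[]]] *; apply/andP; split; lra.
  rewrite ler_norml; have := (sqr_ge0 (Re (g x) - 1), sqr_ge0 (Re (g x) + 1),
    sqr_ge0 (Im (g x)), sqr_ge0 (Re (g x))).
  by rewrite sqrrB sqrrD => -[[[]]] *; apply/andP; split; lra.
Qed.

Lemma bernoulli_ge (x : R) k : 0 <= x -> 1 + k%:R * x <= (1 + x) ^+ k.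
Proof.
move=> x0; elim: k => [|k IH]; first by rewrite mul0r addr0 expr0.
rewrite exprS; apply: (@le_trans _ _ ((1 + x) * (1 + k%:R * x))).
  have : 0 <= k%:R * x * x by rewrite !mulr_ge0.
  by rewrite -natr1; lra.
by rewrite ler_wpM2l// addr_ge0.
Qed.

Lemma bernoulli_le (x : R) k : 0 <= x <= 1 -> 1 - k%:R * x <= (1 - x) ^+ k.
Proof.
move=> /andP[x0 x1]; elim: k => [|k IH]; first by rewrite mul0r subr0 expr0.
rewrite exprS; apply: (@le_trans _ _ ((1 - x) * (1 - k%:R * x))).
  have : 0 <= k%:R * x * x by rewrite !mulr_ge0.
  by rewrite -natr1; lra.
by rewrite ler_wpM2l// subr_ge0.
Qed.

(** The choice of [h] gives [sqrt r * (1 + h) <= 1], so by Bernoulli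
    [sqrt r ^ n <= 1 / (h * (n + 1))]; squaring yields a bound on [r ^ n] of order [1 / n^2]. *)
Lemma cvg_natM_expr (r : R) : 0 <= r < 1 -> n%:R * r ^+ n @[n --> \oo] --> (0 : R).
Proof.
move=> /andP[r0 r1]; pose h := (1 - Num.sqrt r) / 2.
have s0 : 0 <= Num.sqrt r by exact: sqrtr_ge0.
have s1 : Num.sqrt r < 1 by rewrite -sqrtr1 ltr_sqrt.
have h0 : 0 < h by rewrite /h; lra.
have h1 : h < 1 by rewrite /h; lra.
have sh : Num.sqrt r * (1 + h) <= 1 by rewrite /h; nra.
have bnd n : n%:R * r ^+ n <= h ^- 2 * n.+1%:R^-1.
  have a : Num.sqrt r ^+ n * (h * n.+1%:R) <= 1.
    apply: (@le_trans _ _ (Num.sqrt r ^+ n * (1 + h) ^+ n)).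
      rewrite ler_wpM2l ?exprn_ge0// (le_trans _ (bernoulli_ge _ (ltW h0)))//.
      by rewrite -natr1; lra.
    by rewrite -exprMn exprn_ile1// mulr_ge0// addr_ge0// ltW.
  have n0 : 0 < n.+1%:R :> R by rewrite ltr0n.
  rewrite -[r in r ^+ n]sqr_sqrtr// -exprM mulnC exprM.
  rewrite -invfM -[_^-1]mul1r ler_pdivlMr; last by rewrite mulr_gt0 ?exprn_gt0.
  set u := Num.sqrt r ^+ n in a *.
  have u0 : 0 <= u by rewrite exprn_ge0.
  apply: (@le_trans _ _ ((u * (h * n.+1%:R)) ^+ 2)).
    have -> : (u * (h * n.+1%:R)) ^+ 2 = n.+1%:R * (u ^+ 2 * (h ^+ 2 * n.+1%:R)).
      by move: n.+1%:R => N; ring.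
    rewrite -mulrA ler_wpM2r ?ler_nat//.
    by apply: mulr_ge0; rewrite ?exprn_ge0// mulr_ge0// exprn_ge0// ltW.
  by rewrite exprn_ile1//; apply: mulr_ge0 => //; apply: mulr_ge0; exact: ltW.
apply: (@squeeze_cvgr _ _ _ _ (fun=> 0) (fun n => h ^- 2 * n.+1%:R^-1)).
- by apply: nearW => n; rewrite bnd mulr_ge0 ?exprn_ge0.
- exact: cvg_cst.
- rewrite -[X in _ --> X](mulr0 (h ^- 2)); apply: cvgM; first exact: cvg_cst.
  exact: cvg_harmonic.
Qed.

(** Polynomials in [t] approaching the indicator of [t < 1/2] on [[0, 1]]. By Bernoulli's inequality
    the size of [n * (2 * t) ^ n] decides: it tends to 0 below 1/2 and to infinity above, and the
    factor [n] in the exponent settles the point 1/2 itself. *)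
Definition cutoff (n : nat) (t : R) : R := (1 - t ^+ n) ^+ (n * 2 ^ n).

Lemma cutoff_bounds n (t : R) : 0 <= t <= 1 -> 0 <= cutoff n t <= 1.
Proof.
move=> /andP[t0 t1]; have tn0 : 0 <= t ^+ n by rewrite exprn_ge0.
have tn1 : t ^+ n <= 1 by rewrite exprn_ile1.
by rewrite exprn_ge0 ?subr_ge0//= exprn_ile1 ?subr_ge0// lerBlDr lerDl.
Qed.

Lemma cvg_cutoff (t : R) : 0 <= t <= 1 ->
  cutoff n t @[n --> \oo] --> (\1_[set s : R | s < 2^-1] t : R).
Proof.
move=> t01; have /andP[t0 t1] := t01.
have tn0 n : 0 <= t ^+ n by rewrite exprn_ge0.
have tn1 n : t ^+ n <= 1 by rewrite exprn_ile1.
rewrite indicE; have [th|th] := ltP t 2^-1.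
  rewrite mem_set//.
  have r1 : 0 <= 2 * t < 1 by rewrite mulr_ge0//= mulrC -ltr_pdivlMr// mul1r.
  apply: (@squeeze_cvgr _ _ _ _ (fun n => 1 - n%:R * (2 * t) ^+ n) (fun=> 1)).
  - apply: nearW => n; have /andP[_ ->] := cutoff_bounds n t01; rewrite andbT.
    apply: le_trans (bernoulli_le _ _); last by rewrite tn0 tn1.
    by rewrite natrM natrX exprMn mulrA.
  - rewrite -[X in _ --> X]subr0; apply: cvgB; first exact: cvg_cst.
    exact: cvg_natM_expr.
  - exact: cvg_cst.
rewrite memNset /=; last by apply/negP; rewrite -leNgt.
apply: (@squeeze_cvgr _ _ _ _ (fun=> 0) (fun n => n.+1%:R^-1)).
- apply: nearW => n; have /andP[-> _] /= := cutoff_bounds n t01.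
  set k := (n * 2 ^ n)%N; rewrite -[_^-1]mul1r ler_pdivlMr//.
  (* As [(1 - t^n) * (1 + t^n) <= 1], a lower bound on the power of [1 + t^n] bounds the cutoff
     above. *)
  have B : n.+1%:R <= (1 + t ^+ n) ^+ k.
    apply: le_trans (bernoulli_ge _ (tn0 n)); rewrite -natr1 addrC lerD2l natrM.
    rewrite -mulrA ler_peMr// natrX -exprMn exprn_ege1//.
    by rewrite mulrC -ler_pdivrMr// mul1r.
  apply: (@le_trans _ _ ((1 - t ^+ n) ^+ k * (1 + t ^+ n) ^+ k)).
    by rewrite ler_wpM2l// exprn_ge0// subr_ge0.
  rewrite -exprMn -subr_sqr expr1n exprn_ile1 ?subr_ge0 ?lerBlDr ?lerDl ?sqr_ge0//.
  by rewrite exprn_ile1.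
- exact: cvg_cst.
- exact: cvg_harmonic.
Qed.

Section FourierUniqueness.
Variables (H : R -> C) (w : R).
Hypothesis iH : cintegrable H.
Hypothesis H0 : forall k : int, cint setT (fun x => H x * expi (k%:~R * w * x)) = 0.

(** Those bounded [g] for which [H * g] still has only zero moments. They are stable under
    differences and under multiplication by the trigonometric polynomial [t], hence contain every
    polynomial cutoff of [t]. *)
Let annih (g : R -> R) := [/\ measurable_fun setT g, exists M : R, forall x, `|g x| <= M
  & forall k : int, cint setT (fun x => H x * (g x)%:C * expi (k%:~R * w * x)) = 0].

Let iHg (g : R -> R) (M k : R) : measurable_fun setT g -> (forall x, `|g x| <= M) ->
  cintegrable (fun x => H x * (g x)%:C * expi (k * w * x)).
Proof.
move=> mg gM; apply: (@cintegrableM_bounded _ _ 1).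
- apply: (@cintegrableM_bounded _ _ (M ^+ 2)).
  + exact: iH.
  + exact: cmeasurable_real.
  + move=> x; rewrite sqmodR -real_normK ?num_real// lerXn2r// nnegrE//; exact: le_trans (gM x).
- apply: cmeasurable_expi; exact: mulrl_measurable.
- by move=> x; rewrite sqmod_expi.
Qed.

Let annih1 : annih (fun=> 1).
Proof.
split; [exact: measurable_cst|by exists 1 => x; rewrite normr1|].
by move=> k; rewrite -[RHS](H0 k); apply: eq_cint => x _; rewrite mulr1.
Qed.

Let annihB (g1 g2 : R -> R) : annih g1 -> annih g2 -> annih (fun x => g1 x - g2 x).
Proof.
move=> [mg1 [M1 gM1] g10] [mg2 [M2 gM2] g20]; split; first exact: measurable_funB.
  by exists (M1 + M2) => x; rewrite (le_trans (ler_normB _ _))// lerD.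
move=> k; rewrite -[RHS](subrr 0) -{1}(g10 k) -(g20 k) -cintB; [|exact: iHg gM1|exact: iHg gM2].
by apply: eq_cint => x _; rewrite rmorphB /= mulrBr mulrBl.
Qed.

Variables m c : R.
(* For [|c| <= 1] this trigonometric polynomial takes its values in [[0, 1]] and is
   below 1/2 exactly on the superlevel set, which the cutoffs therefore approximate. *)
Let t x : R := (2 - (cos (w * x - m) - c)) / 4.

Let annihM (g : R -> R) : annih g -> annih (fun x => g x * t x).
Proof.
move=> [mg [M gM] g0].
have mt : measurable_fun setT t.
  apply: measurable_funM => //; apply: measurable_funB => //; apply: measurable_funB => //.
  apply: measurableT_comp; last exact: measurable_affine.
  by apply: continuous_measurable_fun; exact: continuous_cos.
split; first exact: measurable_funM.
  exists (M * ((2 + 1 + `|c|) / 4)) => x; rewrite normrM ler_pM//.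
  rewrite /t normrM [ `|_^-1|]ger0_norm// ler_pM2r//.
  have := (cos_geN1 (w * x - m), cos_le1 (w * x - m), ler_norm c, ler_norm (- c)).
  rewrite normrN => -[[[]]] *; rewrite ler_norml; apply/andP; split; lra.
move=> k.
pose E j x : C := H x * (g x)%:C * expi (j%:~R * w * x).
have iE j : cintegrable (E j) by exact: iHg gM.
(* The cosine is half the sum of two exponentials, so multiplying by [t] mixes the moments at
   [k - 1], [k] and [k + 1]; [8] is this [2] times the denominator [4] of [t]. *)
rewrite (@eq_cint _ _ (fun x => ((2 + c) / 4)%:C * E k x -
   ((8^-1)%:C * expi (- m) * E (k + 1) x + (8^-1)%:C * expi m * E (k - 1) x))); last first.
  move=> x _; rewrite /E; set a := H x; set b := g x.
  rewrite (_ : (k + 1)%:~R * w * x = k%:~R * w * x + w * x); last by rewrite intrD; ring.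
  rewrite (_ : (k - 1)%:~R * w * x = k%:~R * w * x - w * x); last by rewrite intrD; ring.
  rewrite !expiD; set ek := expi (k%:~R * w * x).
  have -> : (b * t x)%:C = b%:C *
      (((2 + c) / 4)%:C - (8^-1)%:C * (expi (w * x - m) + expi (- (w * x - m)))).
    by apply: complex_ext; rewrite !ReIm ?cosN ?sinN /t /=; field.
  rewrite opprB !expiD; ring.
rewrite cintB; [|exact: cintegrableZ|by apply: cintegrableD; exact: cintegrableZ].
rewrite cintD ?cintZ//; [|exact: cintegrableZ..].
have E0 j : cint setT (E j) = 0 by exact: g0.
by rewrite !E0 !mulr0 addr0 subr0.
Qed.

Let annih_cutoff n : annih (fun x => cutoff n (t x)).
Proof.
have pow j (g : R -> R) : annih g -> annih (fun x => g x * t x ^+ j).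
  move=> gA; elim: j => [|j IH]; first by under eq_fun do rewrite expr0 mulr1.
  by under eq_fun do rewrite exprSr mulrA; exact: annihM.
rewrite /cutoff; elim: (n * 2 ^ n)%N => [|j IH].
  by under eq_fun do rewrite expr0; exact: annih1.
under eq_fun do rewrite exprSr mulrBr mulr1.
by apply: annihB => //; exact: pow.
Qed.

(** Dominated convergence along the cutoffs of [t], which are bounded by 1. *)
Lemma fourier_zero_superlevel : -1 <= c <= 1 ->
  cint setT (fun x => H x * (\1_[set y | c < cos (w * y - m)] x : R)%:C) = 0.
Proof.
move=> /andP[c1 c2]; have [ir ii] := iH.
have t01 x : 0 <= t x <= 1.
  have : -1 <= cos (w * x - m) <= 1 by rewrite cos_geN1 cos_le1.
  by move=> /andP[? ?]; rewrite /t; lra.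
have cvt x : cutoff n (t x) @[n --> \oo] --> (\1_[set y | c < cos (w * y - m)] x : R).
  rewrite (_ : \1__ x = \1_[set s : R | s < 2^-1] (t x) :> R); first exact: cvg_cutoff.
  rewrite !indicE; congr (nat_of_bool _)%:R; apply/idP/idP => /[!inE] /=; rewrite /t; lra.
have mH := cintegrable_cmeasurable iH.
have mq n : measurable_fun setT (fun x => cutoff n (t x)) by have [] := annih_cutoff n.
have z n : cint setT (fun x => H x * (cutoff n (t x))%:C) = 0.
  have [_ _ /(_ 0)] := annih_cutoff n; apply: etrans.
  by apply: eq_cint => x _; rewrite !mul0r expi0 mulr1.
(* [P] stands for the real and for the imaginary part. *)
have key (P : C -> R) : (forall z (r : R), P (z * r%:C) = P z * r) ->
    measurable_fun setT (fun x => P (H x)) ->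
    mu.-integrable setT (EFin \o (fun x => P (H x))) ->
    (forall n, (\int[mu]_x P (H x * (cutoff n (t x))%:C) = 0)%R) ->
    (\int[mu]_x P (H x * (\1_[set y | c < cos (w * y - m)] x : R)%:C) = 0)%R.
  move=> PM mP iP P0.
  suff K : (\int[mu]_x P (H x * (cutoff n (t x))%:C))%R @[n --> \oo] -->
           (\int[mu]_x P (H x * (\1_[set y | c < cos (w * y - m)] x : R)%:C))%R.
    by rewrite -(cvg_lim _ K)//; under eq_fun do rewrite P0; exact: lim_cst.
  apply: (@Rint_dct _ _ (fun x => `|P (H x)|)).
  - by move=> n; under eq_fun do rewrite PM; exact: measurable_funM.
  - by move=> x; rewrite PM; under eq_fun do rewrite PM; apply: cvgM => //; exact: cvg_cst.
  - exact: integrable_norm.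
  - move=> n x; rewrite PM normrM ler_piMr// ger0_norm; have /andP[] := cutoff_bounds n (t01 x) => //.
apply: complex_ext; rewrite (Re_cint, Im_cint) (Re0, Im0).
- apply: key => //; first by move=> z0 r; rewrite ReM ImR mulr0 subr0.
    by case: mH.
  by move=> n; rewrite -Re_cint z.
- apply: key => //; first by move=> z0 r; rewrite ImM ImR mulr0 add0r.
    by case: mH.
  by move=> n; rewrite -Im_cint z.
Qed.

End FourierUniqueness.

(** Lebesgue differentiation: the primitive of [u] is constant on []p, q[], and its derivative is
    [u] almost everywhere. *)
Lemma ae0_zero_integrals (u : R -> R) (p q : R) : mu.-integrable setT (EFin \o u) ->
  (forall a b, p < a -> a < b -> b < q -> (\int[mu]_x (u x * (\1_`]a, b[ x : R)) = 0)%R) ->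
  {ae mu, forall x, p < x < q -> u x = 0}.
Proof.
move=> iu u0; have mu' := measurable_int _ iu; have mu_ := mu'; move/measurable_EFinP in mu_.
have iS (I : interval R) : mu.-integrable [set` I] (EFin \o u) by exact: integrableS iu.
have z y a : p < y -> y <= a -> a < q ->
    (\int[mu]_(x in `]-oo, y]) u x = \int[mu]_(x in `]-oo, a]) u x)%R.
  move=> py; rewrite le_eqVlt => /predU1P[->//|ya] aq.
  apply/eqP; rewrite eq_sym -subr_eq0; apply/eqP.
  rewrite (@Rintegral_itvB _ u -oo%O (BRight a) y)//; last by rewrite bnd_simp ltW.
  rewrite -Rintegral_itv_bndo_bndc; last exact: iS.
  rewrite Rintegral_mkcond -[RHS](u0 y a py ya aq).
  apply: eq_Rintegral => x _; rewrite patchE indicE; case: ifP => _; by rewrite ?mulr1 ?mulr0.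
have loc : locally_integrable [set: R] u.
  split => //; first exact: openT.
  move=> K _ cK; have mK := compact_measurable cK.
  have iK : mu.-integrable K (EFin \o u) by exact: integrableS iu.
  by have /integrableP[] := iK.
have /ae_imp := FTC1Ny (fun y => iS `]-oo, y]) loc; apply=> x [_ Fx] /andP[px xq].
rewrite -Fx derive1E.
rewrite (@near_eq_derive _ _ _ _ (cst (\int[mu]_(t in `]-oo, x]) u t)%R)).
  by rewrite -derive1E derive1_cst.
near=> y; rewrite /=.
have yp : p < y by near: y; exact: lt_nbhsr.
have yq : y < q by near: y; exact: lt_nbhsl.
by have [xy|/ltW yx] := leP x y; [rewrite (z x y)|rewrite (z y x)].
Unshelve. all: by end_near.
Qed.

(** * Periodicity and arcs *)

Lemma cos_period (t : R) (k : int) : cos (t + k%:~R * (pi *+ 2)) = cos t.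
Proof.
have P (s : R) (n : nat) : cos (s + n%:R * (pi *+ 2)) = cos s.
  elim: n => [|n IH]; first by rewrite mul0r addr0.
  by rewrite -natr1 mulrDl mul1r addrA cosD2pi IH.
case: k => n; first exact: P.
by rewrite NegzE mulrNz mulNr -[LHS](P _ n.+1) subrK.
Qed.

Lemma sin_period (t : R) (k : int) : sin (t + k%:~R * (pi *+ 2)) = sin t.
Proof.
have := cos_period (t - pi / 2) k.
by rewrite addrAC !cosBpihalf.
Qed.

Lemma expi_period (t : R) (k : int) : expi (t + k%:~R * (pi *+ 2)) = expi t.
Proof. by apply: complex_ext; rewrite !ReIm (cos_period, sin_period). Qed.

Lemma cos_gt_arc (t h : R) : 0 < h < pi ->
  cos h < cos t <-> exists k : int, `|t - k%:~R * (pi *+ 2)| < h.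
Proof.
move=> /andP[h0 hpi]; have pi0 := pi_gt0 R.
have E k : cos t = cos `|t - k%:~R * (pi *+ 2)|.
  by rewrite cos_norm -[RHS](cos_period _ k) subrK.
split=> [ht|[k tk]].
  (* This multiple of [2 pi] leaves a remainder in [[- pi, pi]], where the cosine decreases with the
     absolute value. *)
  pose k := Num.floor ((t + pi) / (pi *+ 2)); exists k.
  have : `|t - k%:~R * (pi *+ 2)| <= pi.
    have /andP[k1 k2] : k%:~R <= (t + pi) / (pi *+ 2) < k%:~R + 1.
      by rewrite floor_le/= -intrD1 floorD1_gt.
    have pi2 : 0 < pi *+ 2 :> R by rewrite mulr2n addr_gt0.
    move: k1 k2; rewrite ler_pdivlMr// ltr_pdivrMr// => k1 k2.
    rewrite ler_norml; apply/andP; split; lra.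
  move: ht; rewrite (E k) => ht tpi.
  rewrite ltNge; apply/negP => ht'.
  move: ht; rewrite ltNge => /negP; apply.
  move: ht'; rewrite le_eqVlt => /predU1P[->//|ht']; apply/ltW.
  by rewrite ltr_cos ?in_itv//=; apply/andP; split => //; exact: ltW.
rewrite (E k) ltr_cos ?in_itv//= ?normr_ge0/=; first by rewrite (le_trans (ltW tk))// ltW.
by rewrite !ltW.
Qed.

Definition arc (w a b : R) : set R :=
  [set x | exists k : int, a < x - k%:~R * (2 * pi / w) < b].

(** A periodised interval shorter than the period is a superlevel set of a shifted cosine: [m] is
    the phase of its centre, and [cos h], with [h] its half-width in phase, is the level. *)
Lemma fourier_zero_arc (H : R -> C) (w a b : R) : 0 < w -> cintegrable H ->
  (forall k : int, cint setT (fun x => H x * expi (k%:~R * w * x)) = 0) ->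
  a < b -> w * (b - a) < 2 * pi ->
  cint setT (fun x => H x * (\1_(arc w a b) x : R)%:C) = 0.
Proof.
move=> w0 iH H0 ab wab.
pose m := w * ((a + b) / 2); pose h := w * ((b - a) / 2).
have h0 : 0 < h by rewrite mulr_gt0// divr_gt0// subr_gt0.
have hpi : h < pi by rewrite /h; lra.
have -> : arc w a b = [set y | cos h < cos (w * y - m)].
  apply/seteqP; split => x /=; rewrite cos_gt_arc ?h0// => -[k xk]; exists k.
  - have -> : w * x - m - k%:~R * (pi *+ 2) = w * (x - k%:~R * (2 * pi / w) - (a + b) / 2).
      by rewrite /m; field; rewrite gt_eqF.
    rewrite normrM gtr0_norm// ltr_pM2l// ltr_norml; lra.
  - move: xk; have -> : w * x - m - k%:~R * (pi *+ 2) = w * (x - k%:~R * (2 * pi / w) - (a + b) / 2).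
      by rewrite /m; field; rewrite gt_eqF.
    rewrite normrM gtr0_norm// ltr_pM2l// ltr_norml; lra.
by apply: (fourier_zero_superlevel iH H0); rewrite cos_geN1 cos_le1.
Qed.

(** * The Plancherel theorem *)

Lemma FTC_everywhere (F f : R -> R) (a b : R) : a < b ->
  (forall x : R, is_derive x 1 F (f x)) -> continuous f ->
  (\int[mu]_(x in `[a, b]) f x = F b - F a)%R.
Proof.
move=> ab dF cf; have cF : continuous F.
  by move=> x; apply/differentiable_continuous/derivable1_diffP; have [] := dF x.
rewrite /Rintegral (@continuous_FTC2 _ f F)//.
- exact: continuous_subspaceT.
- split; first by move=> x _; have [] := dF x.
    by apply: cvg_at_right_filter; exact: cF.
  by apply: cvg_at_left_filter; exact: cF.
- by move=> x _; rewrite derive1E; have [_] := dF x.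
Qed.

Lemma cint_expi_itv (c a b : R) : c != 0 -> a < b ->
  cint `[a, b] (fun x => expi (c * x)) =
  ((sin (c * b) - sin (c * a)) / c) -i* ((cos (c * b) - cos (c * a)) / c).
Proof.
move=> c0 ab; have cl : continuous (fun x : R => c * x) by exact: mulrl_continuous.
have dl (x : R) : is_derive x 1 (fun x : R => c * x) c.
  by rewrite -[X in is_derive _ _ _ X]mulr1; exact: is_deriveZ.
apply: complex_ext; rewrite (Re_cint, Im_cint) /=.
- have d (x : R) : is_derive x 1 (fun x => c^-1 * sin (c * x)) (cos (c * x)).
    rewrite (_ : cos _ = c^-1 *: (cos (c * x) * c)); last by rewrite /GRing.scale/=; field.
    by apply: is_deriveZ; exact: is_derive1_comp.
  rewrite (FTC_everywhere ab d); first by rewrite -mulrBr mulrC.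
  by move=> x; apply: continuous_comp; [exact: cl|exact: continuous_cos].
- have d (x : R) : is_derive x 1 (fun x => - c^-1 * cos (c * x)) (sin (c * x)).
    rewrite (_ : sin _ = - c^-1 *: (- sin (c * x) * c)); last by rewrite /GRing.scale/=; field.
    by apply: is_deriveZ; exact: is_derive1_comp.
  rewrite (FTC_everywhere ab d); first by rewrite -mulrBr mulNr mulrC.
  by move=> x; apply: continuous_comp; [exact: cl|exact: continuous_sin].
Qed.

Lemma cint_expi_period (w a : R) (k : int) : 0 < w ->
  cint `[a, a + 2 * pi / w] (fun x => expi (k%:~R * w * x)) =
  (if k == 0 then 2 * pi / w else 0)%:C.
Proof.
move=> w0; have pi0 := pi_gt0 R.
have T0 : 0 < 2 * pi / w by rewrite divr_gt0// mulr_gt0.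
have [->|k0] := eqVneq.
  rewrite (@eq_cint _ _ (fun=> 1)); last by move=> x _; rewrite !mul0r expi0.
  apply: complex_ext; rewrite (Re_cint, Im_cint) (ReR, ImR) (Re1, Im1) Rintegral_cst// ?mul0r// mul1r.
  rewrite [X in fine X](_ : _ = (2 * pi / w)%:E)//.
  apply: etrans (lebesgue_measure_itv _) _.
  by rewrite /= lte_fin ltrDl T0 -EFinD/= addrAC subrr add0r.
rewrite cint_expi_itv ?ltrDl//; last by rewrite mulf_neq0 ?intr_eq0// gt_eqF.
have -> : k%:~R * w * (a + 2 * pi / w) = k%:~R * w * a + k%:~R * (pi *+ 2).
  by field; rewrite gt_eqF.
by rewrite cos_period sin_period !subrr !mul0r oppr0.
Qed.

Lemma cint_indic (D : set R) f : measurable D ->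
  cint D f = cint setT (fun x => f x * (\1_D x : R)%:C).
Proof.
move=> mD; apply: complex_ext; rewrite !(Re_cint, Im_cint) Rintegral_mkcond;
apply: eq_Rintegral => x _; rewrite patchE (ReM, ImM) ReR ImR indicE;
by case: (x \in D) => /=; rewrite !(mulr0, mulr1, subr0, addr0, add0r, oppr0).
Qed.

Lemma ae_neq (a : R) : {ae mu, forall x, x <> a}.
Proof.
exists [set a]; split => //; first exact: lebesgue_measure_set1.
by move=> x /= /contrapT.
Qed.

Lemma ae0_zero_cint (H : R -> C) (p q : R) : cintegrable H ->
  (forall a b, p < a -> a < b -> b < q -> cint setT (fun x => H x * (\1_`]a, b[ x : R)%:C) = 0) ->
  {ae mu, forall x, p < x < q -> H x = 0}.
Proof.
move=> [ir ii] H0.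
have hr := ae0_zero_integrals (p := p) (q := q) ir.
have hi := ae0_zero_integrals (p := p) (q := q) ii.
apply: (ae_imp2 (hr _) (hi _)) => [a b pa ab bq|a b pa ab bq|x rx ix xpq].
- have /(congr1 Re) := H0 a b pa ab bq; rewrite Re_cint Re0 => <-.
  by apply: eq_Rintegral => x _; rewrite ReM ReR ImR mulr0 subr0.
- have /(congr1 Im) := H0 a b pa ab bq; rewrite Im_cint Im0 => <-.
  by apply: eq_Rintegral => x _; rewrite ImM ReR ImR mulr0 add0r.
- by apply: complex_ext; rewrite ?rx ?ix.
Qed.

Definition ft (g : R -> C) (xi : R) : C := cint setT (fun x => g x * expi (- (xi * x))).

Definition supported (L : R) (g : R -> C) := forall x, ~ (- L <= x <= L) -> g x = 0.

Lemma Rintegrable_indic_itv (a b : R) :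
  mu.-integrable setT (EFin \o (\1_`[a, b] : R -> R)).
Proof. exact: integrable_indic_itv. Qed.

Lemma supported_cintegrable L g : L2 g -> supported L g -> cintegrable g.
Proof.
move=> Lg sg; apply: (@le_cintegrable _ (fun x => 1 * sqmod (g x) + 1 * \1_`[- L, L] x)).
- exact: L2_cmeasurable.
- by apply: Rintegrable_lin; [exact: L2_sqmod_integrable|exact: Rintegrable_indic_itv].
- move=> x; rewrite !mul1r indicE; have [xL|xL] := pselect (- L <= x <= L).
    rewrite mem_set ?in_itv//=; have := Re_le_sqmod (g x) => h; rewrite ler_norml.
    have := (sqr_ge0 (Re (g x) - 1), sqr_ge0 (Re (g x) + 1)).
    by rewrite sqrrB sqrrD => -[] *; apply/andP; split; lra.
  by rewrite (sg x xL) Re0 normr0 addr_ge0// sqmod_ge0.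
- move=> x; rewrite !mul1r indicE; have [xL|xL] := pselect (- L <= x <= L).
    rewrite mem_set ?in_itv//=; have := Im_le_sqmod (g x) => h; rewrite ler_norml.
    have := (sqr_ge0 (Im (g x) - 1), sqr_ge0 (Im (g x) + 1)).
    by rewrite sqrrB sqrrD => -[] *; apply/andP; split; lra.
  by rewrite (sg x xL) Im0 normr0 addr_ge0// sqmod_ge0.
Qed.

Lemma cintegrableM_expi g (h : R -> R) : cintegrable g -> measurable_fun setT h ->
  cintegrable (fun x => g x * expi (h x)).
Proof.
move=> ig mh; apply: (@cintegrableM_bounded _ _ 1) => //; first exact: cmeasurable_expi.
by move=> x; rewrite sqmod_expi.
Qed.

Lemma measurable_Nscale (xi : R) : measurable_fun setT (fun x : R => - (xi * x)).
Proof. by apply: measurable_funN; exact: mulrl_measurable. Qed.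

(** Measurable because continuous: [|Re g| + |Im g|] dominates both parts of the integrand at every
    frequency. *)
Lemma cmeasurable_ft g : cintegrable g -> cmeasurable (ft g).
Proof.
move=> ig; have [ir ii] := ig.
have B x xi : `|Re (g x * expi (- (xi * x)))| <= 1 * `|Re (g x)| + 1 * `|Im (g x)| /\
              `|Im (g x * expi (- (xi * x)))| <= 1 * `|Re (g x)| + 1 * `|Im (g x)|.
  rewrite ReM ImM Re_expi Im_expi; set u := - (xi * x).
  have c1 : `|cos u| <= 1 by rewrite ler_norml cos_geN1 cos_le1.
  have s1 : `|sin u| <= 1 by rewrite ler_norml sin_geN1 sin_le1.
  split; [apply: le_trans (ler_normB _ _) _|apply: le_trans (ler_normD _ _) _];
  by rewrite !normrM !mul1r lerD// ler_piMr.
have iB : mu.-integrable setT (EFin \o (fun x => 1 * `|Re (g x)| + 1 * `|Im (g x)|)).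
  by apply: Rintegrable_lin; exact: integrable_norm.
have cexp y : continuous (fun xi : R => - (xi * y)).
  by move=> xi; apply: cvgN; exact: mulrr_continuous.
split; apply: continuous_measurable_fun => xi.
- have := @continuity_under_integral R _ _ mu (fun xi x => Re (g x * expi (- (xi * x)))) setT
    measurableT (xi - 1) (xi + 1) _ _ _ iB _.
  apply.
  + by move=> y _; have [] := cintegrableM_expi ig (measurable_Nscale y).
  + apply: aeT => x _ y _; under eq_fun do rewrite ReM Re_expi Im_expi.
    apply: cvgB; apply: cvgM; try exact: cvg_cst.
      by apply: continuous_comp; [exact: cexp|exact: continuous_cos].
    by apply: continuous_comp; [exact: cexp|exact: continuous_sin].
  + by move=> y _; apply: aeT => x _; have [] := B x y.
  + by rewrite inE/= in_itv/=; apply/andP; split; lra.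
- have := @continuity_under_integral R _ _ mu (fun xi x => Im (g x * expi (- (xi * x)))) setT
    measurableT (xi - 1) (xi + 1) _ _ _ iB _.
  apply.
  + by move=> y _; have [] := cintegrableM_expi ig (measurable_Nscale y).
  + apply: aeT => x _ y _; under eq_fun do rewrite ImM Re_expi Im_expi.
    apply: cvgD; apply: cvgM; try exact: cvg_cst.
      by apply: continuous_comp; [exact: cexp|exact: continuous_sin].
    by apply: continuous_comp; [exact: cexp|exact: continuous_cos].
  + by move=> y _; apply: aeT => x _; have [] := B x y.
  + by rewrite inE/= in_itv/=; apply/andP; split; lra.
Qed.

(** Enumerates the integers, so that Parseval, series and countable unions, all indexed by [nat],
    apply to families indexed by [int]. *)
Definition int_of_nat (i : nat) : int := if odd i then Negz i./2 else Posz i./2.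

Lemma int_of_nat_inj : injective int_of_nat.
Proof.
move=> i j; rewrite /int_of_nat; case oi: (odd i); case oj: (odd j) => //= -[] h;
by rewrite -(odd_double_half i) -(odd_double_half j) oi oj h.
Qed.

Lemma int_of_nat_surj (k : int) : exists i, int_of_nat i = k.
Proof.
case: k => n.
- by exists n.*2; rewrite /int_of_nat odd_double doubleK.
- by exists n.*2.+1; rewrite /int_of_nat /= odd_double /= uphalf_double.
Qed.

Section PlancherelCompact.
Variables (L : R) (g : R -> C).
Hypotheses (L0 : 0 < L) (Lg : L2 g) (sg : supported L g).
Let w := pi / L.
Let w0 : 0 < w. Proof. by rewrite divr_gt0// pi_gt0. Qed.
Let period : 2 * pi / w = 2 * L.
Proof. rewrite /w; move: (pi : R) (lt0r_neq0 (pi_gt0 R)) => p p0.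
by field; rewrite (gt_eqF L0). Qed.
Let r : R := (Num.sqrt (2 * L))^-1.
Let r2 : r * r = (2 * L)^-1.
Proof. by rewrite -invfM -expr2 sqr_sqrtr// mulr_ge0// ltW. Qed.
Let itv : set R := `[- L, L].
Let itvE : itv = `[- L, - L + 2 * pi / w]%classic.
Proof. by rewrite period /itv (_ : - L + 2 * L = L)//; ring. Qed.
Let mitv : measurable itv. Proof. exact: measurable_itv. Qed.

Let e (i : nat) (x : R) : C :=
  (\1_itv x : R)%:C * (r%:C * expi ((int_of_nat i)%:~R * w * x)).

Let mexp (k : R) : measurable_fun setT (fun x => k * w * x).
Proof. exact: mulrl_measurable. Qed.

Let Le i : L2 (e i).
Proof.
apply: (@le_L2 _ (fun x => r ^+ 2 * \1_itv x)).
- apply: cmeasurableM; first by apply: cmeasurable_real.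
  by apply: cmeasurableM; [exact: cmeasurable_cst|exact: cmeasurable_expi].
- by apply: EFin_Rintegrable_scale; exact: Rintegrable_indic_itv.
- move=> x; rewrite !sqmodM !sqmodR sqmod_expi mulr1 mulrC ler_wpM2l ?sqr_ge0//.
  by rewrite indicE; case: (x \in itv); rewrite ?expr1n ?expr0n.
Qed.

Let oe : Defs.orthonormal e.
Proof.
split=> // i j.
have -> : cinner (e i) (e j) = (i == j)%:R.
  rewrite cinnerE (@eq_cint _ _ (fun x => ((2 * L)^-1)%:C *
    (expi ((int_of_nat i - int_of_nat j)%:~R * w * x) * (\1_itv x : R)%:C))); last first.
    move=> x _; rewrite /e !conjcM !conjc_real expiJ -r2 indicE.
    rewrite intrD mulrNz !mulrDl expiD !mulNr !rmorphM /=.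
    by case: (x \in itv); rewrite ?(mulr1, mul1r, mul0r, mulr0)//; ring.
  have i1 : cintegrable (fun x => expi ((int_of_nat i - int_of_nat j)%:~R * w * x) * (\1_itv x : R)%:C).
    under eq_fun do rewrite mulrC; apply: cintegrableM_expi => //.
    by split; [exact: Rintegrable_indic_itv|exact: integrable0].
  rewrite cintZ// -cint_indic// itvE cint_expi_period// period subr_eq0.
  rewrite (inj_eq int_of_nat_inj); case: ifP => _; last by rewrite mulr0.
  by rewrite -rmorphM /= mulVf ?gt_eqF ?mulr_gt0.
by split; case: eqP.
Qed.

(** By uniqueness of Fourier coefficients [f = h] almost everywhere on [[- L, L]]. Outside, [f] is 0
    while [h] may have mass, hence an inequality. *)
Let total (f h : R -> C) : L2 f -> supported L f -> L2 h ->
  (forall i, cinner (fun x => f x - h x) (e i) = 0) -> nrm2 f <= nrm2 h.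
Proof.
move=> Lf sf Lh fh0.
have rn0 : r != 0 by rewrite invr_eq0 gt_eqF// sqrtr_gt0 mulr_gt0.
pose H x : C := (\1_itv x : R)%:C * (f x - h x).
have m1 : cmeasurable (fun x => (\1_itv x : R)%:C) by apply: cmeasurable_real.
have b1 x : sqmod ((\1_itv x : R)%:C : C) <= 1.
  by rewrite sqmodR indicE; case: (x \in itv); rewrite ?expr1n ?expr0n.
have LH : L2 H by apply: (L2M_bounded _ m1 b1); exact: L2B.
have nitv x : ~ (- L <= x <= L) -> \1_itv x = 0 :> R.
  by move=> xL; rewrite indicE memNset//= in_itv/=.
have sH : supported L H by move=> x /nitv; rewrite /H => ->; rewrite mul0r.
have iH := supported_cintegrable LH sH.
have H0 k : cint setT (fun x => H x * expi (k%:~R * w * x)) = 0.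
  (* The inner product conjugates the exponential, which turns index [- k] into frequency [k]. *)
  have [i ik] := int_of_nat_surj (- k).
  have := fh0 i; rewrite cinnerE.
  rewrite (@eq_cint _ _ (fun x => r%:C * (H x * expi (k%:~R * w * x)))); last first.
    move=> x _; rewrite /e /H ik !conjcM !conjc_real expiJ mulrNz !mulNr opprK; ring.
  rewrite cintZ; last exact: cintegrableM_expi.
  by move/eqP; rewrite mulf_eq0 => /orP[/eqP[/eqP]|/eqP//]; rewrite (negbTE rn0).
have H1 a b : - L < a -> a < b -> b < L -> cint setT (fun x => H x * (\1_`]a, b[ x : R)%:C) = 0.
  (* The period is [2 * L], so within [[- L, L]] the arc is just []a, b[]. *)
  move=> La ab bL; rewrite -[RHS](fourier_zero_arc w0 iH H0 ab).
    apply: eq_cint => x _; have [xL|xL] := pselect (- L <= x <= L); last by rewrite sH// !mul0r.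
    congr (_ * _%:C); rewrite !indicE; congr (nat_of_bool _)%:R.
    apply/idP/idP => /[!inE]; rewrite /arc /= in_itv/=.
      by move=> xab; exists 0; rewrite mul0r subr0.
    move=> [k]; rewrite period => /andP[xa xb]; have /andP[x1 x2] := xL.
    have [k0|k0|k0] := ltgtP k 0.
    - have : k%:~R <= -1 :> R by rewrite -[-1]/((-1)%:~R) ler_int; clear -k0; lia.
      by move=> k1; nra.
    - have : 1 <= k%:~R :> R by rewrite ler1z; clear -k0; lia.
      by move=> k1; nra.
    - by move: xa xb; rewrite k0 mul0r subr0 => -> ->.
  by rewrite mulrC -ltr_pdivlMr// period; lra.
have Hae := ae0_zero_cint iH H1.
have Lh' : L2 (fun x => (\1_itv x : R)%:C * h x) by exact: (L2M_bounded Lh m1 b1).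
rewrite (@ae_eq_nrm2 f (fun x => (\1_itv x : R)%:C * h x)); [|exact: L2_cmeasurable..|].
  apply: le_nrm2 => //; first exact: L2_cmeasurable.
  by move=> x; rewrite sqmodM ler_piMl// sqmod_ge0.
apply: (ae_imp2 (ae_and (ae_neq L) (ae_neq (- L))) Hae) => x [xL xNL].
have [xi|xi _] := pselect (- L <= x <= L); last by rewrite sf// nitv// mul0r.
have x1 : \1_itv x = 1 :> R by rewrite indicE mem_set//= in_itv.
rewrite /H x1 !mul1r => fh; apply/eqP; rewrite -subr_eq0; apply/eqP/fh.
by rewrite !lt_neqAle; move: xi => /andP[-> ->]; rewrite !andbT; apply/andP; split; apply/eqP => // /esym.
Qed.

Let ft_sum (t : R) :
  (\sum_(i <oo) (sqmod (ft g (t + (int_of_nat i)%:~R * w)))%:E = (2 * L * nrm2 g)%:E)%E.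
Proof.
pose f x := expi (- (t * x)) * g x.
have mt := measurable_Nscale t.
have Lf : L2 f.
  by apply: (L2M_bounded (M := 1) Lg) => [|x]; [exact: cmeasurable_expi|rewrite sqmod_expi].
have sf : supported L f by move=> x /sg; rewrite /f => ->; rewrite mulr0.
have := parseval oe Lf (fun h Lh => total Lf sf Lh).
have -> : nrm2 f = nrm2 g by apply: eq_Rintegral => x _; rewrite sqmodM sqmod_expi mul1r.
rewrite EFinM => <-; rewrite -nneseriesZl => [|i _]; last by rewrite lee_fin sqmod_ge0.
apply: eq_eseriesr => i _; rewrite -EFinM; congr EFin.
have -> : cinner f (e i) = r%:C * ft g (t + (int_of_nat i)%:~R * w).
  rewrite cinnerE /ft -cintZ; last first.
    by apply: cintegrableM_expi; [exact: supported_cintegrable sg|exact: measurable_Nscale].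
  apply: eq_cint => x _; rewrite /f /e !conjcM !conjc_real expiJ mulrDl opprD expiD.
  have [xi|xi] := pselect (- L <= x <= L); last by rewrite sg// !(mulr0, mul0r).
  have -> : \1_itv x = 1 :> R by rewrite indicE mem_set//= in_itv.
  ring.
by rewrite sqmodM sqmodR expr2 r2 mulVKf//; apply: lt0r_neq0; rewrite mulr_gt0.
Qed.

(* Parseval on [[-L, L]] for [g e^{-itx}] gives the sum of [|ft g|^2] over [t + (pi / L) Z];
   then integrate over a period in [t]. *)
Lemma plancherel_supported : L2 (ft g) /\ nrm2 (ft g) = 2 * pi * nrm2 g.
Proof.
have ig := supported_cintegrable Lg sg.
have mS := measurable_sqmod (cmeasurable_ft ig).
pose S x : \bar R := (sqmod (ft g x))%:E.
have mS' : measurable_fun setT S by exact/measurable_EFinP.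
have S0 x : (0 <= S x)%E by rewrite lee_fin sqmod_ge0.
pose k i : R := (int_of_nat i)%:~R.
pose I i : set R := `[k i * w, k i * w + w[%classic.
have UI : \bigcup_i I i = setT.
  apply/seteqP; split => // x _.
  have [i ix] := int_of_nat_surj (Num.floor (x / w)).
  exists i => //; rewrite /I /k ix /= in_itv/= -ler_pdivlMr// floor_le/=.
  rewrite -[X in _ + X]mul1r -mulrDl -ltr_pdivrMr//.
  by rewrite -intrD1 floorD1_gt.
have tI : trivIset setT I.
  apply/trivIsetP => i j _ _ ij; apply/seteqP; split => // x [].
  rewrite /I /= !in_itv/= => /andP[i1 i2] /andP[j1 j2]; apply: (negP ij).
  have lt1 (p q : R) : p * w <= x -> x < q * w + w -> p < q + 1.
    by move=> px xq; rewrite -(ltr_pM2r w0) mulrDl mul1r; exact: le_lt_trans xq.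
  rewrite -(inj_eq int_of_nat_inj) eq_le -!ltzD1 -!(ltr_int R) !intrD.
  by rewrite (lt1 _ _ i1 j2) (lt1 _ _ j1 i2).
have mI i : measurable (I i) by exact: measurable_itv.
have E : (\int[mu]_x S x = (2 * pi * nrm2 g)%:E)%E.
  rewrite -{1}UI ge0_integral_bigcup//; last by rewrite UI.
  have T i : (\int[mu]_(x in I i) S x = \int[mu]_(x in `[0%R, w[) S (x + k i * w)%R)%E.
    rewrite integral_mkcond [in RHS]integral_mkcond.
    have := @ge0_integral_affine 1 (k i * w) (S \_ (I i)) ltr01.
    rewrite invr1 mul1e => <-.
    - apply: eq_integral => x _; rewrite !patchE mul1r; congr (if _ then _ else _).
      apply/idP/idP; rewrite !inE /I /= !in_itv/=; lra.
    - by apply/(measurable_restrictT _ _).1 => //; exact: measurable_funS mS'.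
    - by move=> x; rewrite patchE; case: ifP.
  under eq_eseriesr do rewrite T.
  rewrite -integral_nneseries//; last first.
    move=> i; apply: (@measurable_funS _ _ _ _ setT) => //.
    apply: (measurableT_comp mS'); under eq_fun do rewrite -[X in X + _]mul1r.
    exact: measurable_affine.
  under eq_integral do rewrite ft_sum.
  rewrite integral_cst// [X in (_ * X)%E](_ : _ = w%:E); last first.
    by apply: etrans (lebesgue_measure_itv _) _; rewrite /= lte_fin w0 sube0.
  rewrite -EFinM; congr EFin.
  by rewrite /w; field; rewrite gt_eqF.
split.
  by split; [exact: cmeasurable_ft|rewrite E ltry].
by rewrite /nrm2 /Rintegral E.
Qed.

End PlancherelCompact.

(** * Extension to L^2 by truncation *)

Lemma nrm2_cvg (a : nat -> R -> C) (a' b : R -> C) : (forall n, L2 (a n)) -> L2 a' -> L2 b ->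
  nrm2 (fun x => a n x - a' x) @[n --> \oo] --> 0 ->
  nrm2 (fun x => a n x - b x) @[n --> \oo] --> nrm2 (fun x => a' x - b x).
Proof.
move=> La La' Lb aa.
pose d n x := a n x - a' x; pose c x := a' x - b x.
have Ld n : L2 (d n) by exact: L2B.
have Lc : L2 c by exact: L2B.
have E n : nrm2 (fun x => a n x - b x) = nrm2 (d n) + nrm2 c + 2 * Re (cinner (d n) c).
  by rewrite -nrm2D//; apply: eq_nrm2 => x; rewrite /d /c addrA subrK.
rewrite (_ : nrm2 (fun x => a' x - b x) = 0 + nrm2 c + 2 * 0); last by rewrite mulr0 add0r addr0.
under eq_fun do rewrite E.
apply: cvgD; first by apply: cvgD => //; exact: cvg_cst.
apply: cvgM; first exact: cvg_cst.
have S0 : Num.sqrt (nrm2 (d n) * nrm2 c) @[n --> \oo] --> (0 : R).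
  rewrite -[X in _ --> X]sqrtr0; apply: continuous_cvg; first exact: sqrt_continuous.
  by rewrite -[X in _ --> X](mul0r (nrm2 c)); apply: cvgM => //; exact: cvg_cst.
apply: (@squeeze_cvgr _ _ _ _ (fun n => - Num.sqrt (nrm2 (d n) * nrm2 c))
  (fun n => Num.sqrt (nrm2 (d n) * nrm2 c))) => //.
- apply: nearW => n; rewrite -ler_norml -sqrtr_sqr ler_sqrt.
    exact: le_trans (Re_le_sqmod _) (cauchy_schwarz _ _).
  by rewrite mulr_ge0 ?nrm2_ge0.
- by rewrite -[X in _ --> X]oppr0; exact: cvgN.
Qed.

Definition cut (D : set R) f x : C := (\1_D x : R)%:C * f x.

Lemma sqmod_cut_le D f x : sqmod (cut D f x) <= sqmod (f x).
Proof.
by rewrite sqmodM sqmodR ler_piMl ?sqmod_ge0// indicE; case: (x \in D); rewrite ?expr1n ?expr0n.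
Qed.

Lemma cmeasurable_cut D f : measurable D -> cmeasurable f -> cmeasurable (cut D f).
Proof. by move=> mD mf; apply: cmeasurableM => //; apply: cmeasurable_real. Qed.

Lemma L2_cut D f : measurable D -> L2 f -> L2 (cut D f).
Proof.
move=> mD Lf; apply: (le_L2 _ (L2_sqmod_integrable Lf)).
- by apply: cmeasurable_cut => //; exact: L2_cmeasurable.
- by move=> x; exact: sqmod_cut_le.
Qed.

Lemma cut_in (D : set R) f x : D x -> cut D f x = f x.
Proof. by move=> Dx; rewrite /cut indicE mem_set// mul1r. Qed.

Lemma cut_out (D : set R) f x : ~ D x -> cut D f x = 0.
Proof. by move=> Dx; rewrite /cut indicE memNset// mul0r. Qed.

Lemma nrm2_cut_cvg f (D : nat -> set R) : L2 f -> (forall n, measurable (D n)) ->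
  (forall x, \forall n \near \oo, D n x) ->
  nrm2 (fun x => f x - cut (D n) f x) @[n --> \oo] --> 0.
Proof.
move=> Lf mD Dx.
have := @Rint_dct (fun n x => sqmod (f x - cut (D n) f x)) (fun=> 0) (fun x => sqmod (f x)).
rewrite Rintegral_cst// mul0r; apply.
- move=> n; apply: measurable_sqmod; apply: cmeasurableB; first exact: L2_cmeasurable.
  by apply: cmeasurable_cut => //; exact: L2_cmeasurable.
- move=> x; apply: cvg_near_cst; apply: filterS (Dx x) => n Dn.
  by rewrite cut_in// subrr sqmod0.
- exact: L2_sqmod_integrable.
- move=> n x; rewrite ger0_norm ?sqmod_ge0//.
  have [Dn|Dn] := pselect (D n x); first by rewrite cut_in// subrr sqmod0 sqmod_ge0.
  by rewrite cut_out// subr0.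
Qed.

Lemma supported_cut D f (L : R) : (forall x, D x -> - L <= x <= L) -> supported L (cut D f).
Proof. by move=> DL x xL; rewrite cut_out// => /DL. Qed.

Lemma ftB g h : cintegrable g -> cintegrable h ->
  forall xi, ft (fun x => g x - h x) xi = ft g xi - ft h xi.
Proof.
move=> ig ih xi; have m := measurable_Nscale xi.
rewrite /ft -cintB; [|exact: cintegrableM_expi..].
by apply: eq_cint => x _; rewrite mulrBl.
Qed.

Lemma plancherel_supportedB (L : R) g h : 0 < L -> L2 g -> L2 h -> supported L g -> supported L h ->
  nrm2 (fun xi => ft g xi - ft h xi) = 2 * pi * nrm2 (fun x => g x - h x).
Proof.
move=> L0 Lg Lh sg sh.
have s : supported L (fun x => g x - h x) by move=> x xL; rewrite sg// sh// subrr.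
have [_ <-] := plancherel_supported L0 (L2B Lg Lh) s.
apply: eq_nrm2 => xi; rewrite ftB//; [exact: supported_cintegrable sg|exact: supported_cintegrable sh].
Qed.

Definition ftN (f : R -> C) (N : nat) : R -> C := ft (cut `[- N%:R, N%:R] f).

Lemma ftNE f N xi : ftN f N xi = cint `[- N%:R, N%:R] (fun x => f x * expi (- (xi * x))).
Proof.
by rewrite cint_indic//; apply: eq_cint => x _; rewrite /cut -mulrA mulrC.
Qed.

(** The radius [M.+1] stays positive when [N = 0], as [plancherel_supported] demands; the free [M]
    gives two truncations a common radius. *)
Lemma supported_cutN f (N M : nat) : (N <= M)%N -> supported M.+1%:R (cut `[- N%:R, N%:R] f).
Proof.
move=> NM; apply: supported_cut => x; rewrite /= in_itv/=.
have : N%:R <= M.+1%:R :> R by rewrite ler_nat leqW.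
by move=> NM' /andP[x1 x2]; apply/andP; split; lra.
Qed.

Lemma L2_ftN f N : L2 f -> L2 (ftN f N).
Proof.
move=> Lf; have Lc := @L2_cut `[- N%:R, N%:R] f (measurable_itv _) Lf.
by have [] := plancherel_supported (ltr0Sn _ N) Lc (supported_cutN f (leqnn N)).
Qed.

Lemma fourier_L2P f F : L2 f ->
  fourier_L2 f F <-> L2 F /\ nrm2 (fun xi => ftN f n xi - F xi) @[n --> \oo] --> 0.
Proof.
move=> Lf; rewrite /fourier_L2.
have E N : L2 F -> l2dist2 F (fun xi => cint `[- (N%:R), N%:R] (fun x => f x * expi (- (xi * x)))) =
    (nrm2 (fun xi => ftN f N xi - F xi))%:E.
  move=> LF; rewrite (nrm2_subC (ftN f N) F) -(l2dist2E LF (L2_ftN N Lf)).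
  by congr l2dist2; apply/funext => xi; rewrite ftNE.
split=> -[LF Fl]; split => //.
- by move: Fl; under eq_fun do rewrite E//; exact: fine_cvg.
- by under eq_fun do rewrite E//; apply/cvg_EFin; [exact: nearW|].
Qed.

Lemma cut_itv_cvg f : L2 f ->
  nrm2 (fun x => cut `[- n%:R, n%:R] f x - f x) @[n --> \oo] --> 0.
Proof.
move=> Lf; under eq_fun do rewrite (nrm2_subC _ f).
apply: nrm2_cut_cvg => // x; near=> n; rewrite /= in_itv/= -ler_norml.
by near: n; exact: nbhs_infty_ger.
Unshelve. all: by end_near. Qed.

Lemma fourier_L2_exists f : L2 f -> exists F, fourier_L2 f F.
Proof.
move=> Lf; have Lc n : L2 (cut `[- n%:R, n%:R] f) by exact: L2_cut.
have [] := @L2_complete (ftN f); first by move=> n; exact: L2_ftN.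
  move=> eps eps0; have pi0 := pi_gt0 R.
  (* A factor 4 is lost in the triangle inequality for squared norms and a factor [2 * pi] in
     Plancherel. *)
  have e0 : 0 < eps / (8 * pi) by rewrite divr_gt0// mulr_gt0.
  have /cvgrPdist_lt /(_ _ e0) [N _ NP] := cut_itv_cvg Lf.
  exists N => m n Nm Nn.
  rewrite (plancherel_supportedB (ltr0Sn _ (maxn m n)))//; last 2 first.
  - by apply: supported_cutN; exact: leq_maxl.
  - by apply: supported_cutN; exact: leq_maxr.
  have := nrm2_triangle (Lc m) Lf (Lc n).
  have := NP m Nm; have := NP n Nn; rewrite /= !sub0r !normrN !ger0_norm ?nrm2_ge0//.
  rewrite [X in _ <= _ + 2 * X](nrm2_subC f).
  move: (nrm2 _) (nrm2 _) (nrm2 _) => u v t.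
  rewrite !ltr_pdivlMr ?mulr_gt0// => u1 v1 t1.
  have : 2 * pi * u <= 2 * pi * (2 * v + 2 * t) by rewrite ler_pM2l// mulr_gt0.
  lra.
move=> F LF Fl; exists F; exact/fourier_L2P.
Qed.

(** Both sides are limits along the truncations of [f], for which Plancherel is known. With [g = 0]
    this is Plancherel for [f]; a general [g] allows truncations other than the symmetric ones in
    the definition of the transform. *)
Lemma fourier_L2_dist (L : R) f F g : L2 f -> fourier_L2 f F -> 0 < L -> L2 g -> supported L g ->
  nrm2 (fun xi => F xi - ft g xi) = 2 * pi * nrm2 (fun x => f x - g x).
Proof.
move=> Lf /(fourier_L2P _ Lf)[LF Fl] L0 Lg sg.
have Lc n : L2 (cut `[- n%:R, n%:R] f) by exact: L2_cut.
have [Lftg _] := plancherel_supported L0 Lg sg.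
have c1 := nrm2_cvg (fun n => L2_ftN n Lf) LF Lftg Fl.
have c2 := nrm2_cvg Lc Lf Lg (cut_itv_cvg Lf).
have E n : nrm2 (fun xi => ftN f n xi - ft g xi) =
    2 * pi * nrm2 (fun x => cut `[- n%:R, n%:R] f x - g x).
  have M0 : 0 < L + n%:R by rewrite ltr_wpDr.
  apply: (plancherel_supportedB M0) => //.
  - apply: supported_cut => x; rewrite /= in_itv/= => /andP[x1 x2].
    by apply/andP; split; lra.
  - move=> x xL; apply: sg => /andP[x1 x2]; apply: xL.
    by have n0 : 0 <= n%:R :> R by []; apply/andP; split; lra.
have c3 : nrm2 (fun xi => ftN f n xi - ft g xi) @[n --> \oo] -->
    2 * pi * nrm2 (fun x => f x - g x).
  by under eq_fun do rewrite E; apply: cvgM => //; exact: cvg_cst.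
exact: (cvg_unique _ c1 c3).
Qed.

Lemma fourier_L2_nrm2 f F : L2 f -> fourier_L2 f F -> nrm2 F = 2 * pi * nrm2 f.
Proof.
move=> Lf fF; have s0 : supported 1 (fun=> 0 : C) by [].
have := fourier_L2_dist Lf fF ltr01 L2_0 s0.
have -> : nrm2 (fun xi => F xi - ft (fun=> 0) xi) = nrm2 F.
  apply: eq_nrm2 => xi; rewrite /ft (@eq_cint _ _ (fun=> 0)) ?cint0 ?subr0//.
  by move=> x _; rewrite mul0r.
by move=> ->; congr (_ * _); apply: eq_nrm2 => x; rewrite subr0.
Qed.

Lemma fourier_L2_lin z f F g G : L2 f -> L2 g -> fourier_L2 f F -> fourier_L2 g G ->
  fourier_L2 (fun x => f x + z * g x) (fun xi => F xi + z * G xi).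
Proof.
move=> Lf Lg /(fourier_L2P _ Lf)[LF Fl] /(fourier_L2P _ Lg)[LG Gl].
apply/fourier_L2P; first by apply: L2D => //; exact: L2Z.
split; first by apply: L2D => //; exact: L2Z.
have ic h N : L2 h -> cintegrable (cut `[- N%:R, N%:R] h).
  by move=> Lh; apply: (supported_cintegrable _ (supported_cutN h (leqnn N))); exact: L2_cut.
have E N xi : ftN (fun x => f x + z * g x) N xi = ftN f N xi + z * ftN g N xi.
  have m := measurable_Nscale xi.
  rewrite /ftN /ft -cintZ -?cintD; last 3 first.
  - by apply: cintegrableM_expi => //; exact: ic.
  - by apply: cintegrableZ; apply: cintegrableM_expi => //; exact: ic.
  - by apply: cintegrableM_expi => //; exact: ic.
  by apply: eq_cint => x _; rewrite /cut; ring.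
apply: (@squeeze_cvgr _ _ _ _ (fun=> 0) (fun n => 2 * nrm2 (fun xi => ftN f n xi - F xi) +
   2 * (sqmod z * nrm2 (fun xi => ftN g n xi - G xi)))).
- apply: nearW => n; rewrite nrm2_ge0/=.
  have L1 : L2 (fun xi => ftN f n xi - F xi) by apply: L2B => //; exact: L2_ftN.
  have L2' : L2 (fun xi => ftN g n xi - G xi) by apply: L2B => //; exact: L2_ftN.
  rewrite -nrm2Z//; apply: le_trans (nrm2D_le L1 (L2Z z L2')).
  by rewrite le_eqVlt; apply/orP; left; apply/eqP/eq_nrm2 => xi; rewrite E; ring.
- exact: cvg_cst.
- rewrite -[X in _ --> X](_ : 2 * 0 + 2 * (sqmod z * 0) = 0); last by rewrite !mulr0 addr0.
  by apply: cvgD; apply: cvgM; try exact: cvg_cst; last apply: cvgM; try exact: cvg_cst.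
Qed.

(** Polarisation: the norms of [f + z * g] and of its transform are compared for [z = 1] and
    [z = i]. *)
Lemma fourier_L2_cinner f F g G : L2 f -> L2 g -> fourier_L2 f F -> fourier_L2 g G ->
  cinner F G = (2 * pi)%:C * cinner f g.
Proof.
move=> Lf Lg fF gG; have LF := fF.1; have LG := gG.1.
have K z : Re (z^*%C * cinner F G) = 2 * pi * Re (z^*%C * cinner f g).
  have := fourier_L2_nrm2 (L2D Lf (L2Z z Lg)) (fourier_L2_lin z Lf Lg fF gG).
  rewrite !nrm2D//; [|exact: L2Z..].
  rewrite !nrm2Z// !cinnerZr// (fourier_L2_nrm2 Lf fF) (fourier_L2_nrm2 Lg gG).
  lra.
apply: complex_ext; rewrite (ReM, ImM) ReR ImR mul0r ?subr0 ?addr0.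
- by have := K 1; rewrite conjc1 !mul1r.
- have := K (0 +i* 1)%C; rewrite !ReM /conjc /= !mul0r !sub0r !mulN1r !opprK.
  by [].
Qed.

Lemma ft_affine g (a b xi : R) : 0 < a -> cintegrable g ->
  ft (fun x => g (a * x + b)) xi = (a^-1)%:C * (expi (xi * b / a) * ft g (xi / a)).
Proof.
move=> a0 ig; have m := measurable_Nscale (xi / a).
rewrite /ft -[X in _ * X]cintZ; last exact: cintegrableM_expi.
rewrite -(cint_affine b a0); last by apply: cintegrableZ; exact: cintegrableM_expi.
apply: eq_cint => x _; rewrite mulrCA -expiD; congr (_ * expi _).
by field; rewrite gt_eqF.
Qed.

Lemma fourier_L2_affine f F (a b : R) : 0 < a -> L2 f -> fourier_L2 f F ->
  fourier_L2 (fun x => f (a * x + b)) (fun xi => (a^-1)%:C * (expi (xi * b / a) * F (xi / a))).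
Proof.
move=> a0 Lf fF; have LF := fF.1.
have ai0 : 0 < a^-1 by rewrite invr_gt0.
have key (H : R -> C) : L2 H -> L2 (fun xi => (a^-1)%:C * (expi (xi * b / a) * H (xi / a))) /\
    nrm2 (fun xi => (a^-1)%:C * (expi (xi * b / a) * H (xi / a))) = a^-1 * nrm2 H.
  move=> LH; have LH' : L2 (fun xi => H (xi / a)).
    have := L2_affine 0 ai0 LH; congr L2; apply/funext => x; by rewrite addr0 mulrC.
  have me : cmeasurable (fun xi => expi (xi * b / a)).
    by apply: cmeasurable_expi; under eq_fun do rewrite -mulrA; exact: mulrr_measurable.
  have LH2 : L2 (fun xi => expi (xi * b / a) * H (xi / a)).
    by apply: (L2M_bounded (M := 1) LH' me) => x; rewrite sqmod_expi.
  split; first exact: L2Z.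
  rewrite nrm2Z// sqmodR expr2 -mulrA; congr (_ * _).
  rewrite -[nrm2 H](mulKf (lt0r_neq0 a0)); congr (_ * _).
  have := nrm2_affine 0 ai0 LH; rewrite invrK => <-.
  by apply: eq_Rintegral => x _; rewrite sqmodM sqmod_expi mul1r addr0 mulrC.
apply/fourier_L2P; first exact: L2_affine.
split; first by have [] := key F LF.
(* The substitution turns truncation to [[- n, n]] into truncation of [f] to this interval, in
   general not symmetric; [fourier_L2_dist] measures the error all the same. *)
pose I n : set R := `[- (a * n%:R) + b, a * n%:R + b]%classic.
have mI n : measurable (I n) by exact: measurable_itv.
have Lc n : L2 (cut (I n) f) by exact: L2_cut.
have L0 n : 0 < a * n%:R + `|b| + 1 by rewrite ltr_wpDl// addr_ge0// mulr_ge0// ltW.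
have sI n : supported (a * n%:R + `|b| + 1) (cut (I n) f).
  apply: supported_cut => x; rewrite /I /= in_itv/= => /andP[x1 x2].
  have := ler_norm b; have := ler_norm (- b); rewrite normrN => b1 b2.
  by apply/andP; split; lra.
have ftE n xi : ftN (fun x => f (a * x + b)) n xi =
    (a^-1)%:C * (expi (xi * b / a) * ft (cut (I n) f) (xi / a)).
  rewrite -ft_affine//; last exact: supported_cintegrable (sI n).
  rewrite /ftN; congr ft; apply/funext => x; rewrite /cut !indicE.
  congr ((nat_of_bool _)%:R%:C * _); apply/idP/idP; rewrite !inE /I /= !in_itv/= => /andP[x1 x2];
  apply/andP; split.
  - by rewrite lerD2r -mulrN ler_pM2l.
  - by rewrite lerD2r ler_pM2l.
  - by move: x1; rewrite lerD2r -mulrN ler_pM2l.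
  - by move: x2; rewrite lerD2r ler_pM2l.
have E n : nrm2 (fun xi => ftN (fun x => f (a * x + b)) n xi -
      (a^-1)%:C * (expi (xi * b / a) * F (xi / a))) =
    a^-1 * (2 * pi * nrm2 (fun x => f x - cut (I n) f x)).
  rewrite (nrm2_subC (ftN _ n)) -(fourier_L2_dist Lf fF (L0 n) (Lc n) (sI n)).
  have [Lft _] := plancherel_supported (L0 n) (Lc n) (sI n).
  rewrite -(key _ (L2B LF Lft)).2; apply: eq_nrm2 => xi; rewrite ftE; ring.
rewrite (_ : (0 : R) = a^-1 * (2 * pi * 0)); last by rewrite !mulr0.
under eq_fun do rewrite E.
apply: cvgM; first exact: cvg_cst.
apply: cvgM; first exact: cvg_cst.
apply: nrm2_cut_cvg => // x; near=> n.
have : `|x - b| / a <= n%:R by near: n; exact: nbhs_infty_ger.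
rewrite ler_pdivrMr// ler_norml /I /= in_itv/= mulrC => /andP[x1 x2].
by apply/andP; split; lra.
Unshelve. all: by end_near. Qed.

(** * Correlations of a function with its dilates *)

Lemma lebesgue_measure_affine (a b : R) (A : set R) : 0 < a -> measurable A ->
  (mu ((fun x : R => (a * x + b)%R) @^-1` A) = a^-1%:E * mu A)%E.
Proof.
move=> a0 mA; have mp : measurable ((fun x => a * x + b) @^-1` A).
  by rewrite -[X in measurable X]setTI; exact: (measurable_affine a b).
have mi : measurable_fun setT (fun x : R => (\1_A x : R)%:E) by exact/measurable_EFinP.
have i0 x : (0 <= (\1_A x : R)%:E)%E by rewrite lee_fin.
have E : (\int[mu]_x (\1_A x : R)%:E = mu A)%E by rewrite integral_indic// setIT.
have := ge0_integral_affine b a0 mi i0; rewrite E => <-.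
by rewrite -[LHS](_ : \int[mu]_x (\1_((fun x : R => (a * x + b)%R) @^-1` A) x : R)%:E = _)%E // integral_indic// setIT.
Qed.

Lemma ae_affine (a b : R) (P : R -> Prop) : 0 < a ->
  {ae mu, forall x, P x} -> {ae mu, forall x, P (a * x + b)}.
Proof.
move=> a0 [A [mA A0 PA]]; exists ((fun x => a * x + b) @^-1` A); split.
- by rewrite -[X in measurable X]setTI; exact: (measurable_affine a b).
- by apply: etrans (lebesgue_measure_affine b a0 mA) _; rewrite A0 mule0.
- by move=> x /= Px; exact: PA.
Qed.

Lemma ae_forall_nat (P : nat -> R -> Prop) :
  (forall n, {ae mu, forall x, P n x}) -> {ae mu, forall x, forall n, P n x}.
Proof.
move=> aP; have N : mu.-negligible (\bigcup_n (~` [set x | P n x])).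
  by apply: negligible_bigcup => n; exact: aP.
suff : mu.-negligible (~` [set x | forall n, P n x]) by [].
by apply: negligibleS N => x /= /existsNP[n nP]; exists n.
Qed.

Lemma ae_forall_int (P : int -> R -> Prop) :
  (forall k, {ae mu, forall x, P k x}) -> {ae mu, forall x, forall k, P k x}.
Proof.
move=> aP; apply: (ae_imp (ae_forall_nat (fun n => aP (int_of_nat n)))) => x Px k.
by have [n <-] := int_of_nat_surj k.
Qed.

Lemma int_eq0_bound (P : R) (k : int) : 0 < P -> - P < k%:~R * P < P -> k = 0.
Proof.
move=> P0; rewrite -mulN1r !(ltr_pM2r P0) -{2}[P]mul1r (ltr_pM2r P0).
rewrite -[-1]/((-1)%:~R) -[1]/(1%:~R) !ltr_int => /andP[k1 k2]; lia.
Qed.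

Lemma cintegrable_translate H (s : R) : cintegrable H -> cintegrable (fun x => H (x + s)).
Proof.
by move=> iH; have := cintegrable_affine s ltr01 iH; under eq_fun do rewrite mul1r.
Qed.

Lemma cint_translate H (s : R) : cintegrable H ->
  cint setT (fun x => H (x + s)) = cint setT H.
Proof.
move=> iH; have := cint_affine s ltr01 iH; rewrite invr1 mul1r => <-.
by apply: eq_cint => x _; rewrite mul1r.
Qed.

Lemma cintegrableM_indic H (D : set R) (h : R -> R) : measurable D -> measurable_fun setT h ->
  cintegrable H -> cintegrable (fun x => H x * (\1_D (h x) : R)%:C).
Proof.
move=> mD mh iH; apply: (@cintegrableM_bounded _ _ 1) => // [|x].
  by apply: cmeasurable_real; exact: (measurableT_comp (measurable_indic mD) mh).
by rewrite sqmodR indicE; case: (_ \in D); rewrite ?expr1n ?expr0n.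
Qed.

Lemma measurable_translate (s : R) : measurable_fun setT (fun x : R => x + s).
Proof. by apply: measurable_funD => //; exact: measurable_cst. Qed.

(** The integral of the [2 pi]-periodisation of [H] over []a, b[] is that of [H] over the arc of
    []a, b[], which vanishes. [K] lists the translates that can contribute over []p, q[], so the sum
    is finite. *)
Lemma periodization (H : R -> C) (p q : R) (K : seq int) :
  cintegrable H -> uniq K -> q - p <= 2 * pi ->
  (forall k : int, cint setT (fun x => H x * expi (k%:~R * x)) = 0) ->
  {ae mu, forall x, forall k : int, k \notin K -> p < x - k%:~R * (2 * pi) < q -> H x = 0} ->
  {ae mu, forall x, p < x < q -> \sum_(k <- K) H (x + k%:~R * (2 * pi)) = 0}.
Proof.
move=> iH uK pq H0 HK; have pi0 := pi_gt0 R.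
have P0 : 0 < 2 * pi :> R by rewrite mulr_gt0.
apply: ae0_zero_cint => [|a b pa ab bq].
  by apply: cintegrable_sum => k; exact: cintegrable_translate.
have mI : measurable (`]a, b[%classic : set R) by exact: measurable_itv.
pose J k x : C := H x * (\1_`]a, b[ (x - k%:~R * (2 * pi)) : R)%:C.
have iJ k : cintegrable (J k) by apply: cintegrableM_indic => //; exact: measurable_translate.
have -> : cint setT (fun x => (\sum_(k <- K) H (x + k%:~R * (2 * pi))) * (\1_`]a, b[ x : R)%:C) =
   cint setT (fun x => \sum_(k <- K) J k x).
  transitivity (\sum_(k <- K) cint setT (J k)); last by rewrite cint_sum.
  under eq_bigr => k _ do rewrite -(cint_translate (k%:~R * (2 * pi)) (iJ k)).
  rewrite -cint_sum => [|k]; last exact: cintegrable_translate.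
  by apply: eq_cint => x _; rewrite mulr_suml; apply: eq_bigr => k _; rewrite /J addrK.
have H0' (k : int) : cint setT (fun x => H x * expi (k%:~R * 1 * x)) = 0.
  by rewrite -[RHS](H0 k); apply: eq_cint => x _; rewrite mulr1.
rewrite -[RHS](fourier_zero_arc ltr01 iH H0' ab); last by rewrite mul1r; lra.
have marc : measurable (arc 1 a b).
  rewrite (_ : arc 1 a b = \bigcup_i [set x | a < x - (int_of_nat i)%:~R * (2 * pi / 1) < b]).
    apply: bigcupT_measurable => i.
    rewrite -[X in measurable X]setTI.
    rewrite (_ : [set x | _] = (fun x => x - (int_of_nat i)%:~R * (2 * pi / 1)) @^-1` `]a, b[%classic).
      exact: measurable_translate.
    by apply/seteqP; split => x /=; rewrite in_itv.
  apply/seteqP; split => x [k].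
    by move=> xk; have [i ik] := int_of_nat_surj k; exists i => //=; rewrite ik.
  by move=> _ xk; exists (int_of_nat k).
apply: ae_eq_cint.
- by apply: cintegrable_cmeasurable; exact: cintegrable_sum.
- by apply: cintegrable_cmeasurable; apply: (cintegrableM_indic marc (@measurable_id _ _ _) iH).
apply: (ae_imp HK) => x xK.
have uniqk k k' : a < x - k%:~R * (2 * pi) < b -> a < x - k'%:~R * (2 * pi) < b -> k = k'.
  move=> /andP[k1 k2] /andP[k3 k4]; apply/eqP; rewrite -subr_eq0; apply/eqP.
  by apply: (@int_eq0_bound (2 * pi)) => //; rewrite intrB mulrBl; apply/andP; split; lra.
have [[k]|nk] := pselect (arc 1 a b x).
  rewrite divr1 => xk; rewrite [in RHS]indicE mem_set/=; last by exists k; rewrite divr1.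
  have [kK|kK] := boolP (k \in K).
    rewrite (bigD1_seq k)//= /J indicE mem_set/=; last by rewrite in_itv.
    rewrite big1 ?addr0// => k' kk'; rewrite indicE memNset/= ?mulr0//.
    by rewrite in_itv/= => xk'; move: kk'; rewrite (uniqk _ _ xk' xk) eqxx.
  rewrite (xK k kK) ?mul0r; last by move: xk => /andP[? ?]; apply/andP; split; lra.
  rewrite big1// => k' _; rewrite /J (xK k kK) ?mul0r//.
  by move: xk => /andP[? ?]; apply/andP; split; lra.
rewrite [in RHS]indicE memNset// mulr0 big1// => k _; rewrite /J indicE memNset ?mulr0//=.
by rewrite in_itv/= => xk; apply: nk; exists k; rewrite divr1.
Qed.

(** An entry [(k, p, q)] of [s] is the piece []p, q[ + 2 pi k] of the line. Moving it back onto []p,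
    q[] does not change [e^{imx}], so [H] may be folded piece by piece. *)
Lemma fold_moments (H : R -> C) (s : seq (int * R * R)) (m : int) : cintegrable H ->
  {ae mu, forall x, H x =
     \sum_(t <- s) H x * (\1_`]t.1.2, t.2[ (x - t.1.1%:~R * (2 * pi)) : R)%:C} ->
  cint setT (fun x => H x * expi (m%:~R * x)) =
  cint setT (fun x => (\sum_(t <- s) H (x + t.1.1%:~R * (2 * pi)) * (\1_`]t.1.2, t.2[ x : R)%:C)
    * expi (m%:~R * x)).
Proof.
move=> iH Hs.
pose J (t : int * R * R) x : C :=
  H x * (\1_`]t.1.2, t.2[ (x - t.1.1%:~R * (2 * pi)) : R)%:C * expi (m%:~R * x).
have iJ t : cintegrable (J t).
  apply: cintegrableM_expi; last exact: mulrl_measurable.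
  by apply: cintegrableM_indic => //; exact: measurable_translate.
transitivity (cint setT (fun x => \sum_(t <- s) J t x)).
  apply: ae_eq_cint; [apply: cintegrable_cmeasurable..|].
  - by apply: cintegrableM_expi => //; exact: mulrl_measurable.
  - exact: cintegrable_sum.
  - by apply: (ae_imp Hs) => x {1}->; rewrite mulr_suml.
rewrite cint_sum//; under eq_bigr => t _ do rewrite -(cint_translate (t.1.1%:~R * (2 * pi)) (iJ t)).
rewrite -cint_sum => [|t]; last exact: cintegrable_translate.
apply: eq_cint => x _; rewrite mulr_suml; apply: eq_bigr => t _; rewrite /J addrK.
congr (_ * _); rewrite mulrDr (_ : m%:~R * (t.1.1%:~R * (2 * pi)) = (m * t.1.1)%:~R * (pi *+ 2)).
  by rewrite expi_period.
by rewrite intrM; ring.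
Qed.

(** * Inner products with dilates and translates *)

Lemma fourier_L2Z z f F : L2 f -> fourier_L2 f F ->
  fourier_L2 (fun x => z * f x) (fun xi => z * F xi).
Proof.
move=> Lf fF; have := fourier_L2_lin (z - 1) Lf Lf fF fF.
have E (h : R -> C) : (fun x => h x + (z - 1) * h x) = (fun x => z * h x).
  by apply/funext => x; rewrite mulrBl mul1r addrC subrK.
by rewrite !E.
Qed.

Lemma expr2z_gt0 (j : int) : 0 < (2 : R) ^ j.
Proof. by rewrite exprz_gt0. Qed.

Lemma L2_psi_jk (psi : R -> C) j k : L2 psi -> L2 (psi_jk psi j k).
Proof.
by move=> Lp; apply: L2Z; exact: (L2_affine (- k%:~R) (expr2z_gt0 j) Lp).
Qed.

Definition psih_jk (psih : R -> C) (j k : int) (xi : R) : C :=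
  (Num.sqrt ((2 : R) ^ j))%:C * ((((2 : R) ^ j)^-1)%:C *
    (expi (xi * (- k%:~R) / 2 ^ j) * psih (xi / 2 ^ j))).

Lemma fourier_psi_jk (psi psih : R -> C) j k : L2 psi -> fourier_L2 psi psih ->
  fourier_L2 (psi_jk psi j k) (psih_jk psih j k).
Proof.
move=> Lp fp; apply: fourier_L2Z.
  exact: (L2_affine (- k%:~R) (expr2z_gt0 j) Lp).
exact: (fourier_L2_affine (- k%:~R) (expr2z_gt0 j) Lp fp).
Qed.

Lemma cinner_psi_jk (f F psi psih : R -> C) (j k : int) : L2 f -> L2 psi ->
  fourier_L2 f F -> fourier_L2 psi psih ->
  cinner f (psi_jk psi j k) = (Num.sqrt ((2 : R) ^ j) / (2 * pi))%:C *
    cint setT (fun y => F (2 ^ j * y) * (psih y)^*%C * expi (k%:~R * y)).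
Proof.
move=> Lf Lp fF fp; have a0 := expr2z_gt0 j; set a := (2 : R) ^ j in a0 *.
have LF := fF.1; have Lph := fp.1; have pi0 := pi_gt0 R.
have := fourier_L2_cinner Lf (L2_psi_jk j k Lp) fF (fourier_psi_jk j k Lp fp).
have LF' : L2 (fun y => F (a * y)).
  by have := L2_affine 0 a0 LF; under eq_fun do rewrite addr0.
have iE : cintegrable (fun y => F (a * y) * (psih y)^*%C * expi (k%:~R * y)).
  by apply: cintegrableM_expi; [exact: L2_mul_cintegrable|exact: mulrl_measurable].
have -> : cinner F (psih_jk psih j k) = (Num.sqrt a)%:C *
    cint setT (fun y => F (a * y) * (psih y)^*%C * expi (k%:~R * y)).
  have ai0 : 0 < a^-1 by rewrite invr_gt0.
  have := cint_affine 0 ai0 iE; rewrite invrK => E.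
  have iE' := cintegrable_affine 0 ai0 iE.
  rewrite cinnerE (@eq_cint _ _ (fun x => (Num.sqrt a * a^-1)%:C * (F (a * (a^-1 * x + 0)) *
     (psih (a^-1 * x + 0))^*%C * expi (k%:~R * (a^-1 * x + 0))))); last first.
    move=> x _; rewrite /psih_jk -/a !conjcM !conjc_real expiJ addr0 (mulVKf (lt0r_neq0 a0)).
    rewrite (_ : - (x * - k%:~R / a) = k%:~R * (a^-1 * x)); last by ring.
    rewrite (mulrC a^-1) rmorphM /=; ring.
  rewrite cintZ// E mulrA -rmorphM /=; congr (_%:C * _).
  by rewrite mulfVK// gt_eqF.
move=> E; apply: (@mulfI _ (2 * pi)%:C).
  by rewrite (inj_eq (@complexI R) _ 0); apply: lt0r_neq0; rewrite mulr_gt0.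
rewrite -E mulrA -rmorphM /=; congr (_%:C * _).
by rewrite mulrC divfK//; apply: lt0r_neq0; rewrite mulr_gt0.
Qed.

Lemma psi_jk00 (psi : R -> C) : psi_jk psi 0 0 = psi.
Proof. by apply/funext => x; rewrite /psi_jk expr0z sqrtr1 !mul1r subr0. Qed.

(** For [F] the transform of [psi] this is, up to a positive factor, the inner product of [psi] with
    [psi_{d,m}]. Rescaling reduces every pair of scales to such a lag [d]. *)
Definition corr (F : R -> C) (d : nat) (m : int) : C :=
  cint setT (fun y => F (2 ^+ d * y) * (F y)^*%C * expi (m%:~R * y)).

Lemma corr_translates (f F : R -> C) (k : int) : L2 f -> fourier_L2 f F ->
  cinner f (psi_jk f 0 k) = ((2 * pi)^-1)%:C * corr F 0 k.
Proof.
move=> Lf fF; rewrite (cinner_psi_jk _ _ Lf Lf fF fF) expr0z sqrtr1 div1r.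
by congr (_ * _); apply: eq_cint => x _; rewrite expr0.
Qed.

Lemma two_pi_neq0 : (2 * pi)%:C != 0 :> C.
Proof. by rewrite (inj_eq (@complexI R) _ 0); apply: lt0r_neq0; rewrite mulr_gt0// pi_gt0. Qed.

Lemma orthonormal_corr (psi psih : R -> C) : L2 psi -> fourier_L2 psi psih ->
  Defs.orthonormal (fun jk : int * int => psi_jk psi jk.1 jk.2) <->
  (forall m, corr psih 0 m = (if m == 0 then 2 * pi else 0)%:C) /\
  (forall d m, corr psih d.+1 m = 0).
Proof.
move=> Lp fp; have pi2 := two_pi_neq0.
split=> [[_ o]|[c0 cd]].
  have E (d : nat) m : cinner psi (psi_jk psi d m) = (Num.sqrt ((2 : R) ^ d) / (2 * pi))%:C * corr psih d m.
    by rewrite (cinner_psi_jk _ _ Lp Lp fp fp).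
  split=> [m|d m].
    have := E 0 m; rewrite expr0z sqrtr1 div1r -{1}(psi_jk00 psi).
    have [od oz] := o (0, 0) (0, m); case: eqVneq => [m0|m0].
      rewrite od ?m0// => E0; rewrite -[RHS]mulr1 E0 mulrA -rmorphM /=.
      by rewrite divff ?mul1r// lt0r_neq0// mulr_gt0// pi_gt0.
    rewrite oz; last by case=> /esym m0'; move: m0; rewrite m0' eqxx.
    move/esym/eqP; rewrite mulf_eq0 => /orP[/eqP|/eqP//].
    by rewrite fmorphV => /eqP; rewrite invr_eq0 (negbTE pi2).
  have [_ oz] := o (0, 0) (d.+1 : int, m).
  have := E d.+1 m; rewrite -{1}(psi_jk00 psi) oz//.
  move/esym/eqP; rewrite mulf_eq0 => /orP[|/eqP//].
  rewrite (inj_eq (@complexI R) _ 0) mulf_eq0 sqrtr_eq0 leNgt expr2z_gt0/= invr_eq0.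
  by rewrite (negbTE (lt0r_neq0 _))// mulr_gt0// pi_gt0.
have L jk : L2 (psi_jk psi jk.1 jk.2) by exact: L2_psi_jk.
(* For [j = j' + d] the inner product is a multiple of a correlation at lag [d]. *)
have key (j' k' k : int) (d : nat) : cinner (psi_jk psi j' k') (psi_jk psi (j' + d) k) =
    (Num.sqrt ((2 : R) ^ (j' + d)) * Num.sqrt ((2 : R) ^ j') / 2 ^ j' / (2 * pi))%:C *
    corr psih d (k - (2 ^ d)%N%:Z * k').
  rewrite (cinner_psi_jk _ _ (L (j', k')) Lp (fourier_psi_jk j' k' Lp fp) fp).
  set a := (2 : R) ^ j'; have a0 : a != 0 by rewrite lt0r_neq0// expr2z_gt0.
  have -> : (2 : R) ^ (j' + d) = a * 2 ^+ d by rewrite expfzDr.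
  have iE m : cintegrable (fun y => psih (2 ^+ d * y) * (psih y)^*%C * expi (m * y)).
    apply: cintegrableM_expi; last exact: mulrl_measurable.
    have p2 : 0 < (2 : R) ^+ d by rewrite exprn_gt0.
    have := L2_affine 0 p2 fp.1; under eq_fun do rewrite addr0.
    by move=> Lq; exact: L2_mul_cintegrable Lq fp.1.
  rewrite (@eq_cint _ _ (fun y => (Num.sqrt a / a)%:C * (psih (2 ^+ d * y) * (psih y)^*%C *
     expi ((k - (2 ^ d)%N%:Z * k')%:~R * y)))).
    rewrite cintZ// mulrA -rmorphM /=; congr (_%:C * _).
    by rewrite -!mulrA; congr (_ * _); rewrite mulrC -!mulrA.
  move=> y _; rewrite /psih_jk -/a.
  have -> : a * 2 ^+ d * y / a = 2 ^+ d * y by field.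
  have -> : (k - (2 ^ d)%N%:Z * k')%:~R * y = k%:~R * y + a * 2 ^+ d * y * - k'%:~R / a :> R.
    by rewrite intrB intrM -pmulrn natrX; field.
  rewrite expiD (mulrC (Num.sqrt a)) rmorphM /=; ring.
split=> // -[j1 k1] [j2 k2] /=.
have eqj (j k k' : int) : cinner (psi_jk psi j k) (psi_jk psi j k') = (k == k')%:R.
  have := key j k k' 0%N; rewrite addr0 => ->.
  rewrite c0 expn0 mul1r subr_eq0 (eq_sym k').
  case: eqP => _; last by rewrite mulr0.
  rewrite -rmorphM /= -[RHS]/(1%:C); congr (_%:C).
  rewrite -expr2 sqr_sqrtr ?ltW ?expr2z_gt0//.
  rewrite divff ?lt0r_neq0 ?expr2z_gt0// mul1r mulVf//.
  by rewrite lt0r_neq0// mulr_gt0// pi_gt0.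
have ltj (j j' k k' : int) : j < j' -> cinner (psi_jk psi j k) (psi_jk psi j' k') = 0.
  move=> jj'; have [d ->] : exists d : nat, j' = j + d.+1%:Z.
    by exists (absz (j' - j - 1)%R); clear -jj'; lia.
  by rewrite key cd mulr0.
split=> [[<- <-]|]; first by rewrite eqj eqxx.
have [jj|jj|->] := ltgtP j1 j2 => ne.
- exact: ltj.
- by rewrite (cinnerC (L (j1, k1)) (L (j2, k2))) ltj// conjc0.
- by rewrite eqj; case: eqP => // kk; case: ne; rewrite kk.
Qed.

(** * Fibres of the support *)

Lemma ae_normr_neq (r : R) : {ae mu, forall x : R, `|x| <> r}.
Proof.
apply: (ae_imp2 (ae_neq r) (ae_neq (- r))) => x h1 h2 xr.
have [x0|x0] := leP 0 x; first by apply: h1; rewrite -xr ger0_norm.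
by apply: h2; rewrite -xr ltr0_norm// opprK.
Qed.

Lemma indic_itv_in (p q x : R) : p < x < q -> \1_`]p, q[ x = 1 :> R.
Proof. by move=> h; rewrite indicE mem_set//= in_itv. Qed.

Lemma indic_itv_out (p q x : R) : x <= p \/ q <= x -> \1_`]p, q[ x = 0 :> R.
Proof.
move=> h; rewrite indicE memNset//= in_itv/= => /andP[h1 h2].
by case: h; rewrite leNgt ?h1 ?h2.
Qed.

Lemma cintegrable_indic_itv (p q : R) : cintegrable (fun x => (\1_`[p, q] x : R)%:C).
Proof. by split; [exact: Rintegrable_indic_itv|exact: integrable0]. Qed.

(** Subtracting [c] times the indicator of the full period [[p, p + 2 pi]] makes all moments vanish
    and reduces to [periodization]. Over []p, q[] the subtracted function is seen at index 0 only,
    hence [0 \in K]. *)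
Lemma periodization_cst (H : R -> C) (c p q : R) (K : seq int) :
  cintegrable H -> uniq K -> 0 \in K -> q - p <= 2 * pi ->
  (forall k : int, cint setT (fun x => H x * expi (k%:~R * x)) =
    (if k == 0 then c * (2 * pi) else 0)%:C) ->
  {ae mu, forall x, forall k : int, k \notin K -> p < x - k%:~R * (2 * pi) < q -> H x = 0} ->
  {ae mu, forall x, p < x < q -> \sum_(k <- K) H (x + k%:~R * (2 * pi)) = c%:C}.
Proof.
move=> iH uK K0 pq Hc HK; have P0 : 0 < 2 * pi :> R by rewrite mulr_gt0// pi_gt0.
pose I x : C := c%:C * (\1_`[p, p + 2 * pi] x : R)%:C.
have iI : cintegrable I by apply: cintegrableZ; exact: cintegrable_indic_itv.
have I0 x : ~ (p <= x <= p + 2 * pi) -> I x = 0.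
  by move=> nx; rewrite /I indicE memNset ?mulr0//= in_itv.
have iHI : cintegrable (fun x => H x - I x) by exact: cintegrableB.
have key (x : R) (k : int) : p < x < q -> p <= x + k%:~R * (2 * pi) <= p + 2 * pi -> k = 0.
  move=> /andP[x1 x2] /andP[k1 k2]; apply: (@int_eq0_bound (2 * pi)) => //.
  by apply/andP; split; lra.
have H'0 k : cint setT (fun x => (H x - I x) * expi (k%:~R * x)) = 0.
  have m : measurable_fun setT (fun x : R => k%:~R * x) by exact: mulrl_measurable.
  rewrite (@eq_cint _ _ (fun x => H x * expi (k%:~R * x) - c%:C *
      (expi (k%:~R * x) * (\1_`[p, p + 2 * pi] x : R)%:C))); last first.
    by move=> x _; rewrite /I; ring.
  have iE : cintegrable (fun x => expi (k%:~R * x) * (\1_`[p, p + 2 * pi] x : R)%:C).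
    under eq_fun do rewrite mulrC.
    by apply: cintegrableM_expi => //; exact: cintegrable_indic_itv.
  rewrite cintB; [|exact: cintegrableM_expi|exact: cintegrableZ].
  rewrite Hc cintZ// -cint_indic; last exact: measurable_itv.
  have := cint_expi_period p k ltr01; rewrite divr1.
  under eq_cint do rewrite mulr1.
  move=> ->; rewrite -rmorphM /=; case: ifP => _; first by rewrite subrr.
  by rewrite mulr0 subrr.
have HK' : {ae mu, forall x, forall k : int, k \notin K -> p < x - k%:~R * (2 * pi) < q ->
    H x - I x = 0}.
  apply: (ae_imp HK) => x h k kK xk; rewrite (h k kK xk) sub0r I0 ?oppr0// => xi.
  have := key _ k xk; rewrite subrK => /(_ xi) k0.
  by move: kK; rewrite k0 K0.
apply: (ae_imp (periodization iHI uK pq H'0 HK')) => x h xpq.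
have := h xpq; rewrite sumrB => /eqP; rewrite subr_eq0 => /eqP ->.
rewrite (bigD1_seq 0)//= mul0r addr0 big1 => [|k k0].
  rewrite addr0 /I indicE mem_set ?mulr1//= in_itv/=.
  by move: xpq => /andP[x1 x2]; apply/andP; split; lra.
by rewrite I0// => /(key _ _ xpq) k0'; move: k0; rewrite k0' eqxx.
Qed.

(* With [N = 2^(n-1)], [u = pi / (2^n - 1)], [P = 2 pi] and [K = N / 2] these are
   the constants of the theorem; [c_n = N e] and [d_n = N b]. *)
Record tiling (N u a b e P : R) (K : int) : Prop := Tiling {
  _ : 0 < u; _ : 2 * u <= a; _ : b = 2 * a; _ : e = 2 * a - 2 * u;
  _ : P = 4 * a - 2 * u; _ : P = 2 * pi; _ : 2 <= N;
  _ : N * e = K%:~R * P - a; _ : N * b = K%:~R * P + a;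
  _ : P <= K%:~R * P; _ : N * P = 2 * (K%:~R * P) }.

Section Tiling.
Variables (N u a b e P : R) (K : int).
Hypothesis T : tiling N u a b e P K.

Definition in_band (x : R) := a <= `|x| <= b \/ N * e <= `|x| <= N * b.

Let P0 : 0 < P. Proof. have [hu ha hb he hP hpi hN hNe hNb hK hNP] := T. lra. Qed.

(** By [N e = K P - a] and [N b = K P + a], the outer bands are translates of [[- a, a]]. *)
Let bandE x : in_band x -> [\/ a <= x <= b, - b <= x <= - a,
  K%:~R * P - a <= x <= K%:~R * P + a | - (K%:~R * P) - a <= x <= - (K%:~R * P) + a].
Proof.
have [hu ha hb he hP hpi hN hNe hNb hK hNP] := T.
rewrite /in_band hNe hNb; have [x0|x0] := leP 0 x.
  by rewrite ger0_norm//; case=> h; [exact: Or41|exact: Or43].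
by rewrite ltr0_norm//; case=> /andP[h1 h2]; [apply: Or42|apply: Or44]; apply/andP; split; lra.
Qed.

Let intP (j k : int) : - P < (k - j)%:~R * P < P -> k = j.
Proof. by move=> /(int_eq0_bound P0)/eqP; rewrite subr_eq0 => /eqP. Qed.

Let intPE (j k : int) : (k - j)%:~R * P = k%:~R * P - j%:~R * P.
Proof. by rewrite intrB mulrBl. Qed.

(** In each of the four pieces of the band the bounds confine [k * P] to within less than [P] of one
    multiple of [P]. On the outer pieces this forces [k = K] or [k = - K], and then [x - k P] lies
    in [[- a, a]], a contradiction. The next three lemmas follow the same pattern. *)
Let fiber_ae x k : in_band x -> a < x - k%:~R * P < e -> k = 0.
Proof.
have [hu ha hb he hP hpi hN hNe hNb hK hNP] := T.
move=> /bandE + /andP[h1 h2]; case=> /andP[x1 x2].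
- by apply: intP; rewrite intPE mul0r; apply/andP; split; lra.
- by apply: intP; rewrite intPE mul0r; apply/andP; split; lra.
- have kK : k = K by apply: intP; rewrite intPE; apply/andP; split; lra.
  by exfalso; move: h1; rewrite kK; lra.
- have kK : k = - K by apply: intP; rewrite intPE mulrNz mulNr; apply/andP; split; lra.
  by exfalso; move: h1; rewrite kK mulrNz mulNr; lra.
Qed.

Let fiber_Nae x k : in_band x -> - e < x - k%:~R * P < - a -> k = 0.
Proof.
have [hu ha hb he hP hpi hN hNe hNb hK hNP] := T.
move=> /bandE + /andP[h1 h2]; case=> /andP[x1 x2].
- by apply: intP; rewrite intPE mul0r; apply/andP; split; lra.
- by apply: intP; rewrite intPE mul0r; apply/andP; split; lra.
- have kK : k = K by apply: intP; rewrite intPE; apply/andP; split; lra.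
  by exfalso; move: h2; rewrite kK; lra.
- have kK : k = - K by apply: intP; rewrite intPE mulrNz mulNr; apply/andP; split; lra.
  by exfalso; move: h2; rewrite kK mulrNz mulNr; lra.
Qed.

Let fiber_eb x k : in_band x -> e < x - k%:~R * P < b -> k = 0 \/ k = -1.
Proof.
have [hu ha hb he hP hpi hN hNe hNb hK hNP] := T.
move=> /bandE + /andP[h1 h2]; case=> /andP[x1 x2].
- by left; apply: intP; rewrite intPE mul0r; apply/andP; split; lra.
- by right; apply: intP; rewrite intPE mulN1r; apply/andP; split; lra.
- have kK : k = K by apply: intP; rewrite intPE; apply/andP; split; lra.
  by exfalso; move: h1 h2; rewrite kK; lra.
- have kK : k = - K by apply: intP; rewrite intPE mulrNz mulNr; apply/andP; split; lra.
  by exfalso; move: h1 h2; rewrite kK mulrNz mulNr; lra.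
Qed.

Let fiber_Naa x k : in_band x -> - a < x - k%:~R * P < a -> k = K \/ k = - K.
Proof.
have [hu ha hb he hP hpi hN hNe hNb hK hNP] := T.
move=> /bandE + /andP[h1 h2]; case=> /andP[x1 x2].
- have kK : k = 0 by apply: intP; rewrite intPE mul0r; apply/andP; split; lra.
  by exfalso; move: h1 h2; rewrite kK mul0r; lra.
- have kK : k = 0 by apply: intP; rewrite intPE mul0r; apply/andP; split; lra.
  by exfalso; move: h1 h2; rewrite kK mul0r; lra.
- by left; apply: intP; rewrite intPE; apply/andP; split; lra.
- by right; apply: intP; rewrite intPE mulrNz mulNr; apply/andP; split; lra.
Qed.

Let K0 : K != 0.
Proof.
have [hu ha hb he hP hpi hN hNe hNb hK hNP] := T.
by apply/eqP => K0; move: hK P0; rewrite K0 mul0r => h1 h2; lra. Qed.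

(* The band meets the fibre [x + P Z] in one point for [x] in [+-(a, e)], and in
   two points for [x] in [(e, b)] or [(-a, a)]. *)
Definition fibre_sums (H : R -> C) (c : R) : Prop :=
  {ae mu, forall x, [/\ a < x < e -> H x = c%:C, - e < x < - a -> H x = c%:C,
    e < x < b -> H x + H (x - P) = c%:C
    & - a < x < a -> H (x + K%:~R * P) + H (x - K%:~R * P) = c%:C]}.

(** These are the moments of an integrable function whose [2 pi]-periodisation is the constant
    [c]. *)
Definition flat_moments (H : R -> C) (c : R) : Prop :=
  forall m : int, cint setT (fun x => H x * expi (m%:~R * x)) =
    (if m == 0 then c * (2 * pi) else 0)%:C.

Lemma fibre_sums_of_flat_moments (H : R -> C) c : cintegrable H ->
  {ae mu, forall x, ~ in_band x -> H x = 0} -> flat_moments H c -> fibre_sums H c.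
Proof.
have [hu ha hb he hP hpi hN hNe hNb hK hNP] := T.
move=> iH H0 Hc; have pc (p q : R) (L : seq int) := @periodization_cst H c p q L iH.
rewrite -hpi in pc; have Hc' := Hc; rewrite /flat_moments -hpi in Hc'.
have s1 : {ae mu, forall x, a < x < e -> \sum_(k <- [:: 0]) H (x + k%:~R * P) = c%:C}.
  apply: pc => //; first by lra.
  apply: (ae_imp H0) => x h k k0 xk; apply: contrapT => Hx.
  have /(fiber_ae) /(_ xk) k0' : in_band x by apply: contrapT => /h.
  by move: k0; rewrite k0' inE eqxx.
have s2 : {ae mu, forall x, - e < x < - a -> \sum_(k <- [:: 0]) H (x + k%:~R * P) = c%:C}.
  apply: pc => //; first by lra.
  apply: (ae_imp H0) => x h k k0 xk; apply: contrapT => Hx.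
  have /(fiber_Nae) /(_ xk) k0' : in_band x by apply: contrapT => /h.
  by move: k0; rewrite k0' inE eqxx.
have s3 : {ae mu, forall x, e < x < b -> \sum_(k <- [:: 0; -1]) H (x + k%:~R * P) = c%:C}.
  apply: pc => //; first by lra.
  apply: (ae_imp H0) => x h k k0 xk; apply: contrapT => Hx.
  have xB : in_band x by apply: contrapT => /h.
  have [k0'|k0'] := fiber_eb xB xk.
    by move: k0; rewrite k0' !inE eqxx.
  by move: k0; rewrite k0' !inE eqxx orbT.
(* Index 0 is listed because [periodization_cst] puts the constant there. Its term [H x] drops out
   at the end, as []- a, a[] misses the band. *)
have s4 : {ae mu, forall x, - a < x < a -> \sum_(k <- [:: 0; K; - K]) H (x + k%:~R * P) = c%:C}.
  apply: pc => //.
  - rewrite /= !inE negb_or (eq_sym 0) K0 eq_sym oppr_eq0 K0/= andbT.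
    by apply/eqP => KK; move: K0; clear -KK; lia.
  - by lra.
  apply: (ae_imp H0) => x h k k0 xk; apply: contrapT => Hx.
  have xB : in_band x by apply: contrapT => /h.
  have [k0'|k0'] := fiber_Naa xB xk.
    by move: k0; rewrite k0' !inE eqxx orbT.
  by move: k0; rewrite k0' !inE eqxx !orbT.
apply: (ae_imp2 (ae_and s1 s2) (ae_and (ae_and s3 s4) H0)).
move=> x [h1 h2] [[h3 h4] h0]; split.
- by move=> /h1; rewrite big_seq1 mul0r addr0.
- by move=> /h2; rewrite big_seq1 mul0r addr0.
- by move=> /h3; rewrite !big_cons big_nil mul0r !addr0 mulN1r.
- move=> xa; have := h4 xa; rewrite !big_cons big_nil mul0r !addr0 mulrNz mulNr.
  rewrite h0 ?add0r// => -[]/andP[]; rewrite ?hNe; move: xa; rewrite -ltr_norml; lra.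
Qed.

(** The period [[- a, P - a]] is cut at [a], [e] and [b] into four tiles. The last one, []b, P -
    a[], is []- e, - a[] translated by [P]. *)
Let tile x (v1 v2 v3 v4 v5 : R) := [/\ \1_`]a, e[ x = v1, \1_`]b, P - a[ x = v2,
  \1_`]e, b[ x = v3, \1_`]- a, a[ x = v4 & \1_`[- a, - a + P] x = v5].

Let tile_closed x : - a <= x -> x <= - a + P -> \1_`[- a, - a + P] x = 1 :> R.
Proof. by move=> h1 h2; rewrite indicE mem_set//= in_itv/= h1. Qed.

Let tile_out x : x < - a \/ P - a < x -> tile x 0 0 0 0 0.
Proof.
have [hu ha hb he hP _ _ _ _ _ _] := T.
case=> h; split.
- by apply: indic_itv_out; left; lra.
- by apply: indic_itv_out; left; lra.
- by apply: indic_itv_out; left; lra.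
- by apply: indic_itv_out; left; lra.
- by rewrite indicE memNset//= in_itv/= => /andP[]; lra.
- by apply: indic_itv_out; right; lra.
- by apply: indic_itv_out; right; lra.
- by apply: indic_itv_out; right; lra.
- by apply: indic_itv_out; right; lra.
- by rewrite indicE memNset//= in_itv/= => /andP[]; lra.
Qed.

Let tile_Naa x : - a < x -> x < a -> tile x 0 0 0 1 1.
Proof.
have [hu ha hb he hP _ _ _ _ _ _] := T; move=> h1 h2; split.
- by apply: indic_itv_out; left; lra.
- by apply: indic_itv_out; left; lra.
- by apply: indic_itv_out; left; lra.
- by apply: indic_itv_in; rewrite h1.
- by apply: tile_closed; lra.
Qed.

Let tile_ae x : a < x -> x < e -> tile x 1 0 0 0 1.
Proof.
have [hu ha hb he hP _ _ _ _ _ _] := T; move=> h1 h2; split.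
- by apply: indic_itv_in; rewrite h1.
- by apply: indic_itv_out; left; lra.
- by apply: indic_itv_out; left; lra.
- by apply: indic_itv_out; right; lra.
- by apply: tile_closed; lra.
Qed.

Let tile_eb x : e < x -> x < b -> tile x 0 0 1 0 1.
Proof.
have [hu ha hb he hP _ _ _ _ _ _] := T; move=> h1 h2; split.
- by apply: indic_itv_out; right; lra.
- by apply: indic_itv_out; left; lra.
- by apply: indic_itv_in; rewrite h1.
- by apply: indic_itv_out; right; lra.
- by apply: tile_closed; lra.
Qed.

Let tile_bP x : b < x -> x < P - a -> tile x 0 1 0 0 1.
Proof.
have [hu ha hb he hP _ _ _ _ _ _] := T; move=> h1 h2; split.
- by apply: indic_itv_out; right; lra.
- by apply: indic_itv_in; rewrite h1.
- by apply: indic_itv_out; right; lra.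
- by apply: indic_itv_out; right; lra.
- by apply: tile_closed; lra.
Qed.

Let tile_shift x : b < x -> x < P - a -> - e < x - P < - a.
Proof.
by have [hu ha hb he hP _ _ _ _ _ _] := T; move=> h1 h2; apply/andP; split; lra.
Qed.

Let pos_abe : [/\ 0 < a, 0 < e & 0 < b].
Proof. by have [hu ha hb he hP _ _ _ _ _ _] := T; split; lra. Qed.

Let band_cases x : in_band x -> `|x| <> a -> `|x| <> e -> `|x| <> b ->
    `|x| <> N * e -> `|x| <> N * b ->
  [\/ a < x < e \/ e < x < b, - b < x < - e \/ - e < x < - a,
  K%:~R * P - a < x < K%:~R * P + a | - (K%:~R * P) - a < x < - (K%:~R * P) + a].
Proof.
have [_ _ _ _ _ _ _ hNe hNb _ _] := T.
have sq (p q : R) : p <= `|x| <= q -> `|x| <> p -> `|x| <> q -> p < `|x| < q.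
  by move=> /andP[h1 h2] /eqP n1 /eqP n2; rewrite !lt_neqAle h1 h2 n2 eq_sym n1.
move: sq; rewrite /in_band hNe hNb.
have [x0|x0] := leP 0 x; [rewrite (ger0_norm x0)|rewrite (ltr0_norm x0)] => sq;
  move=> + xa xe xb xNe xNb; case=> /sq.
- move=> /(_ xa xb) /andP[h1 h2]; apply: Or41.
  by have [h|h|h] := ltgtP x e; [left|right|case: (xe h)]; apply/andP.
- by move=> /(_ xNe xNb) h; exact: Or43.
- move=> /(_ xa xb) /andP[h1 h2]; apply: Or42.
  by have [h|h|h] := ltgtP (- x) e; [right|left|case: (xe h)]; apply/andP; split; lra.
- by move=> /(_ xNe xNb) /andP[h1 h2]; apply: Or44; apply/andP; split; lra.
Qed.

(** Away from endpoints, each point of the band lies in exactly one of six translated tiles: one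
    over []a, e[], one over []b, P - a[], two over []e, b[] and two over []- a, a[]. *)
Let band_tiles x : in_band x -> `|x| <> a -> `|x| <> e -> `|x| <> b ->
    `|x| <> N * e -> `|x| <> N * b ->
  let t1 := \1_`]a, e[ x : R in let t2 := \1_`]b, P - a[ (x + P) : R in
  let t3 := \1_`]e, b[ x : R in let t4 := \1_`]e, b[ (x + P) : R in
  let t5 := \1_`]- a, a[ (x - K%:~R * P) : R in
  let t6 := \1_`]- a, a[ (x + K%:~R * P) : R in
  t1 + (t2 + (t3 + (t4 + (t5 + t6)))) = 1.
Proof.
move=> xB xa xe xb xNe xNb /=; have [hu ha hb he hP _ _ _ _ hK _] := T.
case: (band_cases xB xa xe xb xNe xNb) => [[]|[]||] /andP[h1 h2] {xB xa xe xb xNe xNb}.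
- rewrite (@indic_itv_in a e)// ?h1//.
  rewrite (@indic_itv_out b); last by right; lra.
  rewrite (@indic_itv_out e); last by left; lra.
  rewrite (@indic_itv_out e); last by right; lra.
  rewrite (@indic_itv_out (- a)); last by left; lra.
  rewrite (@indic_itv_out (- a)); last by right; lra.
  by rewrite !addr0.
- rewrite (@indic_itv_out a); last by right; lra.
  rewrite (@indic_itv_out b); last by right; lra.
  rewrite (@indic_itv_in e); last by rewrite h1.
  rewrite (@indic_itv_out e); last by right; lra.
  rewrite (@indic_itv_out (- a)); last by left; lra.
  rewrite (@indic_itv_out (- a)); last by right; lra.
  by rewrite !addr0 !add0r.
- rewrite (@indic_itv_out a); last by left; lra.
  rewrite (@indic_itv_out b); last by left; lra.
  rewrite (@indic_itv_out e); last by left; lra.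
  rewrite (@indic_itv_in e); last by apply/andP; split; lra.
  rewrite (@indic_itv_out (- a)); last by left; lra.
  rewrite (@indic_itv_out (- a)); last by right; lra.
  by rewrite !addr0 !add0r.
- rewrite (@indic_itv_out a); last by left; lra.
  rewrite (@indic_itv_in b); last by apply/andP; split; lra.
  rewrite (@indic_itv_out e); last by left; lra.
  rewrite (@indic_itv_out e); last by right; lra.
  rewrite (@indic_itv_out (- a)); last by left; lra.
  rewrite (@indic_itv_out (- a)); last by right; lra.
  by rewrite !addr0 !add0r.
- rewrite (@indic_itv_out a); last by right; lra.
  rewrite (@indic_itv_out b); last by right; lra.
  rewrite (@indic_itv_out e); last by right; lra.
  rewrite (@indic_itv_out e); last by right; lra.
  rewrite (@indic_itv_in (- a)); last by apply/andP; split; lra.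
  rewrite (@indic_itv_out (- a)); last by right; lra.
  by rewrite !addr0 !add0r.
- rewrite (@indic_itv_out a); last by left; lra.
  rewrite (@indic_itv_out b); last by left; lra.
  rewrite (@indic_itv_out e); last by left; lra.
  rewrite (@indic_itv_out e); last by left; lra.
  rewrite (@indic_itv_out (- a)); last by left; lra.
  rewrite (@indic_itv_in (- a)); last by apply/andP; split; lra.
  by rewrite !add0r.
Qed.

(** Folding the six pieces of the band into one period turns [H] into [c] times the indicator of
    that period, whose moments are known. *)
Lemma flat_moments_of_fibre_sums (H : R -> C) c : cintegrable H ->
  {ae mu, forall x, ~ in_band x -> H x = 0} -> fibre_sums H c -> flat_moments H c.
Proof.
have [_ _ _ _ _ hpi _ hNe hNb _ _] := T; have [a0 e0 b0] := pos_abe.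
move=> iH H0 Hs m.
have endp : {ae mu, forall x : R, `|x| <> a /\ `|x| <> e /\ `|x| <> b /\ `|x| <> N * e /\ `|x| <> N * b
    /\ x <> P - a}.
  do 5 (apply: ae_and; first exact: ae_normr_neq).
  exact: ae_neq.
pose s : seq (int * R * R) :=
  [:: (0, a, e); (-1, b, P - a); (0, e, b); (-1, e, b); (K, - a, a); (- K, - a, a)].
have sE (g : int -> R -> R -> C) : \sum_(t <- s) g t.1.1 t.1.2 t.2 =
    g 0 a e + (g (-1) b (P - a) + (g 0 e b + (g (-1) e b + (g K (- a) a + g (- K) (- a) a)))).
  by rewrite !big_cons big_nil addr0.
rewrite (@fold_moments H s m iH); last first.
  apply: (ae_imp2 H0 endp) => x h0 [xa [xe [xb [xNe [xNb _]]]]].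
  rewrite (sE (fun k p q => H x * (\1_`]p, q[ (x - k%:~R * (2 * pi)) : R)%:C)) -hpi.
  have [xB|xB] := pselect (in_band x); last by rewrite h0// !mul0r !addr0.
  rewrite mul0r subr0 mulN1r opprK mulrNz mulNr opprK.
  have add (r t : R) : r%:C + t%:C = (r + t)%:C :> C by rewrite rmorphD.
  by rewrite -!mulrDr !add (band_tiles xB xa xe xb xNe xNb) mulr1.
have := cint_expi_period (- a) m ltr01; rewrite divr1.
under eq_cint do rewrite mulr1.
set J := cint _ _ => EJ; transitivity (c%:C * J); last first.
  by rewrite EJ -rmorphM /=; case: ifP; rewrite ?mulr0.
have mm : measurable_fun setT (fun x : R => m%:~R * x) by exact: mulrl_measurable.
have iE : cintegrable (fun x => expi (m%:~R * x) * (\1_`[- a, - a + 2 * pi] x : R)%:C).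
  under eq_fun do rewrite mulrC.
  by apply: cintegrableM_expi => //; exact: cintegrable_indic_itv.
rewrite /J [in RHS]cint_indic; last exact: measurable_itv.
rewrite -cintZ//; apply: ae_eq_cint; [apply: cintegrable_cmeasurable..|].
- apply: cintegrableM_expi => //; apply: cintegrable_sum => t.
  apply: (cintegrableM_indic (measurable_itv _) (@measurable_id _ _ _)).
  exact: cintegrable_translate.
- exact: cintegrableZ.
(* On the tile []b, P - a[] the equation needed is the one on []- e, - a[], read at [x - P]. *)
have Hs' := ae_affine (- P) ltr01 Hs.
apply: (ae_imp2 (ae_and Hs Hs') endp).
move=> x [hs ht] [xa [xe [xb [_ [_ xPa]]]]].
rewrite (sE (fun k p q => H (x + k%:~R * (2 * pi)) * (\1_`]p, q[ x : R)%:C)) -hpi.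
rewrite mul0r addr0 mulN1r mulrNz mulNr.
rewrite [RHS]mulrA [RHS]mulrAC; congr (_ * _).
have na : x <> a by move=> xE; apply: xa; rewrite xE ger0_norm// ltW.
have nNa : x <> - a by move=> xE; apply: xa; rewrite xE normrN ger0_norm// ltW.
have ne : x <> e by move=> xE; apply: xe; rewrite xE ger0_norm// ltW.
have nb : x <> b by move=> xE; apply: xb; rewrite xE ger0_norm// ltW.
have [l1|l1|/nNa//] := ltgtP x (- a).
  have [-> -> -> -> ->] := tile_out (or_introl l1).
  by rewrite !mulr0 !addr0.
have [l2|l2|/na//] := ltgtP x a.
  have [-> -> -> -> ->] := tile_Naa l1 l2.
  by rewrite !mulr0 !add0r !mulr1; have [_ _ _ h] := hs; rewrite h ?l1.
have [l3|l3|/ne//] := ltgtP x e.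
  have [-> -> -> -> ->] := tile_ae l2 l3.
  by rewrite !mulr0 !addr0 !mulr1; have [h _ _ _] := hs; rewrite h ?l2.
have [l4|l4|/nb//] := ltgtP x b.
  have [-> -> -> -> ->] := tile_eb l3 l4.
  by rewrite !mulr0 !addr0 !add0r !mulr1; have [_ _ h _] := hs; rewrite h ?l3.
have [l5|l5|/xPa//] := ltgtP x (P - a).
  have [-> -> -> -> ->] := tile_bP l4 l5.
  rewrite !mulr0 !addr0 !add0r !mulr1; have [_ + _ _] := ht; rewrite mul1r; apply.
  exact: tile_shift.
have [-> -> -> -> ->] := tile_out (or_intror l5).
by rewrite !mulr0 !addr0.
Qed.

(** * Orthonormality *)

Variable n1 : nat.
Hypothesis NE : N = 2 ^+ n1.

Let N0 : 0 < N. Proof. by rewrite NE exprn_gt0. Qed.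

Let exp2_gt0 d : 0 < (2 : R) ^+ d. Proof. exact: exprn_gt0. Qed.

Let KPN x : N * (x - P) = N * x - K%:~R * P - K%:~R * P.
Proof. by have [_ _ _ _ _ _ _ _ _ _ hNP] := T; rewrite mulrBr hNP; ring. Qed.

(** Together with [KPN], this moves the equation of [fibre_sums] on []- a, a[] to []e, b[], where it
    involves [N * x] and [N * (x - P)]. *)
Let bandN x : (- a < N * x - K%:~R * P < a) = (e < x < b).
Proof.
have [_ _ _ _ _ _ _ hNe hNb _ _] := T.
rewrite ltrBrDr ltrBlDr addrC -hNe (addrC a) -hNb.
by rewrite !(ltr_pM2l N0).
Qed.

Let ae_noends : {ae mu, forall x : R, [/\ `|x| <> a, `|x| <> e, `|x| <> b & `|x| <> N * e]}.
Proof.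
apply: (ae_imp2 (ae_and (ae_normr_neq a) (ae_normr_neq e))
  (ae_and (ae_normr_neq b) (ae_normr_neq (N * e)))).
by move=> x [h1 h2] [h3 h4]; split.
Qed.

(** Each band spans at most one octave, since [b = 2 a] and [a <= e], so a factor [t >= 2] never
    keeps [y] in its band. It leads from the inner to the outer band only for [t] strictly between
    [N / 2] and [2 * N], and never back. *)
Let lag_arith (t y : R) : 0 < a -> b = 2 * a -> a <= e -> 0 <= y -> y <> a -> y <> b ->
  y <> N * e -> 2 <= N -> 2 <= t -> 2 * t <= N \/ 2 * N <= t ->
  a <= y <= b \/ N * e <= y <= N * b -> a <= t * y <= b \/ N * e <= t * y <= N * b -> False.
Proof.
move=> a0 hb ae y0 /eqP ya /eqP yb /eqP ye N2 t2 tN.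
have ty : 2 * y <= t * y by rewrite ler_wpM2r.
have Nb : N * b = 2 * (N * a) by rewrite hb; ring.
have Nae : N * a <= N * e by rewrite ler_pM2l.
have N2e : 2 * e <= N * e by rewrite ler_wpM2r//; lra.
case=> /andP[y1 y2]; case=> /andP[z1 z2].
- have : a < y by rewrite lt_neqAle eq_sym ya.
  by lra.
- case: tN => tN.
  + have : y < b by rewrite lt_neqAle yb.
    rewrite -(ltr_pM2l N0) Nb => h.
    have : 2 * t * y <= N * y by rewrite ler_wpM2r.
    by rewrite -mulrA; lra.
  + have : a < y by rewrite lt_neqAle eq_sym ya.
    rewrite -(ltr_pM2l N0) => h.
    have : 2 * N * y <= t * y by rewrite ler_wpM2r.
    by rewrite -mulrA; lra.
- by lra.
- have : N * e < y by rewrite lt_neqAle eq_sym ye.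
  by lra.
Qed.

Let lag_disjoint t x : [/\ `|x| <> a, `|x| <> e, `|x| <> b & `|x| <> N * e] ->
  2 <= t -> 2 * t <= N \/ 2 * N <= t -> in_band x -> in_band (t * x) -> False.
Proof.
have [hu ha hb he _ _ hN _ _ _ _] := T => -[xa _ xb xe] t2 tN.
rewrite /in_band normrM (@ger0_norm _ t); last by lra.
by apply: lag_arith => //; lra.
Qed.

Let lag_exp d : d.+1 <> n1 -> 2 * 2 ^+ d.+1 <= N \/ 2 * N <= 2 ^+ d.+1.
Proof.
move=> dn; rewrite NE -!exprS; have [h|h] := leqP d.+2 n1; [left|right].
  by rewrite ler_weXn2l// ler1n.
by rewrite ler_weXn2l ?ler1n//; lia.
Qed.

Lemma lag_zero (h : R -> C) d : {ae mu, forall x, ~ in_band x -> h x = 0} -> d.+1 <> n1 ->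
  {ae mu, forall x, h (2 ^+ d.+1 * x) * (h x)^*%C = 0}.
Proof.
move=> h0 dn; have h0' := @ae_affine (2 ^+ d.+1) 0 _ (exp2_gt0 _) h0.
apply: (ae_imp2 (ae_and h0 h0') ae_noends) => x [h1 h2] nx.
have [xB|/h1 ->] := pselect (in_band x); last by rewrite conjc0 mulr0.
have [TB|] := pselect (in_band (2 ^+ d.+1 * x)); last first.
  by rewrite -[X in in_band X]addr0 => /h2; rewrite addr0 => ->; rewrite mul0r.
exfalso; apply: (lag_disjoint nx _ (lag_exp dn) xB TB).
by rewrite exprS ler_peMr// exprn_ege1// ler1n.
Qed.

Definition unitary_fibres (h : R -> C) : Prop :=
  {ae mu, forall x, (a < x < e \/ - e < x < - a -> sqmod (h x) = 1) /\
    (e < x < b -> [/\ sqmod (h x) + sqmod (h (x - P)) = 1,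
       sqmod (h (N * x)) + sqmod (h (N * (x - P))) = 1
       & h (N * x) * (h x)^*%C + h (N * (x - P)) * (h (x - P))^*%C = 0])}.

(** [N * |x|] falls strictly between the bands, as [b = 2 a <= N a]. Thus the product at lag [N]
    vanishes on the one-point fibres. *)
Let band_gap x : a < x < e \/ - e < x < - a -> in_band (N * x) -> False.
Proof.
have [hu ha hb he _ _ hN _ _ _ _] := T.
have h (y : R) : a < y < e -> a <= N * y <= b \/ N * e <= N * y <= N * b -> False.
  move=> /andP[y1 y2]; have := ltr_pM2l N0 a y; have := ltr_pM2l N0 y e.
  rewrite y1 y2 => h1 h2; have : 2 * a <= N * a by rewrite ler_wpM2r//; lra.
  by move=> h3; case=> /andP[]; lra.
rewrite /in_band normrM (ger0_norm (ltW N0)); case=> /andP[x1 x2].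
  by rewrite ger0_norm; [apply: h; rewrite x1|lra].
by rewrite ltr0_norm; [apply: h; apply/andP; split; lra|lra].
Qed.

(** Points of the outer bands exceed [b] in modulus, so [N] carries them beyond [N * b]. *)
Let band_far x : - a < x < a -> in_band (N * (x + K%:~R * P)) \/ in_band (N * (x - K%:~R * P)) -> False.
Proof.
have [hu ha hb he hP _ hN _ hNb hK _] := T => /andP[x1 x2].
have h (y : R) : K%:~R * P - a < y -> a <= N * y <= b \/ N * e <= N * y <= N * b -> False.
  move=> y1; have y2 : b < y by lra.
  have := ltr_pM2l N0 b y; rewrite y2 => h1.
  have h2 : b <= N * b by rewrite ler_peMl//; lra.
  by case=> /andP[]; lra.
rewrite /in_band !normrM (ger0_norm (ltW N0)); case.
  by rewrite ger0_norm; [apply: h; lra|lra].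
by rewrite ltr0_norm; [apply: h; lra|lra].
Qed.

(** The sums of [|h|^2] give the norms of both rows, the second through [bandN]. For the product at
    lag [N] only the fibres over []e, b[] say anything; [band_gap] and [band_far] dispose of the
    others. *)
Lemma unitary_fibresP (h : R -> C) : {ae mu, forall x, ~ in_band x -> h x = 0} ->
  unitary_fibres h <-> fibre_sums (fun x => (sqmod (h x))%:C) 1 /\
    fibre_sums (fun x => h (N * x) * (h x)^*%C) 0.
Proof.
move=> h0.
have h0' := @ae_affine N 0 _ N0 h0; have {}h0' : {ae mu, forall x, ~ in_band (N * x) -> h (N * x) = 0}.
  by apply: (ae_imp h0') => x; rewrite addr0.
have inj (r s : R) : r%:C = s%:C :> C -> r = s by move=> /(congr1 (@complex.Re _)).
have addC (r s : R) : r%:C + s%:C = (r + s)%:C :> C by rewrite rmorphD.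
split=> [U|[H0 H1]].
  split.
    (* The inverse of [x |-> N x - K P], because [N * P = 2 * (K * P)]. *)
    apply: (ae_imp2 U (@ae_affine N^-1 (P / 2) _ _ U)); first by rewrite invr_gt0.
    move=> x [u1 u2] [_ u3]; split.
    - by move=> xa; rewrite u1//; left.
    - by move=> xa; rewrite u1//; right.
    - by move=> /u2[+ _ _]; rewrite addC => ->.
    - have [_ _ _ _ _ _ _ _ _ _ hNP] := T.
      have e1 : N * (N^-1 * x + P / 2) = x + K%:~R * P.
        by rewrite mulrDr mulVKf ?gt_eqF// mulrA hNP; field.
      have e2 : N * (N^-1 * x + P / 2 - P) = x - K%:~R * P by rewrite KPN e1; ring.
      move: u3; rewrite -bandN e1 e2 addrK => u3 /u3[_ + _].
      by rewrite addC => ->.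
  have s1 := ae_affine (K%:~R * P) ltr01 h0'.
  have s2 := ae_affine (- (K%:~R * P)) ltr01 h0'.
  apply: (ae_imp2 (ae_and U h0') (ae_and s1 s2)).
  move=> x [[_ ux] hx] [k1 k2]; split.
  - by move=> xa; rewrite hx ?mul0r//; apply: band_gap; left.
  - by move=> xa; rewrite hx ?mul0r//; apply: band_gap; right.
  - by move=> /ux[].
  - move=> xa; rewrite mul1r in k1 k2; rewrite k1 ?k2 ?mul0r ?addr0//.
      by move=> xB; apply: (band_far xa); right.
    by move=> xB; apply: (band_far xa); left.
have s := @ae_affine N (- (K%:~R * P)) _ N0 H0.
apply: (ae_imp2 (ae_and H0 H1) s).
move=> x [[p1 p2 p3 _] [_ _ q3 _]] [_ _ _]; rewrite bandN => p4; split.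
  by case=> [/p1|/p2] /inj.
move=> xe; split; last by exact: q3.
  by have := p3 xe; rewrite addC => /inj.
by have := p4 xe; rewrite KPN subrK addC => /inj.
Qed.

(** Lag 0 yields the norms and lag [n1] the orthogonality of the rows; at every other positive lag
    the integrand is zero by [lag_zero]. *)
Lemma orthonormal_unitary_fibres (psi psih : R -> C) : L2 psi -> fourier_L2 psi psih ->
  {ae mu, forall x, ~ in_band x -> psih x = 0} ->
  Defs.orthonormal (fun jk : int * int => psi_jk psi jk.1 jk.2) <-> unitary_fibres psih.
Proof.
move=> Lpsi Fpsi h0; have Lh : L2 psih by have [] := Fpsi.
rewrite (orthonormal_corr Lpsi Fpsi) (unitary_fibresP h0).
have E0 m : corr psih 0 m = cint setT (fun y => (sqmod (psih y))%:C * expi (m%:~R * y)).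
  by rewrite /corr; apply: eq_cint => y _; rewrite expr0 mul1r mulcJ.
have i0 : cintegrable (fun y => (sqmod (psih y))%:C).
  by have := L2_mul_cintegrable Lh Lh; under eq_fun do rewrite mulcJ.
have id d : cintegrable (fun y => psih (2 ^+ d * y) * (psih y)^*%C).
  have := @L2_affine (2 ^+ d) 0 _ (exp2_gt0 _) Lh => L'.
  by have := L2_mul_cintegrable L' Lh; under eq_fun do rewrite addr0.
have z0 : {ae mu, forall x, ~ in_band x -> (sqmod (psih x))%:C = 0}.
  by apply: (ae_imp h0) => x + nx => /(_ nx) ->; rewrite sqmod0.
have zd t : {ae mu, forall x, ~ in_band x -> psih (t * x) * (psih x)^*%C = 0}.
  by apply: (ae_imp h0) => x + nx => /(_ nx) ->; rewrite conjc0 mulr0.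
(* [N >= 2] makes [n1] positive, so the lag [n1] has the form [d.+1]. *)
have n1E : n1.-1.+1 = n1.
  by case: n1 NE => // N1; have [_ _ _ _ _ _ + _ _ _ _] := T; rewrite N1 expr0 (ler_nat _ 2 1).
split=> [[c0 cd]|[F0 F1]].
  split; apply: fibre_sums_of_flat_moments => //.
  - by move=> m; rewrite -E0 c0 mul1r.
  - by have := id n1; rewrite -NE.
  - move=> m; have := cd n1.-1 m; rewrite n1E /corr -NE => ->.
    by rewrite mul0r; case: ifP.
split=> [m|d m].
  by rewrite E0 (flat_moments_of_fibre_sums i0 z0 F0) mul1r.
have [dn|dn] := pselect (d.+1 = n1).
  rewrite /corr dn -NE (flat_moments_of_fibre_sums _ (zd N) F1) ?mul0r; first by case: ifP.
  by have := id n1; rewrite -NE.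
rewrite /corr -cint0; apply: ae_eq_cint.
- apply: cmeasurableM; first exact: cintegrable_cmeasurable (id _).
  by apply: cmeasurable_expi; exact: mulrl_measurable.
- exact: cmeasurable_cst.
- by apply: (ae_imp (lag_zero h0 dn)) => x ->; rewrite mul0r.
Qed.

(** * Completeness *)

(** Lagrange's identity [D1] shows that the determinant [D] has modulus 1; Cramer's rule does the
    rest. *)
Let unitary_kernel (p q r s v w : C) : sqmod p + sqmod q = 1 -> sqmod r + sqmod s = 1 ->
  r * p^*%C + s * q^*%C = 0 -> v * p^*%C + w * q^*%C = 0 -> v * r^*%C + w * s^*%C = 0 ->
  v = 0 /\ w = 0.
Proof.
move=> pq rs o e1 e2; pose D := p^*%C * s^*%C - q^*%C * r^*%C.
have D1 : sqmod D + sqmod (r * p^*%C + s * q^*%C) = (sqmod p + sqmod q) * (sqmod r + sqmod s).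
  rewrite /D /sqmod !ReIm; ring.
have D0 : D != 0.
  apply/eqP => D0; move: D1; rewrite D0 o pq rs sqmod0 addr0 mulr1 => /eqP.
  by rewrite eq_sym oner_eq0.
have vD : v * D = 0.
  transitivity ((v * p^*%C + w * q^*%C) * s^*%C - (v * r^*%C + w * s^*%C) * q^*%C).
    by rewrite /D; ring.
  by rewrite e1 e2 !mul0r subrr.
have wD : w * D = 0.
  transitivity ((v * r^*%C + w * s^*%C) * p^*%C - (v * p^*%C + w * q^*%C) * r^*%C).
    by rewrite /D; ring.
  by rewrite e1 e2 !mul0r subrr.
move/eqP: vD; rewrite mulf_eq0 (negPf D0) orbF => /eqP ->.
by move/eqP: wD; rewrite mulf_eq0 (negPf D0) orbF => /eqP ->.
Qed.

(** The first row is tested by [G] at [x] and [x - P]; the second by [G'] at [N x] and [N (x - P)],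
    where it takes the same two values of [G]. *)
Lemma fibre_kernel (h G G' : R -> C) : unitary_fibres h ->
  fibre_sums (fun x => G x * (h x)^*%C) 0 -> fibre_sums (fun x => G' x * (h x)^*%C) 0 ->
  (forall x, G' (N * x) = G x) ->
  {ae mu, forall x, a < `|x| < b -> `|x| <> e -> G x = 0}.
Proof.
move=> U S S' GG.
have [hu ha hb he hP _ _ _ _ _ _] := T.
have A : {ae mu, forall x, (a < x < e \/ - e < x < - a -> G x = 0) /\
    (e < x < b -> G x = 0 /\ G (x - P) = 0)}.
  have S2 := @ae_affine N (- (K%:~R * P)) _ N0 S'.
  apply: (ae_imp2 U (ae_and S S2)).
  move=> x [u1 u2] [[p1 p2 p3 _] [_ _ _]]; rewrite bandN => p4; split.
    move=> xa; have hx : h x != 0.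
      by apply/eqP => hx; have := u1 xa; rewrite hx sqmod0 => /eqP; rewrite eq_sym oner_eq0.
    have : G x * (h x)^*%C = 0 by case: xa; [exact: p1|exact: p2].
    by move/eqP; rewrite mulf_eq0 conjc_eq0 (negPf hx) orbF => /eqP.
  move=> xe; have [v1 v2 v3] := u2 xe.
  apply: (unitary_kernel v1 v2 v3 (p3 xe)).
  by have := p4 xe; rewrite subrK -KPN !GG.
apply: (ae_imp2 A (ae_affine P ltr01 A)) => x [a1 a2] [_]; rewrite mul1r => a3 xab xe.
have [x0|x0] := leP 0 x.
  rewrite ger0_norm// in xab xe; have [x1 x2] := andP xab.
  have [l|l|//] := ltgtP x e; first by apply: a1; left; rewrite x1.
  by have [] := a2 _; rewrite ?l.
rewrite ltr0_norm// in xab xe; have [x1 x2] := andP xab.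
have [l|l|//] := ltgtP (- x) e; first by apply: a1; right; apply/andP; split; lra.
by have [] := a3 _; rewrite ?addrK//; apply/andP; split; lra.
Qed.

Lemma dyadic_scale (r x : R) : 0 < r -> x != 0 -> exists j : int, r <= `|x / 2 ^ j| < 2 * r.
Proof.
move=> r0 x0; pose y := `|x| / r.
have y0 : 0 < y by rewrite divr_gt0 ?normr_gt0.
pose n := Num.bound y^-1.
(* This makes the least exponent [m] with [2^n * y < 2^m] positive, so that its predecessor can
   serve. *)
have yn : 1 < 2 ^+ n * y.
  by rewrite -ltr_pdivrMr// mul1r upper_nthrootP.
have ex : exists m, 2 ^+ n * y < 2 ^+ m.
  by exists (Num.bound (2 ^+ n * y)); rewrite upper_nthrootP.
case: (ex_minnP ex) => -[|m]; first by rewrite expr0 => /lt_trans /(_ yn); rewrite ltxx.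
move=> mlt mmin; exists (m%:Z - n%:Z).
have jE : (2 : R) ^ (m%:Z - n%:Z) = 2 ^+ m / 2 ^+ n by rewrite expfzDr// exprnN.
have m0 : 0 < (2 : R) ^+ m by rewrite exprn_gt0.
have n0 : 0 < (2 : R) ^+ n by rewrite exprn_gt0.
rewrite normrM normfV (ger0_norm (ltW (expr2z_gt0 _))) jE.
have -> : `|x| / (2 ^+ m / 2 ^+ n) = 2 ^+ n * y / 2 ^+ m * r.
  by rewrite /y; field; rewrite !gt_eqF.
rewrite ler_peMl ?(ltW r0)//=; last first.
  rewrite ler_pdivlMr// mul1r leNgt; apply/negP => h.
  by have := mmin _ h; rewrite ltnn.
by rewrite ltr_pM2r// ltr_pdivrMr// -exprS.
Qed.

Lemma complete_unitary_fibres (psi psih : R -> C) : L2 psi -> fourier_L2 psi psih ->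
  {ae mu, forall x, ~ in_band x -> psih x = 0} -> unitary_fibres psih ->
  complete_in L2 (fun jk : int * int => psi_jk psi jk.1 jk.2).
Proof.
move=> Lpsi Fpsi h0 U f Lf f0; have [F FF] := fourier_L2_exists Lf.
have [LF _] := FF; have Lh : L2 psih by have [] := Fpsi.
have [hu ha hb he hP _ _ _ _ _ _] := T.
have S j : fibre_sums (fun y => F (2 ^ j * y) * (psih y)^*%C) 0.
  have iH : cintegrable (fun y => F (2 ^ j * y) * (psih y)^*%C).
    have L' := @L2_affine (2 ^ j) 0 _ (expr2z_gt0 j) LF.
    by have := L2_mul_cintegrable L' Lh; under eq_fun do rewrite addr0.
  apply: fibre_sums_of_flat_moments iH _ _.
    by apply: (ae_imp h0) => x + nx => /(_ nx) ->; rewrite conjc0 mulr0.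
  move=> k; have /eqP := f0 (j, k); rewrite (cinner_psi_jk _ _ Lf Lpsi FF Fpsi)/=.
  rewrite mulf_eq0 => /orP[/eqP/(congr1 (@complex.Re _))/eqP/=|/eqP ->]; last first.
    by rewrite mul0r; case: ifP.
  rewrite mulf_eq0 invr_eq0 gt_eqF ?sqrtr_gt0 ?expr2z_gt0//=.
  by rewrite gt_eqF// mulr_gt0// pi_gt0.
have Fj j : {ae mu, forall x, a < `|x| < b -> `|x| <> e -> F (2 ^ j * x) = 0}.
  (* Going down [n1] scales cancels the factor [N]. *)
  apply: (fibre_kernel U (S j) (S (j - n1%:Z))) => x.
  by rewrite mulrA NE -[2 ^+ n1]/(2 ^ n1%:Z) -expfzDr// subrK.
have F0 : {ae mu, forall x, F x = 0}.
  have A1 : {ae mu, forall x, forall j : int, a < `|x / 2 ^ j| < b -> `|x / 2 ^ j| <> e -> F x = 0}.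
    apply: ae_forall_int => j; have j0 := expr2z_gt0 j.
    have := @ae_affine (2 ^ j)^-1 0 _ _ (Fj j); rewrite invr_gt0 => /(_ j0).
    move=> h; apply: (ae_imp h) => x.
    by rewrite addr0 mulrA divff ?mul1r ?(mulrC _ x)// gt_eqF.
  have A2 : {ae mu, forall x, forall j : int, `|x / 2 ^ j| <> a /\ `|x / 2 ^ j| <> e}.
    apply: ae_forall_int => j; have j0 := expr2z_gt0 j.
    have := @ae_affine (2 ^ j)^-1 0 _ _ ae_noends; rewrite invr_gt0 => /(_ j0).
    by move=> h; apply: (ae_imp h) => x; rewrite addr0 (mulrC _ x) => -[].
  apply: (ae_imp2 (ae_and A1 A2) (ae_neq 0)) => x [h1 h2] /eqP x0.
  have a0 : 0 < a by lra.
  have [j /andP[j1 j2]] := dyadic_scale a0 x0; have [na ne] := h2 j.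
  apply: (h1 j) => //; rewrite hb j2 andbT lt_neqAle j1 andbT eq_sym.
  exact/eqP.
apply: nrm2_eq0 => //.
have := fourier_L2_nrm2 Lf FF.
have -> : nrm2 F = 0.
  rewrite (@ae_eq_nrm2 F (fun=> 0)) //; last exact: L2_cmeasurable.
  by rewrite /nrm2; under eq_Rintegral do rewrite sqmod0; rewrite Rintegral_cst// mul0r.
move/esym/eqP; rewrite mulf_eq0 => /orP[|/eqP//].
by rewrite gt_eqF// mulr_gt0// pi_gt0.
Qed.

End Tiling.

(** * Moduli and phases *)

Lemma cabs_sqr z : cabs z ^+ 2 = sqmod z.
Proof. by rewrite sqr_sqrtr// sqmod_ge0. Qed.

Lemma cabs_ge0 z : 0 <= cabs z. Proof. exact: sqrtr_ge0. Qed.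

Lemma cabs_eq z1 z2 : (cabs z1 = cabs z2) <-> (sqmod z1 = sqmod z2).
Proof.
rewrite -!cabs_sqr; split=> [->//|/eqP].
by rewrite eqrXn2 ?cabs_ge0// => /eqP.
Qed.

Lemma expi_eqN1 (t : R) : expi t = - 1 <-> exists m : int, t = (2 * m%:~R + 1) * pi.
Proof.
have expi_pi : expi (pi : R) = -1.
  by apply: complex_ext; rewrite !ReIm ?cospi// sinpi oppr0.
split=> [t1|[m ->]]; last first.
  rewrite (_ : _ * pi = pi + m%:~R * (pi *+ 2)) ?expi_period//.
  by rewrite mulr2n; ring.
have pi0 : 0 < pi :> R := pi_gt0 R.
have c1 : cos (t - pi) = 1.
  rewrite -(Re_expi (t - pi)) expiD t1 expiN expi_pi.
  by rewrite !ReIm; ring.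
have hpi : 0 < (pi : R) / 2 < pi by apply/andP; split; lra.
have [+ _] := cos_gt_arc (t - pi) hpi.
rewrite cos_pihalf c1 => /(_ ltr01) [k hk].
have : `|t - pi - k%:~R * (pi *+ 2)| = 0.
  apply: cos_inj; rewrite ?in_itv/= ?normr_ge0/= ?lexx ?pi_ge0//; first by lra.
  by rewrite cos_norm cos0 -mulNr -mulrNz cos_period.
move/eqP; rewrite normr_eq0 subr_eq0 subr_eq => /eqP ->.
by exists k; rewrite mulr2n; ring.
Qed.

(** Half-angle formula: [tan (theta / 2) = Im h / (|h| + Re h)]. The denominator vanishes only where
    [h] is real and nonpositive; there the quotient is 0 by the convention for [0^-1], and the
    indicator adds the angle [pi]. *)
Lemma polar_measurable (h : R -> C) : cmeasurable h ->
  exists2 theta : R -> R, measurable_fun setT theta &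
    forall x, h x = expi (theta x) * (cabs (h x))%:C.
Proof.
move=> mh; pose w x := cabs (h x) + Re (h x).
have mw : measurable_fun setT w.
  apply: measurable_funD; last by case: mh.
  apply: measurableT_comp; last exact: measurable_sqmod.
  by apply: continuous_measurable_fun; exact: sqrt_continuous.
exists (fun x => 2 * atan (Im (h x) * powR (w x) (-1)) + pi * \1_[set 0] (w x)).
  apply: measurable_funD; apply: measurable_funM => //.
    apply: measurableT_comp; last first.
      apply: measurable_funM; first by case: mh.
      by apply: (measurableT_comp (measurable_powR _)).
    by apply: continuous_measurable_fun; exact: continuous_atan.
  by apply: measurableT_comp => //; exact: measurable_indic.
move=> x; have := cabs_sqr (h x); have := cabs_ge0 (h x).
rewrite /w; set r := cabs (h x); rewrite /sqmod; set X := Re (h x); set Y := Im (h x) => r0 rE.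
have w0 : 0 <= r + X.
  have : `|X| <= r.
    by rewrite -(@ler_pXn2r _ 2)// ?nnegrE// real_normK ?num_real// rE lerDl sqr_ge0.
  by rewrite ler_norml => /andP[]; lra.
rewrite powR_inv1//; have [wz|wn] := eqVneq (r + X) 0.
  rewrite wz invr0 mulr0 atan0 mulr0 add0r indicE mem_set//= mulr1.
  have XE : X = - r by lra.
  have Y0 : Y = 0 by apply/eqP; rewrite -sqrf_eq0; apply/eqP; move: rE; rewrite XE sqrrN; lra.
  by apply: complex_ext; rewrite !ReIm cospi sinpi -/X -/Y ?XE ?Y0; ring.
rewrite indicE memNset ?mulr0 ?addr0; last exact/eqP.
have wp : 0 < r + X by rewrite lt_neqAle eq_sym wn.
set t := Y / (r + X); have t1 : 1 + t ^+ 2 != 0 by rewrite gt_eqF// ltr_pwDl// sqr_ge0.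
have c2 : cos (atan t) ^+ 2 = (1 + t ^+ 2)^-1.
  by rewrite cos_atan exprVn sqr_sqrtr// addr_ge0// sqr_ge0.
have s1 : sin (atan t) = t * cos (atan t).
  rewrite -[X in _ = X * _](@atanK _ t) /tan mulfVK// cos_atan invr_eq0 sqrtr_eq0 -ltNge.
  by rewrite ltr_pwDl// sqr_ge0.
have rn : r != 0.
  apply/eqP => rz; move: wp rE; rewrite rz add0r expr0n/= => X0 /eqP.
  rewrite eq_sym paddr_eq0 ?sqr_ge0// !sqrf_eq0 => /andP[/eqP Xz _].
  by rewrite Xz ltxx in X0.
have Y2 : Y ^+ 2 = r ^+ 2 - X ^+ 2 by rewrite rE; ring.
have tE : 1 + t ^+ 2 = 2 * r / (r + X).
  rewrite /t expr_div_n Y2; field; exact: wn.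
have t1V : (1 + t ^+ 2)^-1 = (r + X) / (2 * r) by rewrite tE invf_div.
apply: complex_ext; rewrite !ReIm -/X -/Y mulr0 ?add0r ?subr0 mulr_natl.
  by rewrite cos_mulr2n c2 t1V; field.
rewrite sin_mulr2n s1 mulrCA -expr2 c2 t1V /t; field.
by rewrite rn wn.
Qed.

(** Unit rows that are orthogonal have [|p| = |s|] and [|q| = |r|]. By [key], orthogonality then
    says that [1 + e^{i(tp + ts - tq - tr)}] vanishes unless [|p| |r| = 0]. *)
Lemma unitary_polar (p q r s : C) (tp tq tr ts : R) :
  p = expi tp * (cabs p)%:C -> q = expi tq * (cabs q)%:C ->
  r = expi tr * (cabs r)%:C -> s = expi ts * (cabs s)%:C ->
  [/\ sqmod p + sqmod q = 1, sqmod r + sqmod s = 1 & r * p^*%C + s * q^*%C = 0] <->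
  [/\ cabs p ^+ 2 + cabs r ^+ 2 = 1, cabs p ^+ 2 + cabs q ^+ 2 = 1, cabs p = cabs s &
      (cabs p <> 0 -> cabs r <> 0 ->
       exists m : int, tp + ts - tq - tr = (2 * m%:~R + 1) * pi)].
Proof.
move=> pE qE rE sE; rewrite !cabs_sqr.
have key : sqmod p = sqmod s -> sqmod q = sqmod r -> r * p^*%C + s * q^*%C =
    (cabs p * cabs r)%:C * (expi (tr - tp) * (1 + expi (tp + ts - tq - tr))).
  move=> /cabs_eq ps /cabs_eq qr.
  have mul (x y : C) (tx ty : R) : x = expi tx * (cabs x)%:C -> y = expi ty * (cabs y)%:C ->
      x * y^*%C = (cabs x * cabs y)%:C * expi (tx - ty).
    move=> xE yE; rewrite [in LHS]xE [in LHS]yE conjcM expiJ expiD rmorphM.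
    rewrite (_ : ((cabs y)%:C)^*%C = (cabs y)%:C); last by apply: complex_ext; rewrite !ReIm// oppr0.
    by rewrite /=; ring.
  rewrite (mul _ _ _ _ rE pE) (mul _ _ _ _ sE qE) -ps qr mulrDr mulr1 -expiD mulrDr.
  by rewrite (mulrC (cabs r)) (_ : tr - tp + _ = ts - tq)//; ring.
split=> [[h1 h2 h3]|[h1 h2 /cabs_eq h3 h4]].
  have : sqmod (r * p^*%C) = sqmod (s * q^*%C).
    move/eqP: h3; rewrite addr_eq0 => /eqP ->.
    by rewrite /sqmod !ReIm; ring.
  rewrite !sqmodM !sqmodJ => h4.
  (* From [|r|^2 |p|^2 = |s|^2 |q|^2], eliminating [q] and [r] by the norms of the rows. *)
  have ps : sqmod p = sqmod s.
    have qE' : sqmod q = 1 - sqmod p by rewrite -h1; ring.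
    have rE' : sqmod r = 1 - sqmod s by rewrite -h2; ring.
    move: h4; rewrite qE' rE' => h4.
    transitivity ((1 - sqmod s) * sqmod p + sqmod s * sqmod p); first by ring.
    by rewrite h4; ring.
  have qr : sqmod q = sqmod r by rewrite ps -h2 addrC in h1; exact: addIr h1.
  split=> //; [by rewrite -qr|exact/cabs_eq|].
  move=> /eqP p0 /eqP r0; apply/expi_eqN1.
  move: h3; rewrite (key ps qr) => /eqP; rewrite mulf_eq0 => /orP[|].
    move=> /eqP/(congr1 (@complex.Re _))/= /eqP.
    by rewrite mulf_eq0 (negPf p0) (negPf r0).
  rewrite mulf_eq0 => /orP[/eqP h|]; last by rewrite addrC addr_eq0 => /eqP.
  have := sqmod_expi (tr - tp); rewrite h sqmod0 => /eqP.
  by rewrite eq_sym oner_eq0.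
have qr : sqmod q = sqmod r by move: h1; rewrite -h2 => /addrI.
split=> //; first by rewrite -h3 addrC.
rewrite (key h3 qr); have [->|/eqP p0] := eqVneq (cabs p) 0; first by rewrite mul0r mul0r.
have [->|/eqP r0] := eqVneq (cabs r) 0; first by rewrite mulr0 mul0r.
by have /expi_eqN1 -> := h4 p0 r0; rewrite subrr !mulr0.
Qed.

Lemma fsupp_scale (r : R) (g : R -> R) x : 0 < r -> scale_set (1 / r) (fsupp g) x <-> g (r * x) <> 0.
Proof.
move=> r0; rewrite /scale_set /fsupp; split=> [[y/= gy <-]|gx].
  by rewrite div1r mulVKf// gt_eqF.
by exists (r * x) => //; rewrite mulrA div1r mulVf ?mul1r// gt_eqF.
Qed.

Lemma unitary_fibres_moduli (N u a b e P : R) (K : int) (h : R -> C) :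
  tiling N u a b e P K -> cmeasurable h ->
  let B := fun x => cabs (h x) in
  unitary_fibres N a b e P h <->
  [/\ {ae mu, forall x, (x \in `[a, e] \/ x \in `[- e, - a]) -> B x = 1},
      {ae mu, forall x, x \in `[e, b] -> B x ^+ 2 + B (N * x) ^+ 2 = 1},
      {ae mu, forall x, x \in `[e, b] -> B x ^+ 2 + B (x - 2 * pi) ^+ 2 = 1},
      {ae mu, forall x, x \in `[e, b] -> B x = B (N * (x - 2 * pi))}
    & exists theta : R -> R,
       [/\ measurable_fun setT theta,
           {ae mu, forall x, h x = expi (theta x) * (B x)%:C}
         & {ae mu, forall x, x \in `[e, b] -> fsupp B x -> scale_set (1 / N) (fsupp B) x ->
             exists m : int, theta x + theta (N * (x - 2 * pi)) - theta (x - 2 * pi)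
               - theta (N * x) = (2 * m%:~R + 1) * pi}]].
Proof.
move=> T mh B; have [_ _ _ _ _ hpi N2 _ _ _ _] := T; rewrite -hpi.
have N0 : 0 < N by apply: lt_le_trans N2; rewrite ltr0n.
have B1 x : (B x = 1) <-> (sqmod (h x) = 1).
  rewrite -cabs_sqr -/(B x); split=> [->|/eqP]; first by rewrite expr1n.
  by rewrite sqrp_eq1 ?cabs_ge0// => /eqP.
(* The conditions on moduli and phases use closed intervals, [unitary_fibres] open ones. *)
have ends : {ae mu, forall x : R, [/\ x <> a, x <> e, x <> b & x <> - a /\ x <> - e]}.
  apply: (ae_imp2 (ae_and (ae_neq a) (ae_neq e))
    (ae_and (ae_neq b) (ae_and (ae_neq (- a)) (ae_neq (- e))))).
  by move=> x [? ?] [? ?]; split.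
have sq (p q x : R) : x <> p -> x <> q -> (x \in `[p, q]) = (p < x < q).
  by move=> /eqP xp /eqP xq; rewrite in_itv/= !lt_neqAle xq eq_sym xp.
split=> [U|[c1 c2 c3 c4 [th [_ hth c5]]]].
  have [th mth hth] := polar_measurable mh.
  have A : {ae mu, forall x, x \in `[e, b] -> [/\ B x ^+ 2 + B (N * x) ^+ 2 = 1,
      B x ^+ 2 + B (x - P) ^+ 2 = 1, B x = B (N * (x - P)) &
      (B x <> 0 -> B (N * x) <> 0 -> exists m : int,
        th x + th (N * (x - P)) - th (x - P) - th (N * x) = (2 * m%:~R + 1) * pi)]}.
    apply: (ae_imp2 U ends) => x [_ u2] [_ xe xb _]; rewrite sq// => /u2.
    by rewrite (unitary_polar (hth _) (hth _) (hth _) (hth _)).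
  split.
  - apply: (ae_imp2 U ends) => x [u1 _] [xa xe _ [xna xne]] h1; apply/B1; apply: u1.
    by case: h1; rewrite sq//; [left|right].
  - by apply: (ae_imp A) => x + xe => /(_ xe) [].
  - by apply: (ae_imp A) => x + xe => /(_ xe) [].
  - by apply: (ae_imp A) => x + xe => /(_ xe) [].
  exists th; split=> //; first by apply: aeT => x; exact: hth.
  by apply: (ae_imp A) => x + xe Bx /(fsupp_scale _ _ N0) BN => /(_ xe) [_ _ _]; apply.
have hN : {ae mu, forall x, h (N * x) = expi (th (N * x)) * (B (N * x))%:C}.
  by have := @ae_affine N 0 _ N0 hth; move/ae_imp; apply => x; rewrite addr0.
have hP : {ae mu, forall x, h (x - P) = expi (th (x - P)) * (B (x - P))%:C}.
  by have := ae_affine (- P) ltr01 hth; move/ae_imp; apply => x; rewrite mul1r.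
have hNP : {ae mu, forall x, h (N * (x - P)) = expi (th (N * (x - P))) * (B (N * (x - P)))%:C}.
  by have := ae_affine (- (N * P)) N0 hth; move/ae_imp; apply => x; rewrite -mulrBr.
have H := ae_and (ae_and hth hN) (ae_and hP hNP).
have c := ae_and (ae_and c2 c3) (ae_and c4 c5).
apply: (ae_imp2 c1 (ae_and H c)).
move=> x d1 [[[k1 k2] [k3 k4]] [[d2 d3] [d4 d5]]]; split=> [xa|xe].
  apply/B1; apply: d1; rewrite !in_itv/=.
  by case: xa => /andP[x1 x2]; [left|right]; rewrite !ltW.
have xI : x \in `[e, b] by rewrite in_itv/=; case/andP: xe => x1 x2; rewrite !ltW.
apply/(unitary_polar k1 k3 k2 k4); split; [exact: d2|exact: d3|exact: d4|].
by move=> p0 r0; apply: d5 => //; exact/fsupp_scale.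
Qed.

(** * The constants of the theorem *)

(** The last identity separates the cases: []a_n, e_n[] is empty for [n = 2] and nonempty from
    [n = 3] on. *)
Lemma tiling_constants n : (2 <= n)%N ->
  let N : R := 2 ^+ n.-1 in let u := pi / (2 ^+ n - 1) in
  [/\ tiling N u (a_n n) (b_n n) (e_n n) (2 * pi) (2 ^ (n - 2))%N, c_n n = N * e_n n,
      d_n n = N * b_n n & e_n n - a_n n = (N - 2) * u].
Proof.
case: n => [|[|m]]// _ /=; rewrite subn2/= /a_n /b_n /e_n /c_n /d_n.
have -> : (2 * m.+2).-1 = (m.+1 + m.+2)%N by lia.
rewrite -[m.+2.-1]/m.+1 exprD !exprS.
have : ((2 ^ m)%N : int)%:~R = (2 : R) ^+ m by rewrite -natrX.
have : 1 <= (2 : R) ^+ m by rewrite exprn_ege1// ler1n.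
have p0 := pi_gt0 R.
move: ((2 ^ m)%N : int) (2 ^+ m) => K k k1 KE.
have k4 : 2 * (2 * k) - 1 != 0 by rewrite gt_eqF//; lra.
split; [|by field|by field|by field].
have u0 : 0 < pi / (2 * (2 * k) - 1) by rewrite divr_gt0//; lra.
split; rewrite ?KE; [by []| |by field|by field|by field|by []|by lra|by field|by field| |by ring].
  rewrite (_ : _ * pi = 2 * k * (pi / (2 * (2 * k) - 1))); last by field.
  by rewrite ler_pM2r//; lra.
by rewrite ler_peMl//; lra.
Qed.

Lemma in_band_S_n n x : (2 <= n)%N ->
  S_n n x <-> in_band (2 ^+ n.-1) (a_n n) (b_n n) (e_n n) x.
Proof.
move=> n2; have [_ ceq deq _] := tiling_constants n2; rewrite /in_band -ceq -deq.
have [a0 c0] : 0 <= a_n n :> R /\ 0 <= c_n n :> R.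
  have [[hu ha hb he hP hpi hN hNe hNb hK hNP] _ _ _] := tiling_constants n2.
  by rewrite ceq; split; [|rewrite mulr_ge0//]; lra.
rewrite /S_n /setU /= !in_itv/= {ceq deq}.
move: (a_n n) (b_n n) (c_n n) (d_n n) a0 c0 => A B A' B' a0 c0; split.
  case=> [[[|]|]|] /andP[h1 h2].
  - by right; rewrite ler0_norm; [apply/andP; split|]; lra.
  - by left; rewrite ler0_norm; [apply/andP; split|]; lra.
  - by left; rewrite ger0_norm; [apply/andP; split|]; lra.
  - by right; rewrite ger0_norm; [apply/andP; split|]; lra.
have [x0|x0] := leP 0 x.
  by rewrite ger0_norm//; case=> h; [left; right|right].
rewrite ltr0_norm//.
by case=> /andP[h1 h2]; [left; left; right|left; left; left]; apply/andP; split; lra.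
Qed.

(** * Scaling functions *)

(** Such an [x] is farther than [a] from every multiple of [P] ([far]), and [|x|] is not in [[e, b]]
    ([out]). With [t = 2^(d+1)], [t * |x| > 2 * a = b] excludes the inner band. The outer band is
    excluded by [out] if [t = N], by size if [t >= 2 * N], and otherwise by [far], since [K P / t]
    is still a multiple of [P] and dividing by [t] shrinks the radius [a]. *)
Lemma band_avoids_dilates (N u a b e P : R) (K : int) n1 d (k : int) (x : R) :
  tiling N u a b e P K -> N = 2 ^+ n1 ->
  a < x - k%:~R * P < e -> ~ in_band N a b e (2 ^+ d.+1 * x).
Proof.
move=> T NE xk; have [hu ha hb he hP _ hN hNe hNb _ hNP] := T.
have P0 : 0 < P by lra.
have far (m : int) : a < `|x - m%:~R * P|.
  have -> : x - m%:~R * P = (x - k%:~R * P) + (k - m)%:~R * P by rewrite intrB; ring.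
  have [km|km] := leP 0 (k - m).
    have : 0 <= (k - m)%:~R * P by rewrite mulr_ge0 ?ler0z// ltW.
    by move=> h; rewrite ger0_norm; case/andP: xk => ? ?; lra.
  have : (k - m)%:~R * P <= - P.
    have -> : - P = (-1)%:~R * P by rewrite mulrN1z mulN1r.
    by rewrite ler_pM2r// ler_int; clear -km; lia.
  by move=> h; rewrite ltr0_norm; case/andP: xk => ? ?; lra.
have out : ~ (e <= `|x| <= b).
  have Np : (k + 1)%:~R * P = k%:~R * P + P by rewrite intrD mulrDl mul1r.
  have [k0|k0|k0] := ltgtP k 0; last first.
  - move: xk; rewrite k0 mul0r subr0 => /andP[x1 x2].
    by rewrite ger0_norm => [/andP[]|]; lra.
  - have : P <= k%:~R * P.
      by rewrite ler_peMl ?(ltW P0)// (ler_int _ 1); clear -k0; lia.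
    move=> h; case/andP: xk => x1 x2.
    by rewrite ger0_norm => [/andP[]|]; lra.
  - have : (k + 1)%:~R * P <= 0.
      by rewrite pmulr_lle0// lerz0; clear -k0; lia.
    rewrite Np => h; case/andP: xk => x1 x2.
    by rewrite ltr0_norm => [/andP[]|]; lra.
have t0 : 0 < (2 : R) ^+ d.+1 by rewrite exprn_gt0.
have t2 : 2 <= (2 : R) ^+ d.+1 by rewrite exprS ler_peMr// exprn_ege1// ler1n.
have x_ge0 := normr_ge0 x.
have tx : 2 * `|x| <= 2 ^+ d.+1 * `|x| by rewrite ler_wpM2r.
rewrite /in_band normrM (ger0_norm (ltW t0)) => -[/andP[_ h]|].
  by have := far 0; rewrite mul0r subr0; lra.
have far0 : a < `|x| by have := far 0; rewrite mul0r subr0.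
have [dn|dn] := leqP n1 d.+1.
  move=> /andP[h1 h2].
  have [c|c] := eqVneq d.+1 n1.
    move: h1 h2; rewrite c -NE !ler_pM2l -?NE ?(lt_le_trans _ hN)// => h1 h2.
    by apply: out; rewrite h1 h2.
  have : 2 * N <= 2 ^+ d.+1 by rewrite NE -exprS ler_weXn2l ?ler1n//; clear -dn c; lia.
  move=> tN; have : 2 * N * `|x| <= 2 ^+ d.+1 * `|x| by rewrite ler_wpM2r.
  have : N * a < N * `|x| by rewrite ltr_pM2l// NE exprn_gt0.
  have : N * b = 2 * (N * a) by rewrite hb; ring.
  by rewrite -mulrA; lra.
pose K' : int := (2 ^ (n1 - d.+2))%N.
have KE : K%:~R * P = 2 ^+ d.+1 * (K'%:~R * P).
  have : 2 * (K%:~R * P) = 2 * (2 ^+ d.+1 * (K'%:~R * P)).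
    rewrite -hNP NE !mulrA -exprS; congr (_ * P).
    by rewrite /K' -[(_ : int)%:~R]/((2 ^ (n1 - d.+2))%N%:R) natrX -exprD subnKC.
  by lra.
rewrite hNe hNb KE => /andP[h1 h2].
have close : `| `|x| - K'%:~R * P| <= a.
  have : 2 * `| `|x| - K'%:~R * P| <= 2 ^+ d.+1 * `| `|x| - K'%:~R * P| by rewrite ler_wpM2r.
  rewrite -[X in _ <= X * _](ger0_norm (ltW t0)) -normrM mulrBr.
  have : `|2 ^+ d.+1 * `|x| - 2 ^+ d.+1 * (K'%:~R * P)| <= a.
    by rewrite ler_norml; apply/andP; split; lra.
  by lra.
have [x0|x0] := leP 0 x.
  by rewrite (ger0_norm x0) in close; have := far K'; rewrite ltNge close.
rewrite (ltr0_norm x0) in close; have := far (- K').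
by rewrite mulrNz mulNr -normrN opprB addrC ltNge close.
Qed.

Definition transform_vanishes D f :=
  L2 f /\ exists2 F, fourier_L2 f F & {ae mu, forall x, D x -> F x = 0}.

Lemma lin_span_transform_vanishes D (G : set (R -> C)) g :
  (forall f, G f -> transform_vanishes D f) -> lin_span G g -> transform_vanishes D g.
Proof.
move=> GD [m [h [c [Gh ->]]]]; elim: m h c Gh => [|m IH] h c Gh.
  have -> : (fun x : R => \sum_(i < 0) c i * h i x) = (fun=> 0).
    by apply/funext => x; rewrite big_ord0.
  split; first exact: L2_0.
  have [F FF] := fourier_L2_exists L2_0; exists F => //.
  have n0 : nrm2 (fun=> 0) = 0.
    by rewrite /nrm2; under eq_Rintegral do rewrite sqmod0; rewrite Rintegral_cst// mul0r.
  have [LF _] := FF; have := fourier_L2_nrm2 L2_0 FF; rewrite n0 mulr0 => /(nrm2_eq0 LF).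
  by move/ae_imp; apply.
pose w (i : 'I_m) := widen_ord (leqnSn m) i.
have [Ls [F FF F0]] := IH _ (fun i => c (w i)) (fun i => Gh (w i)).
have [Lh [H HF H0]] := GD _ (Gh ord_max).
have -> : (fun x => \sum_(i < m.+1) c i * h i x) =
    (fun x => (\sum_(i < m) c (w i) * h (w i) x) + c ord_max * h ord_max x).
  by apply/funext => x; rewrite big_ord_recr.
split; first by apply: L2D => //; exact: L2Z.
exists (fun x => F x + c ord_max * H x); first exact: fourier_L2_lin.
by apply: (ae_imp2 F0 H0) => x f0 g0 Dx; rewrite f0// g0// mulr0 addr0.
Qed.

(** On [D] the transform [F] equals [F - G] for each approximant, so its norm there is at most
    [2 pi] times the squared distance from [f] to [g]. *)
Lemma closure_transform_vanishes D (W : set (R -> C)) f F : measurable D ->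
  (forall g, W g -> transform_vanishes D g) -> closure_L2 W f -> fourier_L2 f F ->
  {ae mu, forall x, D x -> F x = 0}.
Proof.
move=> mD WD [Lf cf] FF; have [LF _] := FF.
have LcF := L2_cut mD LF.
suff : nrm2 (cut D F) = 0.
  move=> /(nrm2_eq0 LcF); move/ae_imp; apply => x + Dx.
  by rewrite cut_in.
have pi2 : 0 < 2 * pi :> R by rewrite mulr_gt0// pi_gt0.
apply/eqP; rewrite eq_le nrm2_ge0 andbT; apply/ler_addgt0Pl => eps eps0; rewrite addr0.
have [|g [Wg]] := cf (eps / (2 * pi)); first by rewrite divr_gt0.
have [Lg [G GF G0]] := WD _ Wg; have [LG _] := GF.
rewrite l2dist2E// lte_fin ltr_pdivlMr// mulrC.
have FGF : fourier_L2 (fun x => f x - g x) (fun x => F x - G x).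
  have -> : (fun x => f x - g x) = (fun x => f x + (-1) * g x) by apply/funext => x; rewrite mulN1r.
  have -> : (fun x => F x - G x) = (fun x => F x + (-1) * G x) by apply/funext => x; rewrite mulN1r.
  exact: fourier_L2_lin.
rewrite -(fourier_L2_nrm2 _ FGF)//; last exact: L2B.
move/ltW; apply: le_trans.
have -> : nrm2 (cut D F) = nrm2 (cut D (fun x => F x - G x)).
  apply: ae_eq_nrm2; [exact: L2_cmeasurable| |].
    by apply: L2_cmeasurable; apply: L2_cut => //; exact: L2B.
  apply: (ae_imp G0) => x Gx; have [Dx|nDx] := pselect (D x).
    by rewrite !cut_in// Gx// subr0.
  by rewrite !cut_out.
apply: le_nrm2; [|exact: L2B|by move=> x; exact: sqmod_cut_le].
by apply: L2_cmeasurable; apply: L2_cut => //; exact: L2B.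
Qed.

Lemma not_MRA_wavelet (N u a b e P : R) (K : int) n1 (psi psih : R -> C) :
  tiling N u a b e P K -> N = 2 ^+ n1 -> a < e -> L2 psi -> fourier_L2 psi psih ->
  {ae mu, forall x, ~ in_band N a b e x -> psih x = 0} -> ~ MRA_wavelet psi.
Proof.
move=> T NE ae Lpsi Fpsi h0 [_ [_ _ _ _ [phi [[Lphi ophi] [Vphi _]]]]].
have [hu ha hb he hP hpi _ _ _ _ _] := T.
have phi0 : (fun x => phi (x - 0%:~R)) = phi by apply/funext => x; rewrite subr0.
have Lp : L2 phi by have := Lphi 0; rewrite phi0.
have [F FF] := fourier_L2_exists Lp; have [LF _] := FF.
have F0 : {ae mu, forall x, forall k : int, a < x - k%:~R * P < e -> F x = 0}.
  apply: ae_forall_int => k.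
  have itvE x : `]a + k%:~R * P, e + k%:~R * P[%classic x <-> a < x - k%:~R * P < e.
    by rewrite /= in_itv/=; split=> /andP[? ?]; apply/andP; split; lra.
  have := @closure_transform_vanishes `]a + k%:~R * P, e + k%:~R * P[ _ phi F (measurable_itv _) _ _ FF.
  have := Vphi 0; rewrite phi0 => Vp /(_ _ _ Vp) h.
  apply: (ae_imp (h _)) => [g|x hx xk]; last first.
    by apply: hx; apply/itvE.
  apply: lin_span_transform_vanishes => {}g [l [m [l0 ->]]]; split; first exact: L2_psi_jk.
  exists (psih_jk psih l m); first exact: fourier_psi_jk.
  (* Only negative scales enter [V_0]; at [l = Negz d] the transform evaluates [psih] at
     [2^(d+1) * x]. *)
  case: l l0 => // d _.
  have s0 : 0 < (2 : R) ^+ d.+1 by rewrite exprn_gt0.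
  have := @ae_affine (2 ^+ d.+1) 0 _ s0 h0; move/ae_imp; apply => x.
  rewrite addr0 /psih_jk => hx /itvE xk.
  rewrite (_ : x / 2 ^ Negz d = 2 ^+ d.+1 * x) ?hx ?mulr0//; last by rewrite /exprz /= invrK mulrC.
  exact: band_avoids_dilates T NE xk.
have iH : cintegrable (fun y => F y * (F y)^*%C) by exact: L2_mul_cintegrable.
have mom (k : int) : cint setT (fun y => F y * (F y)^*%C * expi (k%:~R * y)) =
    (if k == 0 then 1 * (2 * pi) else 0)%:C.
  have psiE : psi_jk phi 0 k = (fun x => phi (x - k%:~R)).
    by apply/funext => x; rewrite /psi_jk expr0z sqrtr1 !mul1r.
  have [inner1 inner0] := ophi 0 k; rewrite phi0 -psiE in inner1 inner0.
  have cE : cint setT (fun y => F y * (F y)^*%C * expi (k%:~R * y)) = corr F 0 k.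
    by rewrite /corr; apply: eq_cint => y _; rewrite expr0 mul1r.
  have := corr_translates k Lp FF; rewrite cE => cc.
  have -> : corr F 0 k = (2 * pi)%:C * cinner phi (psi_jk phi 0 k).
    by rewrite cc mulrA -rmorphM /= divff ?mul1r// gt_eqF// mulr_gt0// pi_gt0.
  have [k0|k0] := eqVneq k 0; first by rewrite inner1// mulr1 mul1r.
  by rewrite inner0 ?mulr0//; apply/eqP; rewrite eq_sym.
have S : {ae mu, forall x, a < x < e -> \sum_(k <- [:: 0 : int]) (F (x + k%:~R * (2 * pi)) *
    (F (x + k%:~R * (2 * pi)))^*%C) = (1 : R)%:C}.
  apply: (periodization_cst iH _ _ _ mom) => //; first by rewrite -hpi; lra.
  by apply: (ae_imp F0) => x h k _ xk; rewrite (h k) ?mul0r// hpi.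
(* Over []a, e[] the only term left in the fibre sum is 0 although the sum is 1, while the interval
   has positive measure. *)
have : {ae mu, forall x, ~ `]a, e[%classic x}.
  apply: (ae_imp2 F0 S) => x h s xae; have := h 0; rewrite mul0r subr0 => /(_ xae) Fx.
  have := s xae; rewrite big_seq1 mul0r addr0 Fx mul0r => /(congr1 (@complex.Re _))/= /eqP.
  by rewrite eq_sym oner_eq0.
move=> neg; have : mu `]a, e[%classic = 0%E.
  apply: measure_negligible; first exact: measurable_itv.
  apply: negligibleS neg => x xae; apply.
  exact: xae.
rewrite lebesgue_measure_itv/= lte_fin ae => /eqP.
by rewrite -EFinB eqe subr_eq0 gt_eqF.
Qed.

End ComplexL2.

Theorem theorem3p1 (R : realType) (n : nat) (psi psih : R -> R[i]) :
  (2 <= n)%N ->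
  L2 psi ->
  fourier_L2 psi psih ->
  {ae (@lebesgue_measure R), forall xi, ~ S_n n xi -> psih xi = 0} ->
  let b := fun xi => cabs (psih xi) in
  let N := (2 : R) ^+ n.-1 in
  (is_wavelet psi <->
   [/\ {ae (@lebesgue_measure R), forall xi,
          (xi \in `[a_n n, e_n n] \/ xi \in `[- e_n n, - a_n n]) -> b xi = 1},
       {ae (@lebesgue_measure R), forall xi,
          xi \in `[e_n n, b_n n] -> b xi ^+ 2 + b (N * xi) ^+ 2 = 1},
       {ae (@lebesgue_measure R), forall xi,
          xi \in `[e_n n, b_n n] -> b xi ^+ 2 + b (xi - 2 * pi) ^+ 2 = 1},
       {ae (@lebesgue_measure R), forall xi,
          xi \in `[e_n n, b_n n] -> b xi = b (N * (xi - 2 * pi))}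
     & exists theta : R -> R,
         [/\ measurable_fun [set: R] theta,
             {ae (@lebesgue_measure R), forall xi,
                psih xi = expi (theta xi) * (b xi)%:C}
           & {ae (@lebesgue_measure R), forall xi,
                xi \in `[e_n n, b_n n] -> fsupp b xi ->
                scale_set (1 / N) (fsupp b) xi ->
                exists m : int,
                  theta xi + theta (N * (xi - 2 * pi))
                  - theta (xi - 2 * pi) - theta (N * xi)
                  = (2 * m%:~R + 1) * pi}]]) /\
  ((3 <= n)%N -> is_wavelet psi -> ~ MRA_wavelet psi).
Proof.
move=> n2 Lpsi Fpsi psih0 b N.
have [T _ _ ea] := @tiling_constants R n n2.
have h0 : {ae (@lebesgue_measure R), forall x,
    ~ in_band N (a_n n) (b_n n) (e_n n) x -> psih x = 0}.
  by apply: (ae_imp psih0) => x + nB; apply => /(in_band_S_n _ n2).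
have mh : cmeasurable psih by have [/L2_cmeasurable] := Fpsi.
have wavelet_unitary : is_wavelet psi <->
    unitary_fibres N (a_n n) (b_n n) (e_n n) (2 * pi) psih.
  rewrite -(orthonormal_unitary_fibres T erefl Lpsi Fpsi h0).
  split=> [[]//|o]; split=> //; split=> [jk|]; first exact: L2_psi_jk.
  apply: (complete_unitary_fibres T erefl Lpsi Fpsi h0).
  exact/(orthonormal_unitary_fibres T erefl Lpsi Fpsi h0).
split; first exact: iff_trans wavelet_unitary (unitary_fibres_moduli T mh).
move=> n3 _; apply: (not_MRA_wavelet T erefl _ Lpsi Fpsi h0).
rewrite -subr_gt0 ea mulr_gt0//.
  rewrite subr_gt0 -[X in X < _]expr1 ltr_eXn2l ?ltr1n//.
  by case: n n3 {n2 T h0 wavelet_unitary ea psih0 N} => [|[|[]]].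
by rewrite divr_gt0 ?pi_gt0// subr_gt0 -[X in X < _](expr0 2) ltr_eXn2l ?ltr1n// (leq_trans _ n2).
Qed.
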